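(* There is an absolute constant $C>0$ such that the following holds. Let $d,k\in\mathbb{N}$, $z\ge 1$, let $X=\{x_1,\dots,x_n\}\subset\mathbb{R}^d$ be any set of points, and let $L=\{\ell_1,\dots,\ell_k\}$ be a set of $k$ lines in $\mathbb{R}^d$ giving an optimal $(k,z)$-line approximation of $X$, i.e. minimizing $\mathrm{cost}_z(X,\cdot)$ over all sets of $k$ lines in $\mathbb{R}^d$. Let $\varepsilon\in(0,1)$ and $$t\ \ge\ C\cdot\frac{k\log\log n+z+\log(1/\varepsilon)}{\varepsilon^3}.$$ Then with probability at least $0.9$ over the draw of $\Pi\sim\mathcal{J}_{d,t}$, $$\frac{1}{1+\varepsilon}\,\mathrm{cost}_z(X,L)\ \le\ \min_{L'\ \text{a set of $k$ lines in }\mathbb{R}^t}\mathrm{cost}_z(\Pi(X),L')\ \le\ (1+\varepsilon)\,\mathrm{cost}_z(X,L).$$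
   Context: $\mathcal{J}_{d,t}$ denotes the distribution of the linear map $\Pi:\mathbb{R}^d\to\mathbb{R}^t$, $x\mapsto Gx$, where $G$ is a $t\times d$ matrix with i.i.d. $\mathcal{N}(0,1/t)$ entries. A line in $\mathbb{R}^m$ is a set $\{v+su:s\in\mathbb{R}\}$ with $v\in\mathbb{R}^m$ and $u$ a unit vector; $\rho_\ell(x)$ denotes the closest point of the line $\ell$ to $x$. For a finite $Y\subset\mathbb{R}^m$ and a finite set $L$ of lines, $\mathrm{cost}_z(Y,L)=\big(\sum_{y\in Y}\min_{\ell\in L}\|y-\rho_\ell(y)\|_2^z\big)^{1/z}$. *)

(* Defs.v *)
From HB Require Import structures.
From mathcomp Require Import all_boot all_order all_algebra finmap.
From mathcomp Require Import all_classical all_reals all_analysis.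
Set Implicit Arguments.
Unset Strict Implicit.
Unset Printing Implicit Defensive.
Import Order.TTheory GRing.Theory Num.Theory.
Local Open Scope classical_set_scope.
Local Open Scope ring_scope.

(* The norm `|x| that the library puts on 'cV[R]_m is the sup norm. *)
Definition norm2 (R : realType) (m : nat) (x : 'cV[R]_m) : R :=
  Num.sqrt (\sum_(i < m) x i 0 ^+ 2).

Definition is_line (R : realType) (m : nat) (l : set 'cV[R]_m) : Prop :=
  exists v u : 'cV[R]_m,
    norm2 u = 1 /\ l = [set v + s *: u | s in [set: R]].

(* For l a line the closest point exists and is unique, so neither the choice
   made by xget nor its default value 0 matters. *)
Definition closest_point (R : realType) (m : nat) (l : set 'cV[R]_m)
    (x : 'cV[R]_m) : 'cV[R]_m :=
  xget 0 [set p | l p /\ forall q, l q -> norm2 (x - p) <= norm2 (x - q)].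

(* A set of k lines {l_1, ..., l_k} is a family indexed by 'I_k (repetitions
   are allowed). For 0 < k the infimum is over a finite nonempty set of reals,
   hence a minimum. *)
Definition cost (R : realType) (m k : nat) (z : R) (Y : {fset 'cV[R]_m})
    (L : 'I_k -> set 'cV[R]_m) : R :=
  (\sum_(y <- Y)
     inf [set norm2 (y - closest_point (L i) y) `^ z | i in [set: 'I_k]])
  `^ z^-1.

Definition optimal_lines (R : realType) (m k : nat) (z : R)
    (Y : {fset 'cV[R]_m}) (L : 'I_k -> set 'cV[R]_m) : Prop :=
  (forall i, is_line (L i)) /\
  (forall L' : 'I_k -> set 'cV[R]_m,
     (forall i, is_line (L' i)) -> cost z Y L <= cost z Y L').

Definition mutually_independent (R : realType) (disp : measure_display)
    (T : measurableType disp) (P : probability T R) (I : finType)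
    (X : I -> {RV P >-> R}) : Prop :=
  forall (J : {set I}) (B : I -> set R), (forall i, measurable (B i)) ->
    P (\bigcap_(i in [set` J]) (X i @^-1` B i)) =
    (\prod_(i in J) P (X i @^-1` B i))%E.

(* The second parameter of normal_prob is the standard deviation. *)
Definition iid_gaussian_entries (R : realType) (disp : measure_display)
    (T : measurableType disp) (P : probability T R) (t d : nat)
    (G : 'I_t * 'I_d -> {RV P >-> R}) : Prop :=
  mutually_independent G /\
  forall ij (A : set R), measurable A ->
    distribution P (G ij) A = normal_prob 0 (Num.sqrt (t%:R^-1)) A.

Definition random_matrix (R : realType) (disp : measure_display)
    (T : measurableType disp) (P : probability T R) (t d : nat)
    (G : 'I_t * 'I_d -> {RV P >-> R}) (w : T) : 'M[R]_(t, d) :=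
  \matrix_(i, j) G (i, j) w.

Definition linear_image (R : realType) (t d : nat) (M : 'M[R]_(t, d))
    (X : {fset 'cV[R]_d}) : {fset 'cV[R]_t} :=
  [fset M *m x | x in X]%fset.

(* "E holds with probability at least p": phrased through an event contained
   in E because a measure has no meaningful value on a non-measurable set. For
   measurable E this is p <= P E. *)
Definition with_prob_ge (R : realType) (disp : measure_display)
    (T : measurableType disp) (P : probability T R) (p : R) (E : set T) : Prop :=
  exists A : set T, [/\ measurable A, A `<=` E & (p%:E <= P A)%E].

(* Main.v *)
(* The upper bound maps the optimal lines forward: an exponential moment bound
   controls the total expansion of the residuals.

   For the lower bound, lines in R^t are lifted back to R^d. Let each point carry
   a parameter [s] on its nearest projected line, at distance at most [r]. The
   vectors (s_k - s_j) x_i + (s_i - s_k) x_j + (s_j - s_i) x_k kill every affine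
   function of [s] and lie in the plane of the triple, so a map that does not
   contract the planes of triples does not shrink them; a Gram determinant
   identity for weighted regression turns this into a Kirszbraun-type statement:
   some line in R^d serves all points at distance [c r]. For a random map only
   most triples are good, with respect to a measure [mu]; a greedy choice of
   boundedly many points then yields a line that fails only on a set of small
   [mu]-measure. Taking for [mu] the sensitivities of the union of k lines, of
   total mass O(k 2^k ln n), the failing points contribute a small fraction of
   the cost. The failure probability of a triple is e^(-c eps^2 t), so
   t ~ (k ln ln n + z + ln (1 / eps)) / eps^3 beats the mass of [mu]. *)
Require Import Defs.
From HB Require Import structures.
From mathcomp Require Import all_boot all_order all_algebra finmap.
From mathcomp Require Import all_classical all_reals all_analysis.
From mathcomp Require Import measurable_realfun ring lra zify.
Set Implicit Arguments.
Unset Strict Implicit.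
Unset Printing Implicit Defensive.
Import Order.TTheory GRing.Theory Num.Theory.
Import numFieldNormedType.Exports.
Local Open Scope classical_set_scope.
Local Open Scope ring_scope.

(** * Inner products and the weighted Gram identity *)

(** The lines that are best in the image depend on the random map, so the lower bound must hold for
    all families of lines at once, and a union bound over triples of points would force [t] to grow
    like [ln n]. Only the mean of the [mu]-weighted number of bad triples is estimated, and Markov's
    inequality turns it into one event. The total mass of [mu] enters cubed, against [delta ^+ 3]:
    fixing the points of a triple one after the other costs one factor [delta] each. The lift loses
    mass of order [k * delta], up to a power of [1 / eps], and sensitivities convert mass into cost
    at the price [20 ^ z]; so [delta] has to undercut all of these, which is where [z] and
    [ln (1 / eps)] come from. The factor [2 ^ k] in the mass is a bounded power of [(ln n) ^ k] as
    soon as [n >= 3]. For [n <= 2] the optimal cost is 0 and the iterated logarithm says nothing;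
    this case is separate. Moreover the image of [X] is a set, in which coinciding images would be
    counted once, so injectivity on [X] is a further random event to secure. *)

Definition dot (R : realType) (m : nat) (x y : 'cV[R]_m) : R :=
  \sum_(i < m) x i 0 * y i 0.

Lemma dotC (R : realType) m (x y : 'cV[R]_m) : dot x y = dot y x.
Proof. by apply: eq_bigr => i _; rewrite mulrC. Qed.

Lemma dotDl (R : realType) m (x y w : 'cV[R]_m) :
  dot (x + y) w = dot x w + dot y w.
Proof. by rewrite -big_split; apply: eq_bigr => i _ /=; rewrite mxE mulrDl. Qed.

Lemma dotDr (R : realType) m (x y w : 'cV[R]_m) :
  dot w (x + y) = dot w x + dot w y.
Proof. by rewrite dotC dotDl !(dotC w). Qed.

Lemma dotZl (R : realType) m a (x y : 'cV[R]_m) : dot (a *: x) y = a * dot x y.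
Proof. by rewrite mulr_sumr; apply: eq_bigr => i _ /=; rewrite mxE mulrA. Qed.

Lemma dotZr (R : realType) m a (x y : 'cV[R]_m) : dot x (a *: y) = a * dot x y.
Proof. by rewrite dotC dotZl dotC. Qed.

Lemma dotNl (R : realType) m (x y : 'cV[R]_m) : dot (- x) y = - dot x y.
Proof. by rewrite -scaleN1r dotZl mulN1r. Qed.

Lemma dotNr (R : realType) m (x y : 'cV[R]_m) : dot x (- y) = - dot x y.
Proof. by rewrite dotC dotNl dotC. Qed.

Lemma dot0l (R : realType) m (x : 'cV[R]_m) : dot 0 x = 0.
Proof. by rewrite -(scale0r 0) dotZl mul0r. Qed.

Lemma dot0r (R : realType) m (x : 'cV[R]_m) : dot x 0 = 0.
Proof. by rewrite dotC dot0l. Qed.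

Lemma dot_suml (R : realType) m (I : Type) (r : seq I) (P : pred I)
    (F : I -> 'cV[R]_m) y :
  dot (\sum_(i <- r | P i) F i) y = \sum_(i <- r | P i) dot (F i) y.
Proof.
elim/big_rec2: _ => [|i a b _ <-]; first by rewrite dot0l.
by rewrite dotDl.
Qed.

Definition dotE := (dotDl, dotDr, dotNl, dotNr, dotZl, dotZr).

Lemma dot_ge0 (R : realType) m (x : 'cV[R]_m) : 0 <= dot x x.
Proof. by apply: sumr_ge0 => i _; rewrite -expr2 sqr_ge0. Qed.

Lemma dot_eq0 (R : realType) m (x : 'cV[R]_m) : (dot x x == 0) = (x == 0).
Proof.
apply/idP/eqP => [|->]; last by rewrite dot0l.
rewrite psumr_eq0 => [|i _]; last by rewrite -expr2 sqr_ge0.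
move=> /allP h; apply/matrixP => i j; rewrite ord1 mxE.
by have := h i (mem_index_enum i); rewrite /= -expr2 sqrf_eq0 => /eqP.
Qed.

Lemma norm2_sqr (R : realType) m (x : 'cV[R]_m) : norm2 x ^+ 2 = dot x x.
Proof.
rewrite sqr_sqrtr; last by apply: sumr_ge0 => i _; rewrite sqr_ge0.
by apply: eq_bigr => i _; rewrite expr2.
Qed.

Lemma norm2_ge0 (R : realType) m (x : 'cV[R]_m) : 0 <= norm2 x.
Proof. exact: sqrtr_ge0. Qed.

Lemma norm2E (R : realType) m (x : 'cV[R]_m) : norm2 x = Num.sqrt (dot x x).
Proof. by rewrite -norm2_sqr sqrtr_sqr ger0_norm ?norm2_ge0. Qed.

Lemma norm2Z (R : realType) m a (x : 'cV[R]_m) : norm2 (a *: x) = `|a| * norm2 x.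
Proof.
by rewrite !norm2E !dotE mulrA -expr2 sqrtrM ?sqr_ge0// sqrtr_sqr.
Qed.

Lemma norm2N (R : realType) m (x : 'cV[R]_m) : norm2 (- x) = norm2 x.
Proof. by rewrite !norm2E !dotE opprK. Qed.

Lemma norm2_eq0 (R : realType) m (x : 'cV[R]_m) : (norm2 x == 0) = (x == 0).
Proof. by rewrite -dot_eq0 -norm2_sqr sqrf_eq0. Qed.

Lemma norm20 (R : realType) m : norm2 (0 : 'cV[R]_m) = 0.
Proof. by apply/eqP; rewrite norm2_eq0. Qed.

Lemma CauchySchwarz (R : realType) m (x y : 'cV[R]_m) :
  dot x y ^+ 2 <= dot x x * dot y y.
Proof.
have [->|y0] := eqVneq y 0; first by rewrite !dot0r expr0n mulr0.
have yy : 0 < dot y y by rewrite lt_def dot_eq0 y0 dot_ge0.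
have := dot_ge0 (dot y y *: x - dot x y *: y).
rewrite !dotE (dotC y x) => h.
have {h} : 0 <= dot y y * (dot x x * dot y y - dot x y ^+ 2) by lra.
by rewrite pmulr_rge0// subr_ge0.
Qed.

Lemma dot_le_norm2 (R : realType) m (x y : 'cV[R]_m) :
  dot x y <= norm2 x * norm2 y.
Proof.
rewrite (le_trans (ler_norm _))// -ler_sqr ?nnegrE ?mulr_ge0 ?norm2_ge0//.
by rewrite exprMn !norm2_sqr real_normK ?num_real ?CauchySchwarz.
Qed.

Lemma norm2D (R : realType) m (x y : 'cV[R]_m) :
  norm2 (x + y) <= norm2 x + norm2 y.
Proof.
rewrite -ler_sqr ?nnegrE ?addr_ge0 ?norm2_ge0// norm2_sqr !dotE (dotC y x).
rewrite sqrrD !norm2_sqr; have := dot_le_norm2 x y; lra.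
Qed.

Lemma norm2B (R : realType) m (x y : 'cV[R]_m) :
  norm2 (x - y) <= norm2 x + norm2 y.
Proof. by rewrite (le_trans (norm2D _ _))// norm2N. Qed.

Lemma norm2_distC (R : realType) m (x y : 'cV[R]_m) :
  norm2 (x - y) = norm2 (y - x).
Proof. by rewrite -norm2N opprB. Qed.

(** Reduces a sum of quadratic polynomials in [s i], [e i] to six weighted moments, so that a triple
    sum can be evaluated one index at a time, each stage ending in a [ring] identity. *)
Lemma sum_quadratic (R : realType) (I : finType) (q s e : I -> R) a b c d f g :
  \sum_i q i * (a + b * s i + c * e i + d * s i ^+ 2 + f * (s i * e i)
                + g * e i ^+ 2) =
  a * (\sum_i q i) + b * (\sum_i q i * s i) + c * (\sum_i q i * e i)
  + d * (\sum_i q i * s i ^+ 2) + f * (\sum_i q i * (s i * e i))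
  + g * (\sum_i q i * e i ^+ 2).
Proof.
rewrite !mulr_sumr -!big_split /=; apply: eq_bigr => i _; ring.
Qed.

(* Cauchy-Binet: the left-hand side is 6 times the Gram determinant of the
   three functions 1, s, e in the weighted space L^2(q). *)
Lemma gram_determinant (R : realType) (I : finType) (q s e : I -> R) :
  \sum_i \sum_j \sum_k q i * q j * q k *
    ((s k - s j) * e i + (s i - s k) * e j + (s j - s i) * e k) ^+ 2 =
  6 * ((\sum_i q i) * (\sum_i q i * s i ^+ 2) - (\sum_i q i * s i) ^+ 2)
    * (\sum_i q i * e i ^+ 2)
  - 6 * ((\sum_i q i * s i ^+ 2) * (\sum_i q i * e i) ^+ 2
     - 2 * (\sum_i q i * s i) * (\sum_i q i * e i) * (\sum_i q i * (s i * e i))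
     + (\sum_i q i) * (\sum_i q i * (s i * e i)) ^+ 2).
Proof.
set M0 := \sum_i q i; set M1 := \sum_i q i * s i.
set M2 := \sum_i q i * s i ^+ 2; set U := \sum_i q i * e i.
set W := \sum_i q i * (s i * e i); set A2 := \sum_i q i * e i ^+ 2.
have sumk i j : \sum_k q i * q j * q k *
    ((s k - s j) * e i + (s i - s k) * e j + (s j - s i) * e k) ^+ 2 =
    q j * (q i * ((s i * e j - s j * e i) ^+ 2 * M0
      + 2 * (s i * e j - s j * e i) * (e i - e j) * M1
      + 2 * (s i * e j - s j * e i) * (s j - s i) * U
      + (e i - e j) ^+ 2 * M2 + 2 * (e i - e j) * (s j - s i) * W
      + (s j - s i) ^+ 2 * A2)).
  rewrite mulrA -sum_quadratic mulr_sumr; apply: eq_bigr => k _; ring.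
have sumj i : \sum_j \sum_k q i * q j * q k *
    ((s k - s j) * e i + (s i - s k) * e j + (s j - s i) * e k) ^+ 2 =
    q i * ((s i ^+ 2 * A2 - 2 * s i * e i * W + e i ^+ 2 * M2) * M0
      + 2 * (s i * e i * U - s i * A2 - e i ^+ 2 * M1 + e i * W) * M1
      + 2 * (- s i ^+ 2 * U + s i * W + e i * (s i * M1) - e i * M2) * U
      + (e i ^+ 2 * M0 - 2 * e i * U + A2) * M2
      + 2 * (e i * M1 - e i * s i * M0 - W + s i * U) * W
      + (M2 - 2 * s i * M1 + s i ^+ 2 * M0) * A2).
  under eq_bigr do rewrite sumk.
  transitivity (q i * \sum_j q j * (
     (e i ^+ 2 * M2 + 2 * (e i * (- s i)) * W + s i ^+ 2 * A2)
     + (- 2 * e i * e i * M1 + 2 * (e i * s i) * U + 2 * e i * W - 2 * s i * A2) * s j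
     + (2 * s i * e i * M1 - 2 * s i ^+ 2 * U - 2 * e i * M2 + 2 * s i * W) * e j
     + (e i ^+ 2 * M0 - 2 * e i * U + A2) * s j ^+ 2
     + (- 2 * s i * e i * M0 + 2 * e i * M1 + 2 * s i * U - 2 * W) * (s j * e j)
     + (s i ^+ 2 * M0 - 2 * s i * M1 + M2) * e j ^+ 2)).
    rewrite mulr_sumr; apply: eq_bigr => j _; ring.
  rewrite sum_quadratic -/M0 -/M1 -/M2 -/U -/W -/A2; ring.
under eq_bigr do rewrite sumj.
transitivity (\sum_i q i * (
   (A2 * M2 - 2 * W ^+ 2 + M2 * A2)
   + (- 2 * A2 * M1 + 2 * W * U + 2 * U * W - 2 * M1 * A2) * s i
   + (2 * W * M1 - 2 * M2 * U - 2 * U * M2 + 2 * M1 * W) * e i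
   + (A2 * M0 - 2 * U ^+ 2 + M0 * A2) * s i ^+ 2
   + (- 2 * W * M0 + 2 * U * M1 + 2 * M1 * U - 2 * M0 * W) * (s i * e i)
   + (M2 * M0 - 2 * M1 ^+ 2 + M0 * M2) * e i ^+ 2)).
  by apply: eq_bigr => i _; congr (_ * _); ring.
rewrite sum_quadratic -/M0 -/M1 -/M2 -/U -/W -/A2; ring.
Qed.

(** The 3 x 3 determinant with rows [(1, s, x)] at [i, j, k], expanded along the vector column;
    hence alternating in the triple. *)
Definition detv (R : realType) m (I : Type) (s : I -> R) (x : I -> 'cV[R]_m)
    (i j k : I) : 'cV[R]_m :=
  (s k - s j) *: x i + (s i - s k) *: x j + (s j - s i) *: x k.

Lemma detv_affine (R : realType) m (I : Type) (s : I -> R) (x : I -> 'cV[R]_m)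
    v w i j k :
  detv s (fun i => x i - (v + s i *: w)) i j k = detv s x i j k.
Proof. by apply/matrixP => a b; rewrite !mxE; ring. Qed.

Lemma gram_vector (R : realType) m (I : finType) (q s : I -> R)
    (e : I -> 'cV[R]_m) :
  let M0 := \sum_i q i in let M1 := \sum_i q i * s i in
  let M2 := \sum_i q i * s i ^+ 2 in
  let U := \sum_i q i *: e i in let W := \sum_i (q i * s i) *: e i in
  \sum_i \sum_j \sum_k q i * q j * q k *
    dot (detv s e i j k) (detv s e i j k) =
  6 * (M0 * M2 - M1 ^+ 2) * (\sum_i q i * dot (e i) (e i))
  - 6 * (M2 * dot U U - 2 * M1 * dot U W + M0 * dot W W).
Proof.
move=> M0 M1 M2 U W.
transitivity (\sum_(c < m) \sum_i \sum_j \sum_k q i * q j * q k *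
    ((s k - s j) * e i c 0 + (s i - s k) * e j c 0
     + (s j - s i) * e k c 0) ^+ 2).
  rewrite [RHS]exchange_big; apply: eq_bigr => i _ /=.
  rewrite [RHS]exchange_big; apply: eq_bigr => j _ /=.
  rewrite [RHS]exchange_big; apply: eq_bigr => k _ /=.
  by rewrite mulr_sumr; apply: eq_bigr => c _; rewrite !mxE expr2.
under eq_bigr do rewrite gram_determinant.
rewrite -/M0 -/M1 -/M2 big_split /= sumrN -!mulr_sumr; congr (_ * _ - 6 * _).
  rewrite exchange_big; apply: eq_bigr => i _ /=.
  by rewrite mulr_sumr; apply: eq_bigr => c _; rewrite expr2.
rewrite !mulr_sumr -sumrN -!big_split /=; apply: eq_bigr => c _.
have -> : \sum_i q i * e i c 0 = U c 0.
  by rewrite summxE; apply: eq_bigr => i _; rewrite mxE.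
have -> : \sum_i q i * (s i * e i c 0) = W c 0.
  by rewrite summxE; apply: eq_bigr => i _; rewrite mxE mulrA.
ring.
Qed.

(** Lagrange's identity. The inequality alone would not do: the left-hand side is later divided out,
    so it must be strictly positive once two positively weighted parameters differ. *)
Lemma moments_CauchySchwarz (R : realType) (I : finType) (q s : I -> R) :
  (forall i, 0 <= q i) ->
  (\sum_i q i) * (\sum_i q i * s i ^+ 2) - (\sum_i q i * s i) ^+ 2
  = 2^-1 * \sum_i \sum_j q i * q j * (s i - s j) ^+ 2.
Proof.
move=> q0; set M0 := \sum_i q i; set M1 := \sum_i q i * s i.
set M2 := \sum_i q i * s i ^+ 2.
have E i : \sum_j q i * q j * (s i - s j) ^+ 2 =
    q i * (M2 + (- 2 * M1) * s i + 0 * 0 + M0 * s i ^+ 2 + 0 * (s i * 0) + 0 * 0 ^+ 2).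
  transitivity (q i * \sum_j q j * (s i ^+ 2 + (- 2 * s i) * s j + 0 * 0 + 1 * s j ^+ 2 + 0 * (s j * 0) + 0 * 0 ^+ 2)).
    by rewrite mulr_sumr; apply: eq_bigr => j _; ring.
  rewrite (sum_quadratic q s (fun=> 0)) -/M0 -/M1 -/M2; ring.
under eq_bigr do rewrite E.
rewrite (sum_quadratic q s (fun=> 0)) -/M0 -/M1 -/M2.
by field.
Qed.

(* If [e] is the residual of the [q]-weighted least-squares regression on
   [1] and [s], then the triple sum of [gram_vector] loses its correction term
   for [e], while for any other [e'] the correction term is nonpositive. *)
Lemma weighted_residual_le (R : realType) d t (I : finType) (q s : I -> R)
    (e : I -> 'cV[R]_d) (e' : I -> 'cV[R]_t) (c : R) :
  0 <= c -> (forall i, 0 <= q i) ->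
  \sum_i q i *: e i = 0 -> \sum_i (q i * s i) *: e i = 0 ->
  (forall i j k, 0 < q i -> 0 < q j -> 0 < q k ->
     dot (detv s e i j k) (detv s e i j k) <=
     c * dot (detv s e' i j k) (detv s e' i j k)) ->
  (forall i j, 0 < q i -> 0 < q j -> s i = s j -> i = j) ->
  \sum_i q i * dot (e i) (e i) <= c * \sum_i q i * dot (e' i) (e' i).
Proof.
move=> c0 q0 U0 W0 det_le s_inj.
have E'0 : 0 <= \sum_i q i * dot (e' i) (e' i).
  by apply: sumr_ge0 => i _; rewrite mulr_ge0 ?dot_ge0.
(* If all positively weighted parameters agree, injectivity leaves at most one index of positive
   weight, and the first normal equation kills its residual. *)
have [/existsP[i /existsP[j /and3P[qi qj sij]]]|/existsPn sEq] :=
    boolP [exists i, exists j, [&& 0 < q i, 0 < q j & s i != s j]]; last first.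
  have [i qi|q_eq0] := pickP (fun i => 0 < q i); last first.
    rewrite big1 ?mulr_ge0// => i _; have := q_eq0 i.
    by rewrite lt_def q0 andbT => /negbFE/eqP ->; rewrite mul0r.
  have qj j : j != i -> q j = 0.
    apply: contraNeq => qj.
    have qj0 : 0 < q j by rewrite lt_def qj q0.
    have /existsPn/(_ j) := sEq i; rewrite qi qj0 /= negbK => /eqP sij.
    by rewrite (s_inj _ _ qi qj0 sij).
  rewrite [leLHS](bigD1 i)//= big1 => [|j /qj ->]; last by rewrite mul0r.
  move: U0; rewrite (bigD1 i)//= big1 => [|j /qj ->]; last by rewrite scale0r.
  rewrite addr0 => /eqP; rewrite scaler_eq0 gt_eqF//= => /eqP ->.
  by rewrite dot0l mulr0 addr0 mulr_ge0.
have MM := moments_CauchySchwarz s q0.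
set V := _ - _ in MM.
have V0 : 0 < V.
  rewrite MM mulr_gt0 ?invr_gt0// (bigD1 i)//=; apply: ltr_wpDr.
    by apply: sumr_ge0 => a _; apply: sumr_ge0 => b _; rewrite mulr_ge0 ?sqr_ge0 ?mulr_ge0.
  rewrite (bigD1 j)//=; apply: ltr_wpDr.
    by apply: sumr_ge0 => a _; rewrite mulr_ge0 ?sqr_ge0 ?mulr_ge0.
  by apply: mulr_gt0; [exact: mulr_gt0|rewrite exprn_even_gt0//= subr_eq0].
have := gram_vector q s e; have /= := gram_vector q s e'.
rewrite -/V U0 W0 !dot0l !mulr0 subr0 addr0 mulr0 subr0 => ge' ge.
(* Positive semidefiniteness of the correction: [M0] times this form is
   [|M1 U - M0 W|^2 + V |U|^2]. *)
have corr : 0 <= (\sum_i q i * s i ^+ 2) *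
      dot (\sum_i q i *: e' i) (\sum_i q i *: e' i) -
     2 * (\sum_i q i * s i) *
      dot (\sum_i q i *: e' i) (\sum_i (q i * s i) *: e' i) +
     (\sum_i q i) *
      dot (\sum_i (q i * s i) *: e' i) (\sum_i (q i * s i) *: e' i).
  set M0 := \sum_i q i; set M1 := \sum_i q i * s i.
  set U := \sum_i q i *: e' i; set W := \sum_i _ *: e' i.
  set M2 := \sum_i _ * _ ^+ 2.
  have M00 : 0 < M0.
    by rewrite /M0 (bigD1 i)//=; apply: ltr_wpDr => //; apply: sumr_ge0.
  rewrite -(pmulr_rge0 _ M00).
  have := dot_ge0 (M1 *: U - M0 *: W); rewrite !dotE (dotC W U) => h.
  have := mulr_ge0 (ltW V0) (dot_ge0 U); rewrite /V -/M0 -/M1 -/M2 => h2.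
  lra.
have : 6 * V * (\sum_i q i * dot (e i) (e i)) <=
       c * (6 * V * (\sum_i q i * dot (e' i) (e' i))).
  rewrite -ge (@le_trans _ _ (c * \sum_i \sum_j \sum_k q i * q j * q k *
    dot (detv s e' i j k) (detv s e' i j k)))//; last first.
    by rewrite ler_wpM2l// ge' lerBlDr lerDl; lra.
  rewrite mulr_sumr; apply: ler_sum => i1 _.
  rewrite mulr_sumr; apply: ler_sum => i2 _.
  rewrite mulr_sumr; apply: ler_sum => i3 _.
  have [q1|q1] := eqVneq (q i1) 0; first by rewrite q1 !mul0r mulr0.
  have [q2|q2] := eqVneq (q i2) 0; first by rewrite q2 !(mul0r,mulr0).
  have [q3|q3] := eqVneq (q i3) 0; first by rewrite q3 !(mul0r,mulr0).
  rewrite mulrCA ler_wpM2l ?mulr_ge0// det_le// lt_def q0 ?andbT//.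
have V6 : 0 < 6 * V by rewrite mulr_gt0.
by rewrite mulrCA ler_pM2l.
Qed.

(** The part of [D] on which [f] does not exceed [f p0] is closed inside a compact box, so a bound
    on the coordinates is needed there only. *)
Lemma closed_coercive_min (R : realType) n (f : 'rV[R]_n -> R)
    (D : set 'rV[R]_n) (p0 : 'rV[R]_n) (M : R) :
  continuous f -> closed D -> D p0 ->
  (forall p, D p -> f p <= f p0 -> forall i, `|p 0 i| <= M) ->
  exists2 p, D p & forall p', D p' -> f p <= f p'.
Proof.
move=> fc Dc Dp0 coer.
pose A := D `&` [set p | f p <= f p0].
have Acl : closed A.
  apply: closedI => //.
  apply: (@preimage_closed _ _ f [set x | x <= f p0]); last exact: closed_le.
  by move=> x _; exact: fc.
have Ac : compact A.
  have boxc : compact [set v : 'rV[R]_n | forall i, `[- M, M]%classic (v ord0 i)].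
    by apply: (@rV_compact _ _ (fun=> `[- M, M]%classic)) => _; exact: segment_compact.
  apply: subclosed_compact Acl boxc _ => v [Dv fv] i.
  by rewrite /= in_itv /= -ler_norml coer.
have [p Ap pmin] := compact_EVT_min (ex_intro _ p0 (conj Dp0 (lexx _))) Ac (continuous_subspaceT fc).
move: Ap; rewrite inE => -[Dp fp].
exists p => // p' Dp'.
have [h|h] := leP (f p') (f p0).
  by apply: pmin; rewrite inE; split.
by rewrite (le_trans fp)// ltW.
Qed.

(** * A Kirszbraun theorem for points moving on lines *)

(** Stationarity is extracted along one-parameter variations, on which the objective is a polynomial
    in the step size. *)
Lemma deriv_at_min_poly (R : realType) (P : {poly R}) :
  (forall x, P.[0] <= P.[x]) -> P^`().[0] = 0.
Proof.
move=> Pmin.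
have D : is_derive (0 : R) (1 : R) (horner P) 0.
  apply: (@derive1_at_min R (horner P) (-1) 1 0).
  - by rewrite (@le_trans _ _ 0)// lerN10.
  - by move=> x _; exact: derivable_horner.
  - by rewrite in_itv/= ltrN10 ltr01.
  - by move=> x _; exact: Pmin.
have := is_derive_poly P 0 => D'.
by rewrite -(@derive_val _ _ _ _ _ _ _ D') (@derive_val _ _ _ _ _ _ _ D).
Qed.

Lemma exprn_unbounded (R : realType) (a B : R) : 1 < a -> exists N, B < a ^+ N.
Proof.
move=> a1.
have ge n : 1 + n%:R * (a - 1) <= a ^+ n.
  elim: n => [|n ih]; first by rewrite mul0r addr0.
  rewrite exprS (@le_trans _ _ (a * (1 + n%:R * (a - 1))))//.
    have := mulr_ge0 (ler0n R n) (sqr_ge0 (a - 1)); rewrite -natr1; lra.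
  by rewrite ler_pM2l// (lt_trans ltr01).
have a0 : 0 < a - 1 by rewrite subr_gt0.
exists (Num.truncn (`|B| / (a - 1))).+1.
apply: lt_le_trans (ge _).
have /andP[_ h] := truncn_itv (divr_ge0 (normr_ge0 B) (ltW a0)).
rewrite (le_lt_trans (ler_norm B))// -ltrBlDl.
by move: h; rewrite ltr_pdivrMr//; lra.
Qed.

Lemma continuous_sum (R : realType) (T : topologicalType) (I : Type)
    (r : seq I) (P : pred I) (F : I -> T -> R) :
  (forall i, P i -> continuous (F i)) ->
  continuous (fun x => \sum_(i <- r | P i) F i x).
Proof.
move=> h; apply: continuous_big => //.
by move=> -[a b]; exact: add_continuous.
Qed.

Lemma continuous_addr (R : realType) (T : topologicalType) (f g : T -> R) :
  continuous f -> continuous g -> continuous (fun x => f x + g x).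
Proof. by move=> fc gc x; apply: cvgD; [exact: fc|exact: gc]. Qed.

Lemma continuous_oppr (R : realType) (T : topologicalType) (f : T -> R) :
  continuous f -> continuous (fun x => - f x).
Proof. by move=> fc x; apply: cvgN; exact: fc. Qed.

Lemma continuous_mulr (R : realType) (T : topologicalType) (f g : T -> R) :
  continuous f -> continuous g -> continuous (fun x => f x * g x).
Proof. by move=> fc gc x; apply: cvgM; [exact: fc|exact: gc]. Qed.

Lemma continuous_expr (R : realType) (T : topologicalType) (f : T -> R) n :
  continuous f -> continuous (fun x => f x ^+ n).
Proof.
move=> fc x; apply: (@continuous_comp _ _ _ f (fun y => y ^+ n)); first exact: fc.
exact: exprn_continuous.
Qed.

Lemma dot_continuous (R : realType) (T : topologicalType) m
    (f g : T -> 'cV[R]_m) :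
  (forall c, continuous (fun x => f x c 0)) ->
  (forall c, continuous (fun x => g x c 0)) ->
  continuous (fun x => dot (f x) (g x)).
Proof.
by move=> fc gc; apply: continuous_sum => c _; apply: continuous_mulr.
Qed.

Lemma dot_subZ (R : realType) m (x y : 'cV[R]_m) a :
  dot (x - a *: y) (x - a *: y) =
  dot x x - 2 * a * dot x y + a ^+ 2 * dot y y.
Proof. by rewrite !dotE (dotC y x); ring. Qed.

Lemma coord_sqr_le_dot (R : realType) m (x : 'cV[R]_m) c :
  `|x c 0| <= 1 + dot x x.
Proof.
have : x c 0 ^+ 2 <= dot x x.
  rewrite /dot (bigD1 c)//= -expr2 lerDl.
  by apply: sumr_ge0 => i _; rewrite -expr2 sqr_ge0.
rewrite -[x c 0 ^+ 2]real_normK ?num_real//.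
by have := sqr_ge0 (`|x c 0| - 1); have := normr_ge0 (x c 0); nra.
Qed.

(* A large power stands in for the maximum, so that the minimiser is a
   stationary point and hence a weighted least-squares solution. *)
Lemma minimize_power_sum (R : realType) d (I : finType) (S : {set I})
    (s r : I -> R) (x : I -> 'cV[R]_d) (N : nat) (i0 j0 : I) :
  i0 \in S -> j0 \in S -> s i0 != s j0 -> (forall i, i \in S -> 0 < r i) ->
  exists v w : 'cV[R]_d,
    let e i := x i - (v + s i *: w) in
    let g i := dot (e i) (e i) / r i ^+ 2 in
    let q i := if i \in S then g i ^+ N / r i ^+ 2 else 0 in
    \sum_i q i *: e i = 0 /\ \sum_i (q i * s i) *: e i = 0.
Proof.
move=> iS jS sij r0.
pose vp (p : 'rV[R]_(d + d)) : 'cV[R]_d := (lsubmx p)^T.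
pose wp (p : 'rV[R]_(d + d)) : 'cV[R]_d := (rsubmx p)^T.
pose e p i := x i - (vp p + s i *: wp p).
pose g p i := dot (e p i) (e p i) / r i ^+ 2.
pose Phi p := \sum_(i in S) g p i ^+ N.+1.
have ec i c : continuous (fun p => e p i c 0).
  have -> : (fun p => e p i c 0) =
      (fun p => x i c 0 - (p 0 (lshift d c) + s i * p 0 (rshift d c))).
    by apply/funext => p; rewrite !mxE.
  apply: continuous_addr; first exact: cst_continuous.
  apply: continuous_oppr; apply: continuous_addr; first exact: coord_continuous.
  apply: continuous_mulr; first exact: cst_continuous.
  exact: coord_continuous.
have Phic : continuous Phi.
  apply: continuous_sum => i _; apply: continuous_expr.
  apply: continuous_mulr; last exact: cst_continuous.
  by apply: dot_continuous; exact: ec.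
have g0 p i : 0 <= g p i by rewrite divr_ge0 ?dot_ge0 ?sqr_ge0.
have gle p i : i \in S -> g p i <= 1 + Phi p.
  move=> Si.
  have h : g p i ^+ N.+1 <= Phi p.
    rewrite /Phi (bigD1 i)//= lerDl; apply: sumr_ge0 => k _.
    by rewrite exprn_ge0.
  have [g1|/ltW g1] := leP (g p i) 1.
    by rewrite (le_trans g1)// lerDl (le_trans _ h)// exprn_ge0.
  rewrite (@le_trans _ _ (g p i ^+ N.+1))//; last by rewrite (le_trans h)// lerDr.
  by rewrite exprS ler_peMr// exprn_ege1.
pose K := 1 + Phi 0.
pose B i := 1 + K * r i ^+ 2 + (1 + dot (x i) (x i)).
have K0 : 0 <= K by rewrite addr_ge0// sumr_ge0// => i _; rewrite exprn_ge0.
have B0 i : 0 <= B i.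
  apply: addr_ge0; last by rewrite addr_ge0 ?dot_ge0.
  by apply: addr_ge0 => //; apply: mulr_ge0 => //; exact: sqr_ge0.
have vwB p c i : i \in S -> Phi p <= Phi 0 ->
    `|vp p c 0 + s i * wp p c 0| <= B i.
  move=> Si hp.
  have -> : vp p c 0 + s i * wp p c 0 = x i c 0 - e p i c 0.
    by rewrite /e !mxE; ring.
  rewrite (le_trans (ler_normB _ _))// addrC lerD ?coord_sqr_le_dot//.
  rewrite (le_trans (coord_sqr_le_dot _ _))// lerD2l.
  rewrite -ler_pdivrMr ?exprn_gt0 ?r0// -/(g p i) (le_trans (gle _ _ Si))//.
  by rewrite lerD2l.
(* Coercivity rests on two distinct parameters: bounds on [v + s w] at [i0] and at [j0] bound first
   [w], then [v]. *)
pose D := `|s i0 - s j0|.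
have D0 : 0 < D by rewrite normr_gt0 subr_eq0.
pose W := (B i0 + B j0) / D.
have W0 : 0 <= W by apply: divr_ge0; [exact: addr_ge0|exact: ltW].
have wB p c : Phi p <= Phi 0 -> `|wp p c 0| <= W.
  move=> hp; rewrite ler_pdivlMr// -normrM.
  have -> : wp p c 0 * (s i0 - s j0) =
      (vp p c 0 + s i0 * wp p c 0) - (vp p c 0 + s j0 * wp p c 0) by ring.
  by rewrite (le_trans (ler_normB _ _))// lerD ?vwB.
have vB p c : Phi p <= Phi 0 -> `|vp p c 0| <= B i0 + `|s i0| * W.
  move=> hp.
  have -> : vp p c 0 = (vp p c 0 + s i0 * wp p c 0) - s i0 * wp p c 0 by ring.
  rewrite (le_trans (ler_normB _ _))// lerD ?vwB// normrM ler_wpM2l//.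
  exact: wB.
have [p _ pmin] : exists2 p, setT p & forall p', setT p' -> Phi p <= Phi p'.
  apply: (@closed_coercive_min R _ Phi setT 0 (B i0 + `|s i0| * W + W)) => //.
  move=> p _ hp i.
  rewrite -[p]hsubmxK -[lsubmx p]trmxK -[rsubmx p]trmxK -/(vp p) -/(wp p).
  case: (split_ordP i) => c ->; rewrite ?row_mxEl ?row_mxEr mxE.
    by rewrite (le_trans (vB _ _ hp))// lerDl.
  by rewrite (le_trans (wB _ _ hp))// lerDr; apply: addr_ge0 => //; exact: mulr_ge0.
have station (dv dw : 'cV[R]_d) :
    \sum_(i in S) g p i ^+ N / r i ^+ 2 * dot (e p i) (dv + s i *: dw) = 0.
  pose a i := dv + s i *: dw.
  pose b i := - 2 * dot (e p i) (a i) / r i ^+ 2.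
  pose c i := dot (a i) (a i) / r i ^+ 2.
  (* The objective along the variation [(dv, dw)]; the exponent [N.+1] leaves the weight [g ^+ N]
     after differentiation. *)
  pose P := \sum_(i in S) ((g p i)%:P + (b i)%:P * 'X + (c i)%:P * 'X^2) ^+ N.+1.
  pose pt (y : R) : 'rV[R]_(d + d) := p + y *: row_mx dv^T dw^T.
  have PE y : P.[y] = Phi (pt y).
    rewrite /P horner_sum; apply: eq_bigr => i Si.
    rewrite horner_exp !(hornerD, hornerM, hornerC, hornerX, hornerXn); congr (_ ^+ _).
    rewrite /g; have -> : e (pt y) i = e p i - y *: a i.
      rewrite /e /pt /vp /wp !linearD !linearZ /= row_mxKl row_mxKr !trmxK.
      by apply/matrixP => u z; rewrite !mxE; ring.
    rewrite dot_subZ /b /c; field.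
    by rewrite gt_eqF// r0.
  have : P^`().[0] = 0.
    apply: deriv_at_min_poly => y; rewrite !PE.
    have -> : pt 0 = p by rewrite /pt scale0r addr0.
    exact: pmin.
  rewrite /P linear_sum /= horner_sum => h.
  have c0 : (- 2 * N.+1%:R : R) != 0 by rewrite mulf_neq0// ?oppr_eq0 ?pnatr_eq0.
  apply: (mulfI c0); rewrite mulr0; apply: etrans h; rewrite mulr_sumr; apply: eq_bigr => i Si.
  rewrite deriv_exp !derivD !derivM !derivC !derivX /=.
  rewrite !(hornerD, hornerM, hornerMn, horner_exp, hornerC, hornerX, hornerXn).
  by rewrite !(mulr0, mul0r, mulr1, addr0, add0r) -mulr_natl /b /a; ring.
(* Varying in the direction of the normal-equation vector itself makes the derivative the squared
   norm of that vector. *)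
exists (vp p), (wp p) => e1 g1 q1; split.
- set U := \sum_i _; apply/eqP; rewrite -dot_eq0 -(station U 0) dot_suml.
  rewrite [X in _ == X]big_mkcond /=; apply/eqP/eq_bigr => i _.
  rewrite /q1 dotZl scaler0 addr0; case: ifP => // _; by rewrite mul0r.
- set U := \sum_i _; apply/eqP; rewrite -dot_eq0 -(station 0 U) dot_suml.
  rewrite [X in _ == X]big_mkcond /=; apply/eqP/eq_bigr => i _.
  rewrite /q1 dotZl add0r dotZr; case: ifP => // _; last by rewrite !mul0r.
  by rewrite mulrA.
Qed.

(** With the weights [g ^+ N / r ^+ 2], the residual inequality reads [sum g ^+ N * (g - c) <= 0]. A
    term with [g <= c] is at least [- c ^+ N.+1], while one with [g > c3] exceeds
    [c3 ^+ N * (c3 - c)]. Since [c < c3], a large [N] makes the latter beat [#|S|] terms of the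
    former kind, so no [g] exceeds [c3]. *)
Lemma lines_Kirszbraun (R : realType) d t (I : finType) (S : {set I})
    (s r : I -> R) (x : I -> 'cV[R]_d) (x' : I -> 'cV[R]_t) (v' w' : 'cV[R]_t)
    (c c3 : R) :
  0 < c -> c < c3 -> (forall i, i \in S -> 0 < r i) ->
  (forall i, i \in S ->
     dot (x' i - (v' + s i *: w')) (x' i - (v' + s i *: w')) <= r i ^+ 2) ->
  {in S &, injective s} ->
  (forall i j k, i \in S -> j \in S -> k \in S ->
     dot (detv s x i j k) (detv s x i j k) <=
     c * dot (detv s x' i j k) (detv s x' i j k)) ->
  exists v w : 'cV[R]_d, forall i, i \in S ->
     dot (x i - (v + s i *: w)) (x i - (v + s i *: w)) <= c3 * r i ^+ 2.
Proof.
move=> c0 cc3 r0 r_ge s_inj det_le.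
have [/existsP[i0 /existsP[j0 /and3P[iS jS sij]]]|/existsPn sEq] :=
    boolP [exists i, exists j, [&& i \in S, j \in S & s i != s j]]; last first.
  have [i /= iS|S0] := pickP [pred i | i \in S]; last first.
    by exists 0, 0 => i; have /= -> := S0 i.
  exists (x i), 0 => j jS.
  have /existsPn/(_ j) := sEq i; rewrite iS jS /= negbK => /eqP/(s_inj _ _ iS jS) <-.
  rewrite scaler0 addr0 subrr dot0l mulr_ge0 ?sqr_ge0//.
  by rewrite ltW// (lt_trans c0).
have a1 : 1 < c3 / c by rewrite ltr_pdivlMr// mul1r.
have d0 : 0 < c3 - c by rewrite subr_gt0.
have [N HN] := exprn_unbounded (#|S|%:R * c / (c3 - c)) a1.
have [v [w stat]] := minimize_power_sum x N iS jS sij r0.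
pose e i := x i - (v + s i *: w); pose g i := dot (e i) (e i) / r i ^+ 2.
pose q i := if i \in S then g i ^+ N / r i ^+ 2 else 0.
have [U0 W0] : \sum_i q i *: e i = 0 /\ \sum_i (q i * s i) *: e i = 0 := stat.
exists v, w => i iSi.
have g0 j : 0 <= g j by rewrite divr_ge0 ?dot_ge0 ?sqr_ge0.
have q0 j : 0 <= q j.
  rewrite /q; case: ifP => // _.
  by apply: divr_ge0; [exact: exprn_ge0|exact: sqr_ge0].
have qS j : 0 < q j -> j \in S by rewrite /q; case: ifP => //; rewrite ltxx.
pose e' j := x' j - (v' + s j *: w').
have H : \sum_j q j * dot (e j) (e j) <= c * \sum_j q j * dot (e' j) (e' j).
  apply: (weighted_residual_le (ltW c0) q0 U0 W0).
    by move=> a b k /qS aS /qS bS /qS kS; rewrite !detv_affine det_le.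
  by move=> a b /qS aS /qS bS; exact: s_inj.
have {}H : \sum_(j in S) g j ^+ N * (g j - c) <= 0.
  rewrite -subr_le0 mulr_sumr -sumrB in H.
  apply: le_trans H; rewrite [leLHS]big_mkcond /=; apply: ler_sum => j _.
  rewrite /q; case: ifP => jSi; last by rewrite !mul0r mulr0 subr0.
  have rj : 0 < r j ^+ 2 by rewrite exprn_gt0 ?r0.
  have -> : g j ^+ N / r j ^+ 2 * dot (e j) (e j) = g j ^+ N * g j.
    by rewrite -mulrA [_^-1 * _]mulrC.
  rewrite mulrBr lerD2l lerN2 mulrC ler_wpM2r ?(ltW c0)//.
  by rewrite -mulrA ler_piMr ?exprn_ge0// mulrC ler_pdivrMr// mul1r r_ge.
rewrite -ler_pdivrMr ?exprn_gt0 ?r0// -/(e i) -/(g i) leNgt; apply/negP => gi.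
have {}HN : #|S|%:R * c ^+ N.+1 < g i ^+ N * (g i - c).
  apply: (@lt_le_trans _ _ (c3 ^+ N * (c3 - c))).
    move: HN; rewrite ltr_pdivrMr// expr_div_n mulrAC ltr_pdivlMr ?exprn_gt0//.
    by rewrite exprS mulrA.
  rewrite ler_pM ?exprn_ge0 ?(ltW d0) ?(ltW (lt_trans c0 cc3))//.
    by rewrite lerXn2r ?nnegrE ?g0 ?(ltW gi)// ltW// (lt_trans c0).
  by rewrite lerD2r ltW.
move: H; apply/negP; rewrite -ltNge (bigD1 i)//=.
apply: (@lt_le_trans _ _ (g i ^+ N * (g i - c) - #|S|%:R * c ^+ N.+1)).
  by rewrite subr_gt0.
rewrite lerD2l -[leLHS]mulNr -[leRHS]opprK -[leLHS]opprK lerN2 mulNr opprK.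
rewrite -sumrN; apply: (@le_trans _ _ (\sum_(j in S) c ^+ N.+1)); last first.
  by rewrite sumr_const mulr_natl.
rewrite [leRHS](bigD1 i)//= ler_wpDl ?exprn_ge0 ?(ltW c0)//.
apply: ler_sum => j _; rewrite -mulrN opprB.
have [gc|gc] := leP (g j) c.
  rewrite exprSr ler_pM ?exprn_ge0 ?subr_ge0//.
    by rewrite lerXn2r ?nnegrE ?(ltW c0).
  by rewrite lerBlDr lerDl.
rewrite (@le_trans _ _ 0) ?exprn_ge0 ?(ltW c0)//.
by rewrite mulr_ge0_le0 ?exprn_ge0// subr_le0 ltW.
Qed.

Lemma detv_repeat (R : realType) m (I : eqType) (s : I -> R) (x : I -> 'cV[R]_m)
    i j k :
  [|| i == j, j == k | i == k] -> detv s x i j k = 0.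
Proof.
by case/or3P => /eqP ->; apply/matrixP => a b; rewrite !mxE; ring.
Qed.

Lemma dot_midpoint (R : realType) m (x y : 'cV[R]_m) :
  dot (2^-1 *: (x + y)) (2^-1 *: (x + y)) =
  2^-1 * (dot x x + dot y y) - 4^-1 * dot (x - y) (x - y).
Proof. by rewrite !dotE (dotC y x); field. Qed.

(** Expressing the value at [c] through those at [a] and [b] uses coefficients of size
    [|c - b| / |a - b|] and [|a - c| / |a - b|]. The two hypotheses, an extremality of the pair
    [a, b], say exactly that these are at most [rc / ra] and [rc / rb]. *)
Lemma interpolation_bound (R : realType) m (a b c ra rb rc : R)
    (v w : 'cV[R]_m) :
  a != b -> 0 < ra -> 0 < rb -> 0 < rc ->
  `|a - c| / (ra * rc) <= `|a - b| / (ra * rb) ->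
  `|b - c| / (rb * rc) <= `|a - b| / (ra * rb) ->
  norm2 (v + c *: w) <=
    rc * (norm2 (v + a *: w) / ra + norm2 (v + b *: w) / rb).
Proof.
move=> ab ra0 rb0 rc0 h1 h2.
have ab0 : 0 < `|a - b| by rewrite normr_gt0 subr_eq0.
have abn : a - b != 0 by rewrite subr_eq0.
have -> : v + c *: w = ((c - b) / (a - b)) *: (v + a *: w) +
                       ((a - c) / (a - b)) *: (v + b *: w).
  by apply/matrixP => i j; rewrite !mxE; field.
rewrite (le_trans (norm2D _ _))// !norm2Z mulrDr lerD//.
- rewrite mulrCA -[leLHS]mulrC ler_wpM2l ?norm2_ge0//.
  rewrite normrM normfV ler_pdivrMr// -(distrC b).
  move: h2; rewrite ler_pdivrMr ?mulr_gt0//.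
  have -> : `|a - b| / (ra * rb) * (rb * rc) = rc / ra * `|a - b|.
    by field; rewrite !gt_eqF.
  by [].
- rewrite mulrCA -[leLHS]mulrC ler_wpM2l ?norm2_ge0//.
  rewrite normrM normfV ler_pdivrMr//.
  move: h1; rewrite ler_pdivrMr ?mulr_gt0//.
  have -> : `|a - b| / (ra * rb) * (ra * rc) = rc / rb * `|a - b|.
    by field; rewrite !gt_eqF.
  by [].
Qed.

Lemma le_card_sum (R : realType) (I : finType) (S : {set I}) (F : I -> R) c :
  (forall i, i \in S -> F i <= c) -> \sum_(i in S) F i <= #|S|%:R * c.
Proof.
by move=> h; rewrite mulr_natl -sumr_const; apply: ler_sum => i /h.
Qed.

(* [S] is grown greedily: as long as the lines that nearly minimise the
   potential over the feasible set of [S] are violated on a set of large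
   measure, some violator keeps [S] free of bad triples, and adding it raises
   the minimal potential by [eps ^+ 2 / 8]. Extremality of [i0, j0] makes the
   potential control the displacement of the line at the violator. *)
Lemma robust_line_lift (R : realType) d t (I : finType) (C : {set I})
    (mu s r : I -> R) (x : I -> 'cV[R]_d) (x' : I -> 'cV[R]_t)
    (v' w' : 'cV[R]_t) (bad : I -> I -> I -> bool) (c b eps delta : R) (N : nat) :
  let gp i j := \sum_(k | bad i j k) mu k <= delta in
  0 < c -> 0 <= b -> c < b ^+ 2 -> 0 < eps -> 0 <= delta ->
  2 * b ^+ 2 < N%:R * (eps ^+ 2 / 8) ->
  (forall i, 0 <= mu i) ->
  (forall i j k, bad i j k = bad j i k) ->
  (forall i j k, bad i j k = bad i k j) ->
  (forall i, i \in C -> \sum_(j | ~~ gp i j) mu j <= delta) ->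
  (forall i, i \in C -> 0 < r i) ->
  (forall i, i \in C ->
     dot (x' i - (v' + s i *: w')) (x' i - (v' + s i *: w')) <= r i ^+ 2) ->
  {in C &, injective s} ->
  (forall i j k, i \in C -> j \in C -> k \in C -> i != j -> j != k -> i != k ->
     ~~ bad i j k ->
     dot (detv s x i j k) (detv s x i j k) <=
     c * dot (detv s x' i j k) (detv s x' i j k)) ->
  exists v w : 'cV[R]_d,
    \sum_(i in C | (b + eps) * r i < norm2 (x i - (v + s i *: w))) mu i
    <= ((N.+2)%:R + (N.+2)%:R ^+ 2) * delta.
Proof.
move=> gp c0 b0 cb eps0 delta0 HN mu0 bad12 bad23 badpair r0 r_ge s_inj det_le.
have gpC i j : gp i j = gp j i by rewrite /gp; under eq_bigl do rewrite bad12.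
have b2 : 0 <= b + eps by rewrite addr_ge0// ltW.
pose eta := ((N.+2)%:R + (N.+2)%:R ^+ 2) * delta : R.
have delta_eta : delta <= eta.
  rewrite /eta ler_peMl//.
  by apply: ler_wpDr; [exact: sqr_ge0|rewrite ler1n].
(* Without a good pair of distinct points, the constant line at any [x i] works: it is violated only
   at points that form no good pair with [i]. *)
have [/existsP[[i1 j1] /and4P[/= i1C j1C ij1 gp1]]|noPair] :=
  boolP [exists p : I * I, [&& p.1 \in C, p.2 \in C, p.1 != p.2 & gp p.1 p.2]];
  last first.
  have [i /= iC|C0] := pickP [pred i | i \in C]; last first.
    exists 0, 0; rewrite big_pred0 ?(le_trans delta0)// => i.
    by have /= -> := C0 i.
  exists (x i), 0; apply: le_trans delta_eta.
  apply: le_trans (badpair _ iC).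
  rewrite [leLHS]big_mkcond [leRHS]big_mkcond /=; apply: ler_sum => j _.
  case: ifP => [/andP[jC viol]|_]; last by case: ifP.
  suff -> : ~~ gp i j by [].
  apply/negP => gpij; move: viol; apply/negP; rewrite -leNgt scaler0 addr0.
  have [->|ij] := eqVneq i j; last first.
    by case/negP: noPair; apply/existsP; exists (i, j); rewrite /= iC jC ij.
  by rewrite subrr norm20 mulr_ge0// ltW// r0.
pose D i j := `|s i - s j| / (r i * r j).
pose PP (p : I * I) := [&& p.1 \in C, p.2 \in C & gp p.1 p.2].
have PP1 : PP (i1, j1) by rewrite /PP /= i1C j1C.
(* Maximality is among good pairs only. It will apply to a violator [y] because [y] is chosen to
   form good pairs with all of [S], in particular with [i0] and [j0]. *)
case: (arg_maxP (fun p => D p.1 p.2) PP1) => -[i0 j0] /and3P[/= i0C j0C gp0] Dmax.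
have D0 : 0 < D i0 j0.
  apply: lt_le_trans (Dmax _ PP1); rewrite /D /= divr_gt0 ?mulr_gt0 ?r0//.
  by rewrite normr_gt0 subr_eq0; apply: contra ij1 => /eqP/(s_inj _ _ i1C j1C) ->.
have s0 : s i0 != s j0.
  by apply: contraTneq D0 => h; rewrite /D h subrr normr0 mul0r ltxx.
pose e (p : 'cV[R]_d * 'cV[R]_d) i := x i - (p.1 + s i *: p.2).
pose Feas (S : {set I}) p := forall i, i \in S -> norm2 (e p i) <= b * r i.
pose H p := dot (e p i0) (e p i0) / r i0 ^+ 2 + dot (e p j0) (e p j0) / r j0 ^+ 2.
pose good (S : {set I}) := (forall i j, i \in S -> j \in S -> i != j -> gp i j) /\
  (forall i j k, i \in S -> j \in S -> k \in S -> i != j -> j != k -> i != k ->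
     ~~ bad i j k).
have ri0 := r0 _ i0C; have rj0 := r0 _ j0C.
have H0 p : 0 <= H p.
  by apply: addr_ge0; apply: divr_ge0; rewrite ?dot_ge0 ?sqr_ge0.
have FeasN0 (S : {set I}) : S \subset C -> good S -> exists p, Feas S p.
  move=> /fintype.subsetP SC [gS1 gS2].
  have [||||v [w vw]] := @lines_Kirszbraun R d t I S s r x x' v' w' c (b ^+ 2) c0 cb.
  - by move=> i /SC; exact: r0.
  - by move=> i /SC; exact: r_ge.
  - by move=> i j /SC iC /SC jC; exact: s_inj.
  - move=> i j k iS jS kS.
    have [rep|] := boolP [|| i == j, j == k | i == k].
      by rewrite !detv_repeat// !dot0l mulr0.
    rewrite !negb_or => /and3P[ij jk ik].
    by apply: det_le; rewrite ?SC// gS2.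
  exists (v, w) => i iS.
  rewrite -ler_sqr ?nnegrE ?norm2_ge0 ?mulr_ge0 ?(ltW (r0 _ (SC _ iS)))//.
  by rewrite norm2_sqr exprMn vw.
have FeasH (S : {set I}) p : i0 \in S -> j0 \in S -> Feas S p -> H p <= 2 * b ^+ 2.
  move=> iS jS Fp; rewrite /H mulr_natl mulr2n.
  rewrite lerD// ler_pdivrMr ?exprn_gt0// -exprMn -norm2_sqr.
    by rewrite lerXn2r ?nnegrE ?norm2_ge0 ?mulr_ge0 ?(ltW ri0)// Fp.
  by rewrite lerXn2r ?nnegrE ?norm2_ge0 ?mulr_ge0 ?(ltW rj0)// Fp.
apply/not_existsP => noline.
have {}noline p : eta <
    \sum_(i in C | (b + eps) * r i < norm2 (e p i)) mu i.
  rewrite ltNge; apply/negP => h; apply: (noline p.1); by exists p.2.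
(* Union bound: the points excluded by a pair [(i, y)] have mass at most [#|S| * delta], those
   excluded by a triple [(i, j, y)] at most [#|S| ^ 2 * delta]. Together this is at most [eta], less
   than the mass of the violators. *)
have extend (S : {set I}) p : S \subset C -> good S -> (#|S| <= N.+2)%N ->
    exists y, [/\ y \in C, (b + eps) * r y < norm2 (e p y),
      forall i, i \in S -> gp i y &
      forall i j, i \in S -> j \in S -> i != j -> ~~ bad i j y].
  move=> /fintype.subsetP SC [gS1 gS2] Scard; apply: contrapT => /forallNP noext.
  have := noline p; apply/negP; rewrite -leNgt.
  apply: (@le_trans _ _ (\sum_y (\sum_(i in S) (if ~~ gp i y then mu y else 0) +
     \sum_(i in S) \sum_(j in S) (if (i != j) && bad i j y then mu y else 0)))).
    rewrite big_mkcond /=; apply: ler_sum => y _.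
    have P1 : 0 <= \sum_(i in S) (if ~~ gp i y then mu y else 0).
      by apply: sumr_ge0 => i _; case: ifP.
    have P2 : 0 <= \sum_(i in S) \sum_(j in S)
        (if (i != j) && bad i j y then mu y else 0).
      by apply: sumr_ge0 => i _; apply: sumr_ge0 => j _; case: ifP.
    case: ifP => [/andP[yC viol]|_]; last by rewrite addr_ge0.
    have [/existsP[i /andP[iS gpi]]|h1] := boolP [exists i, (i \in S) && ~~ gp i y].
      rewrite ler_wpDr// (bigD1 i)//= gpi lerDl.
      by apply: sumr_ge0 => k _; case: ifP.
    have [/existsP[i /existsP[j /and4P[iS jS ij bij]]]|h2] :=
      boolP [exists i, exists j, [&& i \in S, j \in S, i != j & bad i j y]].
      rewrite ler_wpDl// (bigD1 i)//= (bigD1 j)//= ij bij /= -addrA lerDl addr_ge0//.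
        by apply: sumr_ge0 => k _; case: ifP.
      by apply: sumr_ge0 => k _; apply: sumr_ge0 => l _; case: ifP.
    exfalso; apply: (noext y); split => //.
      by move=> i iS; move/existsPn/(_ i): h1; rewrite iS negbK.
    move=> i j iS jS ij; apply: contra h2 => bij.
    by apply/existsP; exists i; apply/existsP; exists j; rewrite iS jS ij.
  rewrite big_split /= exchange_big /= /eta mulrDl lerD//.
    apply: (@le_trans _ _ (#|S|%:R * delta)); last by rewrite ler_wpM2r// ler_nat.
    apply: le_card_sum => i iS; rewrite -big_mkcond /=; exact: badpair (SC _ iS).
  rewrite exchange_big /= expr2 -mulrA.
  apply: (@le_trans _ _ (#|S|%:R * (#|S|%:R * delta))); last first.
    by rewrite ler_pM ?mulr_ge0// ?ler_nat// ler_wpM2r// ler_nat.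
  apply: le_card_sum => i iS; rewrite exchange_big /=.
  apply: le_card_sum => j jS; rewrite -big_mkcond /=.
  have [->|ij] := eqVneq i j; first by rewrite big_pred0.
  exact: gS1.
have grow n : (n <= N)%N -> exists S : {set I}, [/\ S \subset C, good S,
    i0 \in S /\ j0 \in S, #|S| = n.+2 &
    forall p, Feas S p -> n%:R * (eps ^+ 2 / 8) <= H p].
  elim: n => [_|n ih nN].
    exists [set i0; j0]%SET; split.
    - by apply/fintype.subsetP => i; rewrite !inE => /orP[] /eqP ->.
    - split.
        move=> i j; rewrite !inE => /orP[] /eqP -> /orP[] /eqP ->; rewrite ?eqxx//.
        by rewrite gpC.
      by move=> i j k; rewrite !inE => /orP[] /eqP -> /orP[] /eqP -> /orP[] /eqP ->;
         rewrite ?eqxx.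
    - by rewrite !inE !eqxx orbT.
    - by rewrite cards2; have -> : i0 != j0 by apply: contra s0 => /eqP ->.
    - by move=> p _; rewrite mul0r.
  have [S [SC gS [iS jS] Sn HS]] := ih (ltnW nN).
  have [p0 Fp0] := FeasN0 _ SC gS.
  (* An approximate minimiser is taken; its slack [eps ^+ 2 / 16] gives up half of the gain obtained
     below. *)
  have [p Fp pmin] : exists2 p, Feas S p &
      forall p', Feas S p' -> H p - eps ^+ 2 / 16 <= H p'.
    have lb : has_inf [set H p | p in Feas S].
      split; first by exists (H p0); exists p0.
      by exists 0 => _ [p _ <-].
    have k0 : 0 < eps ^+ 2 / 16 by rewrite divr_gt0 ?exprn_gt0.
    have [_ [p Fp <-] hp] := inf_adherent k0 lb.
    exists p => // p' Fp'; rewrite lerBlDr (le_trans (ltW hp))// lerD2r.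
    by apply: ge_inf; [have [] := lb|exists p'].
  have [|y [yC viol gpy bady]] := extend S p SC gS; first by rewrite Sn !ltnS ltnW.
  have ry := r0 _ yC.
  have yS : y \notin S.
    apply/negP => /Fp; apply/negP; rewrite -ltNge (le_lt_trans _ viol)//.
    by rewrite ler_wpM2r ?(ltW ry)// lerDl ltW.
  exists (y |: S)%SET; split.
  - by apply/fintype.subsetP => i; rewrite !inE => /orP[/eqP ->//|]; move/fintype.subsetP: SC; exact.
  - have [gS1 gS2] := gS; split.
      move=> i j; rewrite !inE => /orP[/eqP ->|iS'] /orP[/eqP ->|jS']; rewrite ?eqxx//.
      + by move=> _; rewrite gpC gpy.
      + by move=> _; exact: gpy.
      + exact: gS1.
    move=> i j k; rewrite !inE => /orP[/eqP ->|iS'] /orP[/eqP ->|jS'] /orP[/eqP ->|kS'];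
      rewrite ?eqxx// => ij jk ik.
    + by rewrite bad12 bad23 bady.
    + by rewrite bad23 bady.
    + exact: bady.
    + exact: gS2.
  - by rewrite !inE iS jS !orbT.
  - by rewrite cardsU1 yS Sn.
  move=> p' Fp'.
  have Fp'S : Feas S p' by move=> i iS'; apply: Fp'; rewrite inE iS' orbT.
  (* The midpoint is feasible for [S] by convexity, and the parallelogram law makes its potential
     smaller than the average by [(mi ^+ 2 + mj ^+ 2) / 4 >= eps ^+ 2 / 8]. Comparison with the near
     minimum yields [H p' >= H p + eps ^+ 2 / 8]. *)
  pose q : 'cV[R]_d * 'cV[R]_d := (2^-1 *: (p.1 + p'.1), 2^-1 *: (p.2 + p'.2)).
  have eq_ i : e q i = 2^-1 *: (e p i + e p' i).
    by apply/matrixP => u z; rewrite !mxE; field.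
  have Fq : Feas S q.
    move=> i iS'; rewrite eq_ norm2Z ger0_norm ?invr_ge0//.
    by have := norm2D (e p i) (e p' i); have := Fp _ iS'; have := Fp'S _ iS'; lra.
  pose dv := p'.1 - p.1; pose dw := p'.2 - p.2.
  have de i : e p i - e p' i = dv + s i *: dw.
    by apply/matrixP => u z; rewrite !mxE; ring.
  pose mi := norm2 (dv + s i0 *: dw) / r i0.
  pose mj := norm2 (dv + s j0 *: dw) / r j0.
  have Hq : H q = 2^-1 * (H p + H p') - 4^-1 * (mi ^+ 2 + mj ^+ 2).
    rewrite /H !eq_ !dot_midpoint !de /mi /mj !expr_div_n !norm2_sqr; field.
    by rewrite !gt_eqF.
  (* At [y] the line [p] is off by more than [(b + eps) * r y] and [p'] by at most [b * r y], so
     they differ there by more than [eps * r y]; interpolation carries this difference over to [i0]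
     and [j0], the points that the potential sees. *)
  have lev : eps < mi + mj.
    have h : eps * r y < norm2 (dv + s y *: dw).
      rewrite -de.
      have := norm2D (e p y - e p' y) (e p' y); rewrite subrK.
      have Fy : norm2 (e p' y) <= b * r y by apply: Fp'; rewrite !inE eqxx.
      by move: viol; lra.
    rewrite -(ltr_pM2r ry) (lt_le_trans h)// [leRHS]mulrC.
    apply: interpolation_bound => //.
      by have /= := Dmax (i0, y); apply; rewrite /PP /= i0C yC gpy.
    by have /= := Dmax (j0, y); apply; rewrite /PP /= j0C yC gpy.
  have mij : eps ^+ 2 / 2 <= mi ^+ 2 + mj ^+ 2.
    have : eps ^+ 2 <= (mi + mj) ^+ 2.
      by rewrite lerXn2r ?nnegrE ?(ltW eps0) ?(ltW (lt_trans eps0 lev))// ltW.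
    by have := sqr_ge0 (mi - mj); lra.
  have := pmin _ Fq; rewrite Hq; have := HS _ Fp; rewrite -(natr1 n) !mulrDl; move: mij; lra.
have [S [SC gS [iS jS] _ HS]] := grow N (leqnn N).
have [p Fp] := FeasN0 _ SC gS.
by have := FeasH _ _ iS jS Fp; rewrite leNgt (lt_le_trans HN)// HS.
Qed.

(** * Sensitivities of a union of lines *)

(** The affine coefficients are [th] and [1 - th] with [|th| <= 2], hence [|1 - th| <= 3], and 5 is
    their sum. *)
Lemma affine_extrapolation (R : realType) m (a b y M : R) (v w : 'cV[R]_m) :
  0 <= M -> `|y - a| <= 2 * `|b - a| ->
  norm2 (v + a *: w) <= M -> norm2 (v + b *: w) <= M ->
  norm2 (v + y *: w) <= 5 * M.
Proof.
move=> M0 yab ha hb.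
have [ab|ab] := eqVneq b a.
  move: yab; rewrite ab subrr normr0 mulr0 normr_le0 subr_eq0 => /eqP ->.
  by rewrite (le_trans ha)// ler_peMl// ler1n.
have ab0 : b - a != 0 by rewrite subr_eq0.
pose th := (y - a) / (b - a).
have th2 : `|th| <= 2 by rewrite normrM normfV ler_pdivrMr// normr_gt0.
have -> : v + y *: w = (1 - th) *: (v + a *: w) + th *: (v + b *: w).
  by apply/matrixP => i j; rewrite !mxE /th; field.
rewrite (le_trans (norm2D _ _))// !norm2Z.
have th3 : `|1 - th| <= 3.
  by rewrite (le_trans (ler_normB _ _))// normr1; lra.
have := ler_pM (normr_ge0 _) (norm2_ge0 _) th3 ha.
have := ler_pM (normr_ge0 _) (norm2_ge0 _) th2 hb.
lra.
Qed.

(* Split the points at the midpoint of their range. If a function that is small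
   at the leftmost point is also small at some point of the right half, then it
   is small everywhere up to the factor 5; otherwise one function less has to be
   considered on the right half, and symmetrically. *)
Lemma collinear_coreset (R : realType) (I : finType) (p : I -> R) k
    (Y : {set I}) :
  exists K : {set I}, [/\ K \subset Y, (#|K| + 2 <= 3 * 2 ^ k)%N,
    (Y != finset.set0 -> K != finset.set0) &
    forall m (J : finType) (J0 : {set J}) (v w : J -> 'cV[R]_m) (M : R),
      (#|J0| <= k)%N -> 0 <= M ->
      (forall i, i \in K ->
         exists2 j, j \in J0 & norm2 (v j + p i *: w j) <= M) ->
      forall i, i \in Y ->
         exists2 j, j \in J0 & norm2 (v j + p i *: w j) <= 5 * M].
Proof.
elim: k Y => [|k ih] Y.
  have [->|/finset.set0Pn[a aY]] := eqVneq Y finset.set0.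
    by exists finset.set0; split; rewrite ?finset.sub0set ?cards0 ?eqxx// => m J J0 v w M _ _ _ i; rewrite inE.
  exists [set a]%SET; split => //.
  - by rewrite finset.sub1set.
  - by rewrite cards1.
  - by move=> _; apply/finset.set0Pn; exists a; rewrite inE.
  move=> m J J0 v w M; rewrite leqn0 cards_eq0 => /eqP -> _ /(_ a).
  by rewrite inE eqxx => /(_ isT)[j]; rewrite inE.
have [->|/finset.set0Pn[i0 i0Y]] := eqVneq Y finset.set0.
  exists finset.set0; split; rewrite ?eqxx//.
  - by rewrite cards0 add0n expnS mulnCA leq_pmulr// muln_gt0 expn_gt0.
  - by move=> m J J0 v w M _ _ _ i; rewrite inE.
case: (arg_minP p i0Y) => a aY amin; case: (arg_maxP p i0Y) => b bY bmax.
pose mid := (p a + p b) / 2.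
pose YL := [set i in Y | p i <= mid]%SET; pose YR := [set i in Y | mid < p i]%SET.
have [KL [KLY KLc _ HL]] := ih YL; have [KR [KRY KRc _ HR]] := ih YR.
exists (a |: (b |: (KL :|: KR)))%SET; split.
- apply/fintype.subsetP => i; rewrite !inE => /or4P[/eqP ->//|/eqP ->//|iK|iK].
    by have /fintype.subsetP/(_ i iK) := KLY; rewrite inE => /andP[].
  by have /fintype.subsetP/(_ i iK) := KRY; rewrite inE => /andP[].
(* Two recursive cores and two end points: [#|K| + 2] at most doubles at each level, starting from
   [1 + 2]. *)
- have h1 := cardsU1 a (b |: (KL :|: KR))%SET.
  have h2 := cardsU1 b (KL :|: KR)%SET.
  have [h3 _] := leq_card_setU KL KR.
  have e1 : (((a \notin b |: (KL :|: KR)) : nat) <= 1)%N by case: (a \notin _).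
  have e2 : (((b \notin KL :|: KR) : nat) <= 1)%N by case: (b \notin _).
  rewrite h1 h2 expnS mulnCA mul2n -addnn (leq_trans _ (leq_add KLc KRc))//.
  move: h3 e1 e2; lia.
- by move=> _; apply/finset.set0Pn; exists a; rewrite !inE eqxx.
move=> m J J0 v w M J0k M0 cov i iY.
have [ja jaJ ha] : exists2 j, j \in J0 & norm2 (v j + p a *: w j) <= M.
  by apply: cov; rewrite !inE eqxx.
have [jb jbJ hb] : exists2 j, j \in J0 & norm2 (v j + p b *: w j) <= M.
  by apply: cov; rewrite !inE eqxx orbT.
have pia : p a <= p i by exact: amin.
have pib : p i <= p b by exact: bmax.
have cardD j : j \in J0 -> (#|(J0 :\ j)%SET| <= k)%N.
  by move=> jJ; move: J0k; rewrite (cardsD1 j) jJ add1n ltnS.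
have [iL|iR] := leP (p i) mid.
- have [/existsP[y /andP[yK hy]]|none] :=
      boolP [exists y, (y \in KL) && (norm2 (v jb + p y *: w jb) <= M)].
    exists jb => //; apply: (affine_extrapolation M0 _ hb hy).
    have /fintype.subsetP/(_ y yK) := KLY; rewrite inE => /andP[yY].
    rewrite /mid => ymid; have := amin _ yY => /= ay.
    rewrite !ler0_norm ?subr_le0; lra.
  have [y yK||j jJ hj] := HL m J (J0 :\ jb)%SET v w M (cardD _ jbJ) M0 _ i.
  + have [|j jJ hj] := cov y; first by rewrite !inE yK !orbT.
    exists j => //; rewrite !inE jJ andbT; apply: contra none => /eqP jE.
    by apply/existsP; exists y; rewrite yK -jE.
  + by rewrite inE iY.
  + by exists j => //; move: jJ; rewrite !inE => /andP[].
- have [/existsP[y /andP[yK hy]]|none] :=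
      boolP [exists y, (y \in KR) && (norm2 (v ja + p y *: w ja) <= M)].
    exists ja => //; apply: (affine_extrapolation M0 _ ha hy).
    have /fintype.subsetP/(_ y yK) := KRY; rewrite inE => /andP[yY].
    rewrite /mid => ymid; have := bmax _ yY => /= ay.
    rewrite !ger0_norm ?subr_ge0; lra.
  have [y yK||j jJ hj] := HR m J (J0 :\ ja)%SET v w M (cardD _ jaJ) M0 _ i.
  + have [|j jJ hj] := cov y; first by rewrite !inE yK !orbT.
    exists j => //; rewrite !inE jJ andbT; apply: contra none => /eqP jE.
    by apply/existsP; exists y; rewrite yK -jE.
  + by rewrite inE iY.
  + by exists j => //; move: jJ; rewrite !inE => /andP[].
Qed.

(* [m] cores have been peeled off already, and [T] is a lower bound for the sum
   of [F] over them. *)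
Lemma sensitivity_peeling (R : realType) (I : finType) (Fam : (I -> R) -> Prop)
    (A : R) (f : nat) (Y : {set I}) (m : nat) :
  1 <= A -> (forall F, Fam F -> forall i, 0 <= F i) ->
  (forall Y : {set I}, Y != finset.set0 -> exists K : {set I},
    [/\ K \subset Y, K != finset.set0, (#|K| <= f)%N &
        forall F, Fam F -> forall i, i \in Y ->
          exists2 j, j \in K & F i <= A * F j]) ->
  exists b : I -> R, [/\ forall i, 0 <= b i,
    \sum_(i in Y) b i <= f%:R * \sum_(m <= l < m + #|Y|) l.+1%:R^-1 &
    forall F (T : R), Fam F -> 0 <= T ->
      (forall i, i \in Y -> m%:R * F i <= A * T) ->
      forall i, i \in Y -> F i <= A * b i * (\sum_(j in Y) F j + T)].
Proof.
move=> A1 F0 core.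
have [n] := ubnP #|Y|; elim: n => // n ih in Y m *; rewrite ltnS => Yn.
have [->|Y0] := eqVneq Y finset.set0.
  exists (fun=> 0); split => //.
    by rewrite big1// mulr_ge0// sumr_ge0.
  by move=> F T _ _ _ i; rewrite inE.
have [K [KY K0 Kf HK]] := core Y Y0.
have Kpos : (0 < #|K|)%N by rewrite card_gt0.
have cYK : (#|Y :\: K| = #|Y| - #|K|)%N.
  by rewrite cardsD; move/finset.setIidPr: KY => ->.
have KleY := subset_leq_card KY.
have [|b [b0 bsum bH]] := ih (Y :\: K)%SET m.+1.
  by rewrite cYK; lia.
(* The cores peeled before give [m * F i <= A * T], and for [i] in [K] the present core contributes
   [F i] itself; hence the weight [1 / m.+1]. For the points outside [K], the sum over [K] is added
   to [T]. *)
exists (fun i => if i \in K then m.+1%:R^-1 else b i); split.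
- by move=> i; case: ifP.
- rewrite (big_setID K) /= (finset.setIidPr KY).
  have -> : \sum_(i in K) (if i \in K then m.+1%:R^-1 else b i) = #|K|%:R * m.+1%:R^-1 :> R.
    by rewrite mulr_natl -sumr_const; apply: eq_bigr => i ->.
  rewrite (eq_bigr b); last by move=> i; rewrite inE => /andP[/negbTE ->].
  have Ypos : (m < m + #|Y|)%N by rewrite -addn1 leq_add2l (leq_trans Kpos).
  rewrite (big_ltn Ypos) mulrDr lerD//.
    by rewrite ler_wpM2r ?ler_nat.
  rewrite (le_trans bsum)// ler_wpM2l//.
  rewrite [leRHS](big_cat_nat (n := (m.+1 + #|Y :\: K|)%N)) /=.
  + by rewrite lerDl sumr_ge0.
  + by rewrite leq_addr.
  + by rewrite addSnnS leq_add2l cYK; lia.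
move=> F T FF T0 HT i iY.
have A0 : 0 <= A by rewrite (le_trans ler01).
have SY : \sum_(j in Y) F j = \sum_(j in K) F j + \sum_(j in Y :\: K) F j.
  by rewrite (big_setID K) /= (finset.setIidPr KY).
have FS (Z : {set I}) : 0 <= \sum_(j in Z) F j by apply: sumr_ge0 => j _; exact: F0.
case: ifP => iK.
  rewrite -mulrA mulrCA ler_pdivlMl ?ltr0n// -natr1 mulrDl mul1r mulrDr addrC.
  rewrite lerD ?HT// (@le_trans _ _ (A * F i))//.
    by rewrite ler_peMl ?F0.
  by rewrite ler_wpM2l// (bigD1 i)//= lerDl sumr_ge0// => j _; exact: F0.
rewrite SY (addrC (\sum_(j in K) _)) -addrA.
apply: bH => //.
- by rewrite addr_ge0.
- move=> j; rewrite inE => /andP[jK jY].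
  rewrite mulrDr -natr1 mulrDl mul1r addrC lerD ?HT//.
  have [l lK Fl] := HK F FF j jY.
  rewrite (le_trans Fl)// ler_wpM2l// (bigD1 l)//= lerDl.
  by apply: sumr_ge0 => u _; exact: F0.
- by rewrite inE iK.
Qed.

Lemma harmonic_le_ln (R : realType) (n : nat) : (0 < n)%N ->
  \sum_(0 <= l < n) l.+1%:R^-1 <= 1 + ln n%:R :> R.
Proof.
elim: n => // -[|n] ih _.
  by rewrite big_nat1 ln1 invr1 addr0.
rewrite big_nat_recr //= (le_trans (lerD (ih isT) (lexx _)))// -addrA lerD2l.
have n1 : 0 < n.+1%:R :> R by [].
have n2 : 0 < n.+2%:R :> R by [].
have -> : ln (n.+1%:R : R) = ln n.+2%:R + ln (1 + - n.+2%:R^-1).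
  rewrite -lnM ?posrE//.
    by congr ln; rewrite mulrDr mulr1 mulrN divff ?gt_eqF// -[n.+2%:R]natr1 addrK.
  by rewrite subr_gt0 invf_lt1// ltr1n.
have := @le_ln1Dx R (- n.+2%:R^-1).
by rewrite ltrN2 invf_lt1// ltr1n => /(_ isT) h; rewrite -addrA gerDl -lerBrDr sub0r.
Qed.

(** * Distance to a line and to a union of lines *)

Definition proj_off (R : realType) m (u y : 'cV[R]_m) : 'cV[R]_m :=
  y - dot y u *: u.

Definition ldist (R : realType) m (v u y : 'cV[R]_m) : R :=
  norm2 (proj_off u (y - v)).

Lemma norm2_1 (R : realType) m (u : 'cV[R]_m) : norm2 u = 1 -> dot u u = 1.
Proof. by move=> u1; rewrite -norm2_sqr u1 expr1n. Qed.

Lemma ldist_ge0 (R : realType) m (v u y : 'cV[R]_m) : 0 <= ldist v u y.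
Proof. exact: norm2_ge0. Qed.

Lemma ldistE (R : realType) m (v u y : 'cV[R]_m) :
  ldist v u y = norm2 (y - (v + dot (y - v) u *: u)).
Proof. by rewrite /ldist /proj_off opprD addrA. Qed.

Lemma ldist_le (R : realType) m (v u y : 'cV[R]_m) s :
  norm2 u = 1 -> ldist v u y <= norm2 (y - (v + s *: u)).
Proof.
move=> /norm2_1 u1; rewrite -ler_sqr ?nnegrE ?norm2_ge0// !norm2_sqr opprD addrA.
move: (y - v) => w; rewrite /proj_off !dot_subZ u1.
by have := sqr_ge0 (s - dot w u); lra.
Qed.

Lemma ldist_triangle (R : realType) m (v u a b : 'cV[R]_m) :
  norm2 u = 1 -> ldist v u a <= norm2 (a - b) + ldist v u b.
Proof.
move=> u1; rewrite [X in _ + X]ldistE (le_trans (ldist_le v a (dot (b - v) u) u1))//.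
by rewrite (le_trans _ (norm2D _ _))// addrA subrK.
Qed.

(** Puts distances along a line into the shape that [collinear_coreset] handles, the norm of an
    affine function of the parameter. *)
Lemma ldist_affine (R : realType) m (v u V U : 'cV[R]_m) s :
  ldist v u (V + s *: U) = norm2 (proj_off u (V - v) + s *: proj_off u U).
Proof.
rewrite /ldist /proj_off !dotE; congr norm2.
by apply/matrixP => i j; rewrite !mxE; ring.
Qed.

(* [D] is the distance to the union of the lines [v l + R u l]. *)
Definition is_min_dist (R : realType) m (k : nat) (v u : 'I_k -> 'cV[R]_m)
    (D : 'cV[R]_m -> R) : Prop :=
  (forall y, exists l, D y = ldist (v l) (u l) y) /\
  (forall y l, D y <= ldist (v l) (u l) y).

Lemma min_dist_ge0 (R : realType) m k (v u : 'I_k -> 'cV[R]_m) D y :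
  is_min_dist v u D -> 0 <= D y.
Proof. by move=> [/(_ y)[l ->] _]; exact: ldist_ge0. Qed.

Lemma min_dist_triangle (R : realType) m k (v u : 'I_k -> 'cV[R]_m) D a b :
  (forall l, norm2 (u l) = 1) ->
  is_min_dist v u D -> D a <= norm2 (a - b) + D b.
Proof.
move=> u1 [Dex Dle]; have [l ->] := Dex b.
by rewrite (le_trans (Dle a l))// ldist_triangle.
Qed.

Lemma powR_ge1 (R : realType) (a z : R) : 1 <= a -> 0 <= z -> 1 <= a `^ z.
Proof. by move=> a1 z0; have := ler_powR a1 z0; rewrite powRr0. Qed.

Lemma powR_add_le (R : realType) (a b c z : R) : 0 <= z -> 0 <= a -> 0 <= b ->
  0 <= c -> c <= a + b -> c `^ z <= 2 `^ z * (a `^ z + b `^ z).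
Proof.
move=> z0 a0 b0 c0 cab.
have [ab|ab] := leP a b.
  rewrite (@le_trans _ _ ((2 * b) `^ z))//.
    by apply: ge0_ler_powR; rewrite ?nnegrE ?mulr_ge0//; lra.
  by rewrite powRM// ler_wpM2l ?powR_ge0// lerDr powR_ge0.
rewrite (@le_trans _ _ ((2 * a) `^ z))//.
  by apply: ge0_ler_powR; rewrite ?nnegrE ?mulr_ge0//; lra.
by rewrite powRM// ler_wpM2l ?powR_ge0// lerDl powR_ge0.
Qed.

(** Peels off cores of size at most [3 * 2 ^ k]. Taking for [M] the largest distance on a core,
    every point of the line that remains is within [5 * M], whence [5 ^ z]; the logarithm is the
    harmonic sum over the layers. *)
Lemma collinear_sensitivity (R : realType) d k (I : finType) (z : R)
    (V U : 'cV[R]_d) (tau : I -> R) (Y : {set I}) :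
  1 <= z -> (0 < #|I|)%N ->
  exists b : I -> R, [/\ forall i, 0 <= b i,
    \sum_(i in Y) b i <= (3 * 2 ^ k)%:R * (1 + ln #|I|%:R) &
    forall (v u : 'I_k -> 'cV[R]_d) D, is_min_dist v u D ->
      forall i, i \in Y -> D (V + tau i *: U) `^ z <=
        5 `^ z * b i * \sum_(j in Y) D (V + tau j *: U) `^ z].
Proof.
move=> z1 I0.
have z0 : 0 <= z by rewrite (le_trans ler01).
pose Fam (F : I -> R) := exists (v u : 'I_k -> 'cV[R]_d) D, is_min_dist v u D /\
  F = fun i => D (V + tau i *: U) `^ z.
have A1 : 1 <= 5 `^ z :> R by apply: powR_ge1; rewrite ?ler1n.
have [||b [b0 bsum bH]] :=
  @sensitivity_peeling R I Fam (5 `^ z) (3 * 2 ^ k)%N Y 0 A1.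
- by move=> F [v [u [D [HD ->]]]] i; rewrite powR_ge0.
- move=> Y1 Y10.
  have [K [KY Kc K0 HK]] := collinear_coreset tau k Y1.
  exists K; split => //; [exact: K0|exact: leq_trans (leq_addr _ _) Kc|].
  move=> F [v [u [D [HD ->]]]] i iY.
  have [i0 i0K] := finset.set0Pn _ (K0 Y10).
  case: (arg_maxP (fun i => D (V + tau i *: U)) i0K) => j jK jmax.
  exists j => //.
  have Dj0 : 0 <= D (V + tau j *: U) by exact: min_dist_ge0 HD.
  have [] := HK d 'I_k [set: 'I_k]%SET (fun l => proj_off (u l) (V - v l))
    (fun l => proj_off (u l) U) (D (V + tau j *: U)) _ Dj0 _ i iY.
  + by rewrite cardsT card_ord.
  + move=> y yK; have [/(_ (V + tau y *: U))[l Dl] _] := HD.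
    exists l; rewrite ?inE// -ldist_affine -Dl; exact: jmax.
  move=> l _; rewrite -ldist_affine => hl.
  rewrite -powRM//; apply: ge0_ler_powR; rewrite ?nnegrE ?mulr_ge0//.
    exact: min_dist_ge0 HD.
  by case: HD => _ Dle; exact: le_trans (Dle _ l) hl.
exists b; split => //.
- rewrite (le_trans bsum)// add0n ler_wpM2l//.
  apply: le_trans (harmonic_le_ln R I0).
  rewrite [leRHS](big_cat_nat (n := #|Y|)) //=; last exact: max_card.
  by rewrite lerDl sumr_ge0.
- move=> v u D HD i iY.
  have := bH _ 0 (ex_intro _ v (ex_intro _ u (ex_intro _ D (conj HD erefl)))) (lexx _) _ i iY.
  by rewrite addr0; apply => j _; rewrite mul0r mulr0.
Qed.

(** Each point is compared with the point of parameter [tau i] on its own line, where the collinear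
    bound applies. The passage from points to their representatives and the passage back cost
    [2 ^ z] each, so 20 is [2 * 5 * 2]. The share [a i / O] accounts for the point's own
    displacement and has total mass 1. *)
Lemma line_sensitivity (R : realType) d k (I : finType) (z : R)
    (V U : 'I_k -> 'cV[R]_d) (tau : I -> R) (g : I -> 'I_k) (x : I -> 'cV[R]_d) :
  let a i := norm2 (x i - (V (g i) + tau i *: U (g i))) `^ z in
  let O := \sum_i a i in
  1 <= z -> (0 < #|I|)%N -> 0 < O ->
  exists mu : I -> R, [/\ forall i, 0 <= mu i,
    \sum_i mu i <= 1 + k%:R * ((3 * 2 ^ k)%:R * (1 + ln #|I|%:R)) &
    forall (v u : 'I_k -> 'cV[R]_d) D, (forall l, norm2 (u l) = 1) ->
      is_min_dist v u D ->
      forall i, D (x i) `^ z <= 20 `^ z * mu i * (O + \sum_j D (x j) `^ z)].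
Proof.
move=> a O z1 I0 O0.
have z0 : 0 <= z by rewrite (le_trans ler01).
pose Y l := [set i | g i == l]%SET.
have /choice[b Hb] : forall l, exists b : I -> R, [/\ forall i, 0 <= b i,
    \sum_(i in Y l) b i <= (3 * 2 ^ k)%:R * (1 + ln #|I|%:R) &
    forall (v u : 'I_k -> 'cV[R]_d) D, is_min_dist v u D ->
      forall i, i \in Y l -> D (V l + tau i *: U l) `^ z <=
        5 `^ z * b i * \sum_(j in Y l) D (V l + tau j *: U l) `^ z].
  by move=> l; exact: collinear_sensitivity.
have a0 i : 0 <= a i by exact: powR_ge0.
exists (fun i => a i / O + b (g i) i); split.
- by move=> i; rewrite addr_ge0 ?divr_ge0 ?(ltW O0)//; case: (Hb (g i)).
- rewrite big_split /= -mulr_suml divff ?gt_eqF// lerD2l.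
  rewrite (partition_big g xpredT)//=.
  rewrite -[k in k%:R]card_ord mulr_natl -sumr_const; apply: ler_sum => l _.
  have [_ h _] := Hb l; apply: le_trans h; rewrite le_eqVlt; apply/orP; left.
  apply/eqP; rewrite [RHS](eq_bigl (fun i => g i == l)); last by move=> i; rewrite inE.
  by apply: eq_bigr => i /eqP ->.
move=> v u D u1 HD i.
set S := \sum_j D (x j) `^ z.
have S0 : 0 <= S by apply: sumr_ge0 => j _; exact: powR_ge0.
pose p j := V (g j) + tau j *: U (g j).
have D0 y : 0 <= D y by exact: min_dist_ge0 HD.
have [b0 _ /(_ v u D HD i)] := Hb (g i).
rewrite inE eqxx => /(_ isT) Hi.
have Dx : D (x i) `^ z <= 2 `^ z * (a i + D (p i) `^ z).
  by apply: powR_add_le; rewrite ?norm2_ge0//; exact: min_dist_triangle HD.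
have Dp : \sum_(j in Y (g i)) D (V (g i) + tau j *: U (g i)) `^ z <=
    2 `^ z * (O + S).
  rewrite mulrDr !mulr_sumr -big_split /= big_mkcond /=; apply: ler_sum => j _.
  rewrite inE; case: eqVneq => [<-|_].
    rewrite -mulrDr; apply: powR_add_le; rewrite ?norm2_ge0//.
    by rewrite norm2_distC; exact: min_dist_triangle HD.
  by rewrite addr_ge0 ?mulr_ge0 ?powR_ge0.
have OS : 0 <= O + S by rewrite addr_ge0// ltW.
apply: (le_trans Dx).
have p20 : 20 `^ z = 2 `^ z * (5 `^ z * 2 `^ z) :> R.
  rewrite -!powRM//; congr (_ `^ _); ring.
have h52 : 1 <= 5 `^ z * 2 `^ z :> R.
  by rewrite -powRM//; apply: powR_ge1; rewrite // -natrM ler1n.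
rewrite p20 -!mulrA ler_wpM2l ?powR_ge0// mulrDl !mulrDr lerD//.
- have w0 : 0 <= a i / O by rewrite divr_ge0 ?(ltW O0).
  rewrite -[leLHS](divfK (lt0r_neq0 O0)); apply: ler_wpDr.
    exact: mulr_ge0 (powR_ge0 _ _) (mulr_ge0 (powR_ge0 _ _) (mulr_ge0 w0 S0)).
  by rewrite [leRHS]mulrA ler_peMl// mulr_ge0// ltW.
- rewrite (le_trans Hi)// -!mulrDr -!mulrA ler_wpM2l ?powR_ge0//.
  by rewrite [leRHS]mulrCA ler_wpM2l.
Qed.

(** * The deterministic lower bound *)

Lemma avoid_seq (R : realType) (F : seq R) (a kappa : R) : 0 < kappa ->
  exists2 y, y \notin F & `|y - a| <= kappa.
Proof.
move=> k0; set m := size F.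
pose f (j : nat) : R := a + kappa * (j%:R / m.+1%:R).
have finj : injective f.
  move=> i j /addrI /(mulfI (lt0r_neq0 k0)) /(mulIf _) => /(_ _)/eqP.
  by rewrite eqr_nat => h; apply/eqP/h; rewrite invr_eq0 pnatr_eq0.
have [/allP sub|/allPn[y /mapP[j]]] :=
    boolP (all (mem F) [seq f j | j <- iota 0 m.+1]).
  have := uniq_leq_size _ sub.
  by rewrite size_map size_iota -/m ltnn map_inj_uniq// iota_uniq => /(_ isT).
rewrite mem_iota add0n => /andP[_ jm] -> yF; exists (f j) => //.
rewrite /f addrAC subrr add0r normrM gtr0_norm// ler_piMr ?(ltW k0)//.
by rewrite ger0_norm ?divr_ge0// ler_pdivrMr// mul1r ler_nat ltnW.
Qed.

(** Several points may have the same foot on a projected line, while the regression argument wants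
    distinct parameters. Shifting a parameter along a unit direction moves the foot by at most
    [kappa], which is charged to the radius. *)
Lemma injective_perturbation (R : realType) (I : finType) (s0 : I -> R)
    (kappa : R) : 0 < kappa ->
  exists s : I -> R, injective s /\ forall i, `|s i - s0 i| <= kappa.
Proof.
move=> k0.
suff [s [sinj sk]] : exists s : I -> R, {in [set: I]%SET &, injective s} /\
    forall i, `|s i - s0 i| <= kappa.
  by exists s; split => // i j; apply: sinj; rewrite inE.
move: [set: I]%SET => A.
have [n] := ubnP #|A|; elim: n => // n ih in A *; rewrite ltnS => An.
have [->|/finset.set0Pn[a aA]] := eqVneq A finset.set0.
  by exists s0; split => [i|i]; rewrite ?inE// subrr normr0 ltW.
have [|s [sinj sk]] := ih (A :\ a)%SET.
  by move: An; rewrite (cardsD1 a) aA.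
have [y yF yk] := avoid_seq [seq s i | i <- enum I] (s0 a) k0.
exists (fun i => if i == a then y else s i); split.
  have neq i : s i != y.
    by apply: contra yF => /eqP <-; apply: map_f; rewrite mem_enum.
  move=> i j iA jA; case: eqVneq => [->|ia]; case: eqVneq => [->|ja] //.
  - by move=> h; have := neq j; rewrite -h eqxx.
  - by move=> h; have := neq i; rewrite h eqxx.
  - by apply: sinj; rewrite !inE ?ia ?ja.
by move=> i; case: eqVneq => [->|].
Qed.

Lemma unit_direction (R : realType) m (w : 'cV[R]_m) : (0 < m)%N ->
  exists2 u : 'cV[R]_m, norm2 u = 1 & exists a, w = a *: u.
Proof.
move=> m0; have [->|w0] := eqVneq w 0.
  exists (delta_mx (Ordinal m0) 0); last by exists 0; rewrite scale0r.
  rewrite norm2E /dot (bigD1 (Ordinal m0))//= big1 => [|i im].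
    by rewrite !mxE !eqxx mulr1 addr0 sqrtr1.
  by rewrite !mxE (negbTE im) mulr0.
have n0 : norm2 w != 0 by rewrite norm2_eq0.
exists ((norm2 w)^-1 *: w).
  by rewrite norm2Z ger0_norm ?invr_ge0 ?norm2_ge0// mulVf.
by exists (norm2 w); rewrite scalerA divff// scale1r.
Qed.

Lemma min_dist_exists (R : realType) m k (v u : 'I_k -> 'cV[R]_m) : (0 < k)%N ->
  exists D, is_min_dist v u D.
Proof.
move=> k0; pose l0 := Ordinal k0.
exists (fun y => ldist (v [arg min_(l < l0) ldist (v l) (u l) y]%O)
                  (u [arg min_(l < l0) ldist (v l) (u l) y]%O) y).
split=> y; first by eexists.
by move=> l; case: (arg_minP (fun l => ldist (v l) (u l) y) (erefl true : xpredT l0)) => j _; exact.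
Qed.

(* [M] does not contract the plane spanned by the differences of
   [x i, x j, x k]. *)
Definition noncontracting (R : realType) d t (I : Type) (c : R) (M : 'M[R]_(t, d))
    (x : I -> 'cV[R]_d) (i j k : I) : Prop :=
  forall a1 a2 a3 : R, a1 + a2 + a3 = 0 ->
    let y := a1 *: x i + a2 *: x j + a3 *: x k in
    dot y y <= c * dot (M *m y) (M *m y).

Lemma noncontracting12 (R : realType) d t (I : Type) (c : R) (M : 'M[R]_(t, d))
    (x : I -> 'cV[R]_d) (i j k : I) :
  noncontracting c M x i j k -> noncontracting c M x j i k.
Proof.
move=> h a1 a2 a3 a0 /=; have := h a2 a1 a3; rewrite (addrC a2) => /(_ a0) /=.
by rewrite (addrC (a2 *: _)).
Qed.

Lemma noncontracting23 (R : realType) d t (I : Type) (c : R) (M : 'M[R]_(t, d))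
    (x : I -> 'cV[R]_d) (i j k : I) :
  noncontracting c M x i j k -> noncontracting c M x i k j.
Proof.
move=> h a1 a2 a3 a0 /=; have := h a1 a3 a2; rewrite addrAC => /(_ a0) /=.
by rewrite addrAC.
Qed.

(** If [kappa <= eps * a] the perturbation is a relative one. Otherwise [a + kappa] is below
    [(1 + eps^-1) * kappa <= 1], and raising to a power [z >= 1] only lowers it. The additive error
    vanishes with [kappa]. *)
Lemma powR_perturb (R : realType) (a kappa eps z : R) :
  0 <= a -> 0 < kappa -> 0 < eps -> 1 <= z ->
  (1 + eps^-1) * kappa <= 1 ->
  (a + kappa) `^ z <= (1 + eps) `^ z * a `^ z + (1 + eps^-1) * kappa.
Proof.
move=> a0 k0 e0 z1 k1; have z0 : 0 <= z by rewrite (le_trans ler01).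
have kk : 0 < (1 + eps^-1) * kappa by rewrite mulr_gt0// addr_gt0 ?invr_gt0.
have [h|h] := leP kappa (eps * a).
  apply: ler_wpDr; first exact: ltW.
  rewrite -powRM//; last by rewrite addr_ge0// ltW.
  apply: ge0_ler_powR; rewrite ?nnegrE//; last by lra.
    by rewrite addr_ge0// ltW.
  by rewrite mulr_ge0// addr_ge0// ltW.
apply: ler_wpDl; first by rewrite mulr_ge0 ?powR_ge0.
apply: le_trans (ge1r_powR _ z1); last by rewrite kk k1.
apply: ge0_ler_powR; rewrite ?nnegrE ?(ltW kk)//.
  by rewrite addr_ge0// ltW.
by rewrite mulrDl mul1r addrC lerD2l ler_pdivlMl// ltW.
Qed.

(** The lifted lines serve every point outside a set of mass at most [k * eta + delta]. On that set
    the sensitivities bound the lifted cost by [2 * K * S * mu i], where [S] is the cost of the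
    lifted lines themselves and [O <= S] by optimality. So the exceptional points contribute at most
    [theta * S], which is moved to the other side. *)
Lemma projected_cost_lower_bound (R : realType) d t k (I : finType)
    (x : I -> 'cV[R]_d) (M : 'M[R]_(t, d)) (mu : I -> R) (z O K c b eps delta : R)
    (N : nat) (v' u' : 'I_k -> 'cV[R]_t) (D' : 'cV[R]_t -> R) :
  let eta := ((N.+2)%:R + (N.+2)%:R ^+ 2) * delta in
  let theta := 2 * K * (k%:R * eta + delta) in
  (0 < k)%N -> (0 < d)%N -> 1 <= z ->
  0 < c -> 0 <= b -> c < b ^+ 2 -> 0 < eps -> 0 < delta -> 0 <= K ->
  2 * b ^+ 2 < N%:R * (eps ^+ 2 / 8) -> theta <= 1 ->
  (forall i, 0 <= mu i) ->
  (forall (v u : 'I_k -> 'cV[R]_d) D, (forall l, norm2 (u l) = 1) ->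
      is_min_dist v u D -> O <= \sum_j D (x j) `^ z) ->
  (forall (v u : 'I_k -> 'cV[R]_d) D, (forall l, norm2 (u l) = 1) ->
      is_min_dist v u D ->
      forall i, D (x i) `^ z <= K * mu i * (O + \sum_j D (x j) `^ z)) ->
  \sum_i \sum_j \sum_l mu i * mu j * mu l *
    (~~ `[< noncontracting c M x i j l >])%:R <= delta ^+ 3 ->
  (forall l, norm2 (u' l) = 1) -> is_min_dist v' u' D' ->
  (1 - theta) * O <=
    ((b + eps) * (1 + eps)) `^ z * \sum_i D' (M *m x i) `^ z.
Proof.
move=> eta theta k0 d0 z1 c0 b0 cb eps0 delta0 K0 HN theta1 mu0 Oopt sens badsum u'1 HD'.
have z0 : 0 <= z by rewrite (le_trans ler01).
pose bad i j l := ~~ `[< noncontracting c M x i j l >].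
have bad12 i j l : bad i j l = bad j i l.
  by congr (~~ _); apply: asbool_equiv_eq; split; exact: noncontracting12.
have bad23 i j l : bad i j l = bad i l j.
  by congr (~~ _); apply: asbool_equiv_eq; split; exact: noncontracting23.
pose gp i j := \sum_(l | bad i j l) mu l <= delta.
(* Markov's inequality on each index in turn: a point of [B0] sees mass above [delta] of partners
   [j], each of which has mass above [delta] of bad [l], so [delta ^+ 3] leaves mass at most [delta]
   for [B0]. *)
pose B0 := [set i | delta < \sum_(j | ~~ gp i j) mu j]%SET.
have muB0 : \sum_(i in B0) mu i <= delta.
  have d2 : 0 < delta ^+ 2 by rewrite exprn_gt0.
  rewrite -(ler_pM2r d2) -[leRHS]exprS (le_trans _ badsum)// mulr_suml big_mkcond /=.
  apply: ler_sum => i _.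
  have nn j : 0 <= \sum_l mu i * mu j * mu l * (bad i j l)%:R.
    by apply: sumr_ge0 => l _; rewrite !mulr_ge0.
  case: ifPn => [|_]; last by apply: sumr_ge0 => j _; exact: nn.
  rewrite inE => /ltW hi.
  apply: (@le_trans _ _ (\sum_(j | ~~ gp i j) mu i * mu j * delta)).
    rewrite -mulr_suml -mulr_sumr -mulrA ler_wpM2l// expr2; apply: ler_wpM2r => //; exact: ltW.
  rewrite big_mkcond /=; apply: ler_sum => j _.
  case: ifPn => [|_]; last exact: nn.
  rewrite -ltNge => /ltW hj.
  apply: (@le_trans _ _ (mu i * mu j * \sum_(l | bad i j l) mu l)).
    by rewrite ler_wpM2l ?mulr_ge0.
  rewrite mulr_sumr big_mkcond /=; apply: ler_sum => l _.
  rewrite -/(bad i j l); case: (bad i j l); first by rewrite mulr1.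
  by rewrite mulr0.
have D'0 y : 0 <= D' y by exact: min_dist_ge0 HD'.
have /choice[g Hg] : forall i, exists l,
    D' (M *m x i) = ldist (v' l) (u' l) (M *m x i) by move=> i; case: HD'.
set S' := \sum_i D' (M *m x i) `^ z.
(* Radii [D' + kappa] are positive even where [D'] vanishes, and they absorb the shift that makes
   the parameters distinct. The additive error is then made smaller than an arbitrary [xi]. *)
suff main kappa : 0 < kappa -> exists2 S, O <= S & S <= (b + eps) `^ z *
    (\sum_i (D' (M *m x i) + kappa) `^ z) + theta * S.
  have be0 : 0 < b + eps by rewrite ltr_wpDl.
  have e1 : 0 < 1 + eps^-1 by rewrite addr_gt0 ?invr_gt0.
  apply/ler_addgt0Pr => xi xi0.
  pose Q := 1 + (b + eps) `^ z * #|I|%:R.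
  have Q0 : 0 < Q by rewrite ltr_wpDr// mulr_ge0 ?powR_ge0.
  pose kappa := Num.min 1 (xi / Q) / (1 + eps^-1).
  have mm : 0 < Num.min 1 (xi / Q) by rewrite lt_min ltr01 divr_gt0.
  have kap0 : 0 < kappa by rewrite divr_gt0.
  have kapE : (1 + eps^-1) * kappa = Num.min 1 (xi / Q).
    by rewrite /kappa mulrC divfK// gt_eqF.
  have [S OS HS] := main _ kap0.
  apply: (@le_trans _ _ ((1 - theta) * S)).
    by rewrite ler_wpM2l// subr_ge0.
  have {}HS : (1 - theta) * S <= (b + eps) `^ z *
    (\sum_i (D' (M *m x i) + kappa) `^ z) by lra.
  apply: (le_trans HS).
  apply: (@le_trans _ _ ((b + eps) `^ z *
     ((1 + eps) `^ z * S' + #|I|%:R * Num.min 1 (xi / Q)))).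
    rewrite ler_wpM2l ?powR_ge0// /S' mulr_sumr mulr_natl -sumr_const -big_split /=.
    apply: ler_sum => i _; rewrite -kapE; apply: powR_perturb => //.
    by rewrite kapE ge_min lexx.
  rewrite powRM ?(ltW be0)//; last by rewrite addr_ge0// ltW.
  rewrite mulrDr mulrA lerD2l mulrA (@le_trans _ _ (Q * (xi / Q)))//.
    rewrite ler_pM ?mulr_ge0 ?powR_ge0 ?(ltW mm)//.
      by rewrite /Q lerDr.
    by rewrite ge_min lexx orbT.
  by rewrite mulrC divfK// gt_eqF.
move=> kap0.
pose s0 i := dot (M *m x i - v' (g i)) (u' (g i)).
have [s [sinj sk]] := injective_perturbation s0 kap0.
pose r i := D' (M *m x i) + kappa.
have r0 i : 0 < r i by rewrite ltr_wpDl.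
pose C l := [set i | (i \notin B0) && (g i == l)]%SET.
have /choice[vw Hvw] : forall l, exists vw : 'cV[R]_d * 'cV[R]_d,
    \sum_(i in C l | (b + eps) * r i < norm2 (x i - (vw.1 + s i *: vw.2))) mu i
    <= eta.
  move=> l.
  have [|||||v [w vw]] := @robust_line_lift R d t I (C l) mu s r x
    (fun i => M *m x i) (v' l) (u' l) bad c b eps delta N c0 b0 cb eps0 (ltW delta0) HN mu0 bad12 bad23.
  - by move=> i; rewrite !inE => /andP[]; rewrite -leNgt.
  - by move=> i _.
  - move=> i; rewrite inE => /andP[_ /eqP gl].
    rewrite -norm2_sqr lerXn2r ?nnegrE ?norm2_ge0 ?(ltW (r0 i))//.
    have -> : M *m x i - (v' l + s i *: u' l) =
        (M *m x i - (v' l + s0 i *: u' l)) - (s i - s0 i) *: u' l.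
      by apply/matrixP => a e; rewrite !mxE; ring.
    rewrite (le_trans (norm2B _ _))// norm2Z u'1 mulr1 lerD//.
    by rewrite Hg gl ldistE /s0 gl.
  - by move=> i j _ _; exact: sinj.
  - move=> i j e _ _ _ _ _ _; rewrite /bad negbK => /asboolP nc.
    have -> : detv s (fun i => M *m x i) i j e = M *m detv s x i j e.
      by rewrite /detv !linearD !linearZ.
    by apply: nc; ring.
  by exists (v, w).
have /choice[u Hu] : forall l, exists u : 'cV[R]_d, norm2 u = 1 /\
    exists a, (vw l).2 = a *: u.
  by move=> l; have [u u1 ua] := unit_direction (vw l).2 d0; exists u.
have u1 l : norm2 (u l) = 1 by case: (Hu l).
pose v l := (vw l).1.
have [D HD] := min_dist_exists v u k0.
exists (\sum_j D (x j) `^ z); first exact: Oopt HD.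
set S := \sum_j _.
have OS : O <= S by exact: Oopt HD.
have S0 : 0 <= S by apply: sumr_ge0 => j _; exact: powR_ge0.
pose viol i := (i \in B0) || ((b + eps) * r i < norm2 (x i - (v (g i) + s i *: (vw (g i)).2))).
have Dok i : ~~ viol i -> D (x i) `^ z <= (b + eps) `^ z * r i `^ z.
  rewrite /viol negb_or -leNgt => /andP[_ h].
  rewrite -powRM ?(ltW (r0 i)) ?addr_ge0 ?(ltW eps0)//.
  apply: ge0_ler_powR; rewrite ?nnegrE//.
  - exact: min_dist_ge0 HD.
  - by rewrite mulr_ge0 ?(ltW (r0 i)) ?addr_ge0 ?(ltW eps0).
  apply: le_trans h; case: HD => _ /(_ (x i) (g i)) h; apply: (le_trans h).
  have [_ [a ->]] := Hu (g i); rewrite scalerA; exact: ldist_le.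
have Dbad i : D (x i) `^ z <= 2 * K * S * mu i.
  rewrite (le_trans (sens _ _ _ u1 HD i))// -/S.
  have -> : 2 * K * S * mu i = K * mu i * (S + S) by ring.
  by rewrite ler_wpM2l ?mulr_ge0// lerD2r.
have muviol : \sum_(i | viol i) mu i <= k%:R * eta + delta.
  apply: (@le_trans _ _ (\sum_l (\sum_(i in C l | (b + eps) * r i <
      norm2 (x i - ((vw l).1 + s i *: (vw l).2))) mu i) + \sum_(i in B0) mu i)).
    rewrite [X in _ <= _ + X]big_mkcond /= [leLHS]big_mkcond /=.
    under [X in _ <= X + _]eq_bigr do rewrite big_mkcond /=.
    rewrite exchange_big -big_split /=; apply: ler_sum => i _.
    have P0 : 0 <= \sum_l (if (i \in C l) && ((b + eps) * r i <
      norm2 (x i - ((vw l).1 + s i *: (vw l).2))) then mu i else 0).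
      by apply: sumr_ge0 => l _; case: ifP.
    rewrite /viol; have [iB|iB] := boolP (i \in B0); rewrite /=.
      by rewrite ler_wpDl.
    rewrite addr0; case: ifPn => [h|_]//.
    rewrite (bigD1 (g i))//= inE iB eqxx h /= lerDl.
    by apply: sumr_ge0 => l _; case: ifP.
  rewrite lerD// -[k in k%:R]card_ord mulr_natl -sumr_const.
  by apply: ler_sum => l _; exact: Hvw.
rewrite [leLHS](bigID viol) /= [leLHS]addrC lerD//.
  rewrite mulr_sumr [leLHS]big_mkcond /=; apply: ler_sum => i _.
  by case: ifPn => [/Dok//|_]; rewrite mulr_ge0 ?powR_ge0.
rewrite (@le_trans _ _ (\sum_(i | viol i) 2 * K * S * mu i))//.
  by apply: ler_sum => i _; exact: Dbad.
by rewrite -mulr_sumr /theta [leRHS]mulrAC ler_wpM2l// !mulr_ge0.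
Qed.

(** * Existence of optimal lines *)

Lemma norm_powR_continuous (R : realType) (z : R) : 1 <= z ->
  continuous (fun a : R => `|a| `^ z).
Proof.
move=> z1 a; have z0 : 0 < z by rewrite (lt_le_trans ltr01).
have [->|a0] := eqVneq a 0.
  rewrite /continuous_at /= normr0 powR0 ?gt_eqF//; apply/cvgrPdist_lt => e e0.
  near=> y; rewrite sub0r normrN ger0_norm ?powR_ge0//.
  have [->|y0] := eqVneq y 0; first by rewrite normr0 powR0 ?gt_eqF.
  have ye : `|y| < Num.min e 1.
    near: y; apply: (@nbhs0_lt _ R^o); by rewrite lt_min e0 ltr01.
  move: ye; rewrite lt_min => /andP[ye y1].
  apply: le_lt_trans ye; apply: ge1r_powR => //.
  by rewrite normr_gt0 y0 ltW.
apply: (@continuous_comp _ _ _ (fun a : R => `|a|) (fun a => a `^ z)).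
  exact: norm_continuous.
apply/differentiable_continuous/derivable1_diffP/derivable_powR.
by rewrite in_itv/= normr_gt0 a0.
Unshelve. all: by end_near. Qed.

Lemma continuous_comp_real (R : realType) (T : topologicalType) (f : T -> R)
    (g : R -> R) :
  continuous f -> continuous g -> continuous (fun x => g (f x)).
Proof. by move=> fc gc x; apply: continuous_comp; [exact: fc|exact: gc]. Qed.

Lemma ldist_continuous (R : realType) (T : topologicalType) m
    (v u : T -> 'cV[R]_m) (y : 'cV[R]_m) :
  (forall c, continuous (fun p => v p c 0)) ->
  (forall c, continuous (fun p => u p c 0)) ->
  continuous (fun p => ldist (v p) (u p) y).
Proof.
move=> vc uc.
have yvc c : continuous (fun p => (y - v p) c 0).
  have -> : (fun p => (y - v p) c 0) = (fun p => y c 0 - v p c 0).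
    by apply/funext => p; rewrite !mxE.
  apply: continuous_addr; first exact: cst_continuous.
  exact: continuous_oppr.
have pc c : continuous (fun p => proj_off (u p) (y - v p) c 0).
  have -> : (fun p => proj_off (u p) (y - v p) c 0) =
      (fun p => (y - v p) c 0 - dot (y - v p) (u p) * u p c 0).
    by apply/funext => p; rewrite !mxE.
  apply: continuous_addr => //; apply: continuous_oppr.
  apply: continuous_mulr => //; exact: dot_continuous.
have -> : (fun p => ldist (v p) (u p) y) =
    (fun p => Num.sqrt (dot (proj_off (u p) (y - v p)) (proj_off (u p) (y - v p)))).
  by apply/funext => p; rewrite /ldist norm2E.
apply: continuous_comp_real; last exact: sqrt_continuous.
exact: dot_continuous.
Qed.

Lemma coord_le_norm2 (R : realType) m (x : 'cV[R]_m) c : `|x c 0| <= norm2 x.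
Proof.
rewrite -ler_sqr ?nnegrE ?norm2_ge0// norm2_sqr real_normK ?num_real//.
rewrite /dot (bigD1 c)//= -expr2 lerDl.
by apply: sumr_ge0 => i _; rewrite -expr2 sqr_ge0.
Qed.

Lemma term_le_sum (R : realType) (I : finType) (C : {set I}) (F : I -> R) i :
  (forall i, 0 <= F i) -> i \in C -> F i <= \sum_(j in C) F j.
Proof. by move=> F0 iC; rewrite (bigD1 i)//= lerDl sumr_ge0. Qed.

(** Normalises the base point of a line to be orthogonal to its direction, which makes the
    parametrisation coercive. *)
Lemma ldist_foot (R : realType) m (v u y : 'cV[R]_m) : norm2 u = 1 ->
  ldist (proj_off u v) u y = ldist v u y.
Proof.
move=> /norm2_1 u1; rewrite /ldist; congr norm2.
by apply/matrixP => i j; rewrite /proj_off !dotE u1 !mxE; ring.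
Qed.

(** With [u] a unit vector and [v] orthogonal to it, the norm of [v] is the distance of the line
    from the origin. A line of bounded cost passes within bounded distance of [x i0], so its
    parameters stay in a box. *)
Lemma best_line_exists (R : realType) m (I : finType) (C : {set I})
    (x : I -> 'cV[R]_m) (z : R) : (0 < m)%N -> 1 <= z ->
  exists v u : 'cV[R]_m, norm2 u = 1 /\
    forall v' u', norm2 u' = 1 -> \sum_(i in C) ldist v u (x i) `^ z <=
      \sum_(i in C) ldist v' u' (x i) `^ z.
Proof.
move=> m0 z1.
have [u0 u01 _] := unit_direction (0 : 'cV[R]_m) m0.
have [->|/finset.set0Pn[i0 i0C]] := eqVneq C finset.set0.
  exists 0, u0; split; first exact: u01.
  by move=> v' u' _; apply: ler_sum => i i0; exfalso; move: i0; rewrite inE.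
pose vp (p : 'rV[R]_(m + m)) : 'cV[R]_m := (lsubmx p)^T.
pose up (p : 'rV[R]_(m + m)) : 'cV[R]_m := (rsubmx p)^T.
(* The absolute value changes nothing on distances, but it makes the power continuous on the whole
   real line. *)
pose f p := \sum_(i in C) `|ldist (vp p) (up p) (x i)| `^ z.
pose D := [set p | dot (up p) (up p) = 1] `&` [set p | dot (vp p) (up p) = 0].
have vc c : continuous (fun p => vp p c 0).
  have -> : (fun p => vp p c 0) = (fun p => p 0 (lshift m c)).
    by apply/funext => p; rewrite !mxE.
  exact: coord_continuous.
have uc c : continuous (fun p => up p c 0).
  have -> : (fun p => up p c 0) = (fun p => p 0 (rshift m c)).
    by apply/funext => p; rewrite !mxE.
  exact: coord_continuous.
have fc : continuous f.
  apply: continuous_sum => i _.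
  apply: (@continuous_comp_real R _ _ (fun a => `|a| `^ z)).
    exact: ldist_continuous.
  exact: norm_powR_continuous.
have Dcl : closed D.
  apply: closedI.
    apply: (@preimage_closed _ _ (fun p => dot (up p) (up p)) [set 1]).
      by move=> p _; exact: (@dot_continuous R _ m up up uc uc p).
    exact: closed_eq.
  apply: (@preimage_closed _ _ (fun p => dot (vp p) (up p)) [set 0]).
    by move=> p _; exact: (@dot_continuous R _ m vp up vc uc p).
  exact: closed_eq.
pose mk (v u : 'cV[R]_m) : 'rV[R]_(m + m) := row_mx v^T u^T.
have vpmk v u : vp (mk v u) = v by rewrite /vp /mk row_mxKl trmxK.
have upmk v u : up (mk v u) = u by rewrite /up /mk row_mxKr trmxK.
pose p0 := mk 0 u0.
have Dp0 : D p0.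
  by split; rewrite /= ?vpmk ?upmk ?dot0l// norm2_1.
have f0 p : 0 <= f p by apply: sumr_ge0 => i _; exact: powR_ge0.
have [|p [Dp1 Dp2] pmin] := closed_coercive_min (M := 1 + norm2 (x i0) + (1 + f p0)) fc Dcl Dp0.
  move=> p [/= Dp1 Dp2] fp j.
  have up1 : norm2 (up p) = 1 by rewrite norm2E Dp1 sqrtr1.
  have l1 : ldist (vp p) (up p) (x i0) <= 1 + f p0.
    have [h|h] := leP (ldist (vp p) (up p) (x i0)) 1.
      by rewrite (le_trans h)// lerDl.
    apply: (@le_trans _ _ (ldist (vp p) (up p) (x i0) `^ z)).
      by apply: le1r_powR => //; exact: ltW.
    apply: (@le_trans _ _ (f p)); last by apply: (le_trans fp); rewrite lerDr.
    have := @term_le_sum R I C (fun i => `|ldist (vp p) (up p) (x i)| `^ z) i0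
      (fun i => powR_ge0 _ _) i0C.
    by rewrite /= (ger0_norm (ldist_ge0 _ _ _)); apply.
  have vpB : norm2 (vp p) <= norm2 (x i0) + (1 + f p0).
    have -> : norm2 (vp p) = ldist (vp p) (up p) 0.
      by rewrite /ldist /proj_off sub0r dotNl Dp2 oppr0 scale0r subr0 norm2N.
    rewrite (le_trans (ldist_triangle (vp p) 0 (x i0) up1))// sub0r norm2N.
    by rewrite lerD2l.
  rewrite -[p]hsubmxK -[lsubmx p]trmxK -[rsubmx p]trmxK -/(vp p) -/(up p).
  case: (split_ordP j) => c ->; rewrite ?row_mxEl ?row_mxEr mxE.
    rewrite (le_trans (coord_le_norm2 _ _))// (le_trans vpB)//.
    by rewrite -addrA lerDr.
  rewrite (le_trans (coord_le_norm2 _ _))// up1 -addrA lerDl.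
  by rewrite addr_ge0 ?norm2_ge0// addr_ge0.
exists (vp p), (up p).
have up1 : norm2 (up p) = 1 by rewrite norm2E Dp1 sqrtr1.
split; first exact: up1.
move=> v' u' u'1.
have fE p' : f p' = \sum_(i in C) ldist (vp p') (up p') (x i) `^ z.
  by apply: eq_bigr => i _; rewrite (ger0_norm (ldist_ge0 _ _ _)).
have dd : D (mk (proj_off u' v') u').
  split; rewrite /= ?vpmk ?upmk ?norm2_1//.
  by rewrite /proj_off !dotE norm2_1// mulr1 subrr.
have := pmin _ dd; rewrite !fE vpmk upmk.
by under [X in _ <= X -> _]eq_bigr do rewrite (ldist_foot _ _ u'1).
Qed.

Lemma closest_point_ldist (R : realType) m (v u y : 'cV[R]_m) : norm2 u = 1 ->
  norm2 (y - closest_point [set v + s *: u | s in [set: R]] y) = ldist v u y.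
Proof.
move=> u1; set l := [set _ | _ in _].
have lfoot : l (v + dot (y - v) u *: u) by exists (dot (y - v) u).
have [] : [set p | l p /\ forall q, l q -> norm2 (y - p) <= norm2 (y - q)]
    (closest_point l y).
  apply: xgetPex; exists (v + dot (y - v) u *: u); split => //.
  by move=> _ [s _ <-]; rewrite -ldistE; exact: ldist_le.
move=> [s _ <-] h; apply/eqP; rewrite eq_le ldist_le// andbT ldistE.
exact: h.
Qed.

Definition line (R : realType) m (v u : 'cV[R]_m) : set 'cV[R]_m :=
  [set v + s *: u | s in [set: R]].

Lemma cost_min_dist (R : realType) m k (z : R) (Y : {fset 'cV[R]_m})
    (v u : 'I_k -> 'cV[R]_m) D : (0 < k)%N -> 0 <= z ->
  (forall l, norm2 (u l) = 1) -> is_min_dist v u D ->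
  cost z Y (fun l => line (v l) (u l)) = (\sum_(y <- Y) D y `^ z) `^ z^-1.
Proof.
move=> k0 z0 u1 HD; rewrite /cost; congr (_ `^ _); apply: eq_bigr => y _.
set A := [set _ | _ in _].
have AE l : norm2 (y - closest_point (line (v l) (u l)) y) `^ z =
    ldist (v l) (u l) y `^ z by rewrite closest_point_ldist.
have [Dex Dle] := HD.
have D0 : 0 <= D y by exact: min_dist_ge0 HD.
have lbA : lbound A (D y `^ z).
  move=> _ [l _ <-]; rewrite AE.
  by apply: ge0_ler_powR; rewrite ?nnegrE ?ldist_ge0.
apply/eqP; rewrite eq_le; apply/andP; split.
  apply: ge_inf; first by exists (D y `^ z).
  by have [l Dl] := Dex y; exists l => //; rewrite AE Dl.
apply: lb_le_inf => //; have l0 := Ordinal k0.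
by exists (norm2 (y - closest_point (line (v l0) (u l0)) y) `^ z); exists l0.
Qed.

Lemma lines_param (R : realType) m k (L : 'I_k -> set 'cV[R]_m) :
  (forall l, is_line (L l)) -> exists v u : 'I_k -> 'cV[R]_m,
    (forall l, norm2 (u l) = 1) /\ L = fun l => line (v l) (u l).
Proof.
move=> HL.
have /choice[vu Hvu] : forall l, exists vu : 'cV[R]_m * 'cV[R]_m,
    norm2 vu.2 = 1 /\ L l = line vu.1 vu.2.
  by move=> l; have [v [u [u1 E]]] := HL l; exists (v, u).
exists (fun l => (vu l).1), (fun l => (vu l).2); split=> [l|].
  by case: (Hvu l).
by apply/funext => l; case: (Hvu l).
Qed.

Lemma line_is_line (R : realType) m (v u : 'cV[R]_m) :
  norm2 u = 1 -> is_line (line v u).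
Proof. by move=> u1; exists v, u. Qed.

Lemma ler_sum_fibers (R : realType) (I J : finType) (g : I -> J)
    (F G : I -> R) :
  (forall l, \sum_(i in [set i | g i == l]%SET) F i <=
             \sum_(i in [set i | g i == l]%SET) G i) ->
  \sum_i F i <= \sum_i G i.
Proof.
move=> h; have E (H : I -> R) :
    \sum_i H i = \sum_l \sum_(i in [set i | g i == l]%SET) H i.
  rewrite (partition_big g xpredT)//; apply: eq_bigr => l _.
  by apply: eq_bigl => i; rewrite inE.
by rewrite !E; apply: ler_sum.
Qed.

(** Finitely many assignments of points to indices exist. Each cluster receives a best line, and the
    cheapest assignment wins: any competing family induces an assignment by nearest lines, and the
    best lines of its clusters cost no more. *)
Lemma optimal_lines_exist (R : realType) m k (z : R) (Y : {fset 'cV[R]_m}) :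
  (0 < k)%N -> (0 < m)%N -> 1 <= z ->
  exists L : 'I_k -> set 'cV[R]_m, optimal_lines z Y L.
Proof.
move=> k0 m0 z1; have z0 : 0 <= z by rewrite (le_trans ler01).
pose x (i : Y) : 'cV[R]_m := val i.
have /choice[vu Hvu] : forall C : {set Y}, exists vu : 'cV[R]_m * 'cV[R]_m,
    norm2 vu.2 = 1 /\ forall v' u', norm2 u' = 1 ->
    \sum_(i in C) ldist vu.1 vu.2 (x i) `^ z <=
      \sum_(i in C) ldist v' u' (x i) `^ z.
  by move=> C; have [v [u [u1 h]]] := best_line_exists C x m0 z1; exists (v, u).
pose C (sg : {ffun Y -> 'I_k}) l := [set i | sg i == l]%SET.
pose F sg := \sum_i ldist (vu (C sg (sg i))).1 (vu (C sg (sg i))).2 (x i) `^ z.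
pose sg0 : {ffun Y -> 'I_k} := [ffun=> Ordinal k0].
case: (arg_minP F (erefl true : xpredT sg0)) => sg _ sgmin.
pose v l := (vu (C sg l)).1; pose u l := (vu (C sg l)).2.
have u1 l : norm2 (u l) = 1 by case: (Hvu (C sg l)).
exists (fun l => line (v l) (u l)); split=> [l|L'].
  exact: line_is_line.
move=> /lines_param[v' [u' [u'1 ->]]].
have [D HD] := min_dist_exists v u k0; have [D' HD'] := min_dist_exists v' u' k0.
rewrite (cost_min_dist _ k0 z0 u1 HD) (cost_min_dist _ k0 z0 u'1 HD').
apply: ge0_ler_powR.
- by rewrite invr_ge0.
- by rewrite nnegrE; apply: sumr_ge0 => y _; exact: powR_ge0.
- by rewrite nnegrE; apply: sumr_ge0 => y _; exact: powR_ge0.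
rewrite !big_seq_fsetE /=.
have D0 y : 0 <= D y by exact: min_dist_ge0 HD.
apply: (@le_trans _ _ (F sg)).
  apply: ler_sum => i _; apply: ge0_ler_powR.
  - exact: z0.
  - by rewrite nnegrE.
  - by rewrite nnegrE ldist_ge0.
  - by case: HD => _; apply.
have [D'ex _] := HD'.
have /choice[sg' Hsg'] : forall i : Y, exists l, D' (x i) = ldist (v' l) (u' l) (x i).
  by move=> i; exact: D'ex.
pose sgf : {ffun Y -> 'I_k} := [ffun i => sg' i].
apply: (le_trans (sgmin sgf isT)).
apply: (@le_trans _ _ (\sum_i ldist (v' (sgf i)) (u' (sgf i)) (x i) `^ z)); last first.
  by apply: ler_sum => i _; rewrite ffunE -Hsg' lexx.
apply: (@ler_sum_fibers R _ _ sgf) => l.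
have [_ /(_ (v' l) (u' l) (u'1 l)) h] := Hvu (C sgf l).
apply: (@le_trans _ _ (\sum_(i in C sgf l)
    ldist (vu (C sgf l)).1 (vu (C sgf l)).2 (x i) `^ z)).
  by apply: ler_sum => i; rewrite inE => /eqP ->; rewrite lexx.
apply: (le_trans h).
by apply: ler_sum => i; rewrite inE => /eqP ->; rewrite lexx.
Qed.

(** * Law of the projected norm *)

Lemma ge0_integral_normal_prob (R : realType) (m sigma : R) (f : R -> \bar R) :
  measurable_fun setT f -> (forall x, (0 <= f x)%E) ->
  (\int[normal_prob m sigma]_x f x =
   \int[lebesgue_measure]_x (f x * (normal_pdf m sigma x)%:E))%E.
Proof.
move=> mf f0.
have dom := normal_prob_dominates m sigma.
rewrite -(Radon_Nikodym_SigmaFinite.change_of_variables dom f0 measurableT mf).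
apply: ae_eq_integral => //.
- apply: emeasurable_funM => //.
  exact: measurable_int (Radon_Nikodym_SigmaFinite.f_integrable dom).
- apply: emeasurable_funM => //; apply/measurable_EFinP.
  exact: measurable_normal_pdf.
- apply: ae_eqe_mul2l; apply: integral_ae_eq => //.
  + exact: Radon_Nikodym_SigmaFinite.f_integrable.
  + by apply/measurable_EFinP; exact: measurable_normal_pdf.
  + move=> E _ mE.
    by rewrite -Radon_Nikodym_SigmaFinite.f_integral.
Qed.

(** Completing the square turns the integrand times the density into a multiple of the normal
    density of variance [sigma ^+ 2 / q]. The shift [c] stands for the other summands of a linear
    form, so that coordinates can be integrated out one by one. *)
Lemma normal_expR_sqr (R : realType) (sigma a s c : R) :
  0 < sigma -> 0 < 1 - 2 * s * (a ^+ 2 * sigma ^+ 2) ->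
  (\int[normal_prob 0 sigma]_x (expR (s * (c + a * x) ^+ 2))%:E)%E =
  ((Num.sqrt (1 - 2 * s * (a ^+ 2 * sigma ^+ 2)))^-1 *
   expR (s / (1 - 2 * s * (a ^+ 2 * sigma ^+ 2)) * c ^+ 2))%:E.
Proof.
move=> s0; set q := 1 - _ => q0.
have sq0 : 0 < Num.sqrt q by rewrite sqrtr_gt0.
have sq2 : Num.sqrt q ^+ 2 = q by rewrite sqr_sqrtr// ltW.
pose sigma' := sigma / Num.sqrt q.
have s'0 : 0 < sigma' by rewrite divr_gt0.
have s'2 : sigma' ^+ 2 = sigma ^+ 2 / q by rewrite expr_div_n sq2.
pose m := 2 * s * a * c * sigma' ^+ 2.
have mexp : measurable_fun setT (fun x : R => expR (s * (c + a * x) ^+ 2)).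
  apply: measurableT_comp => //; apply: measurable_funM => //.
  apply: measurable_funX; apply: measurable_funD => //.
rewrite ge0_integral_normal_prob; last 2 first.
- exact/measurable_EFinP.
- by move=> x; rewrite lee_fin expR_ge0.
transitivity (\int[lebesgue_measure]_x
   (((Num.sqrt q)^-1 * expR (s / q * c ^+ 2))%:E * (normal_pdf m sigma' x)%:E))%E.
  apply: eq_integral => x _; rewrite -!EFinM; congr EFin.
  rewrite !normal_pdfE ?gt_eqF// /normal_fun /normal_peak.
  have peakE : (Num.sqrt (sigma ^+ 2 * pi *+ 2))^-1 =
      (Num.sqrt q)^-1 * (Num.sqrt (sigma' ^+ 2 * pi *+ 2))^-1.
    rewrite -invfM -sqrtrM ?(ltW q0)// s'2; congr (Num.sqrt _)^-1.
    by rewrite -!mulrnAr; field; rewrite gt_eqF.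
  rewrite peakE; set P1 := (_ q)^-1; set P2 := (_ (sigma' ^+ 2 * pi *+ 2))^-1.
  transitivity (P1 * P2 * (expR (s * (c + a * x) ^+ 2) *
      expR (- (x - 0) ^+ 2 / (sigma ^+ 2 *+ 2)))); first by ring.
  transitivity (P1 * P2 * (expR (s / q * c ^+ 2) *
      expR (- (x - m) ^+ 2 / (sigma' ^+ 2 *+ 2)))); last by ring.
  congr (_ * _); rewrite -!expRD; congr expR.
  rewrite /m s'2; have : 1 - 2 * s * (a ^+ 2 * sigma ^+ 2) != 0 by rewrite gt_eqF.
  by rewrite /q => qn0; field; rewrite exprMn qn0 gt_eqF.
rewrite ge0_integralZl//.
- by rewrite integral_normal_pdf mule1.
- by apply/measurable_EFinP; exact: measurable_normal_pdf.
- by move=> x _; rewrite lee_fin normal_pdf_ge0.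
Qed.

(** After division by [P D] this is uniqueness of the product measure. Keeping the event [D] in the
    formula replaces conditioning and allows independence to be used inductively. *)
Lemma pair_law (R : realType) d (T : measurableType d) (P : probability T R)
    (D : set T) (W V : T -> R) (al be : probability (measurableTypeR R) R) :
  measurable D -> measurable_fun setT W -> measurable_fun setT V ->
  (forall A B : set R, measurable A -> measurable B ->
    P (D `&` (W @^-1` A `&` V @^-1` B)) = (P D * (al A * be B))%E) ->
  forall X : set (R * R), measurable X ->
    P (D `&` (fun w => (W w, V w)) @^-1` X) = (P D * (al \x be) X)%E.
Proof.
move=> mD mW mV rect X mX.
have mWV : measurable_fun setT (fun w => (W w, V w)) by exact/measurable_fun_pair.
have mpre (A : set (R * R)) : measurable A ->
    measurable ((fun w => (W w, V w)) @^-1` A).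
  by move=> mA; rewrite -[X in measurable X]setTI; exact: mWV.
have [PD0|PD0] := eqVneq (P D) 0%E.
  rewrite PD0 mul0e; apply/eqP; rewrite eq_le measure_ge0 andbT -PD0.
  apply: le_measure; rewrite ?inE//.
  by apply: measurableI => //; exact: mpre.
have PDfin : P D \is a fin_num by exact: fin_num_measure.
pose p : R := fine (P D).
have pE : P D = p%:E by rewrite fineK.
have p0 : 0 < p by rewrite fine_gt0// lt0e PD0 measure_ge0/= ltey_eq PDfin.
have pi0 : 0 <= p^-1 by rewrite invr_ge0 ltW.
(* The measure structure of [pushforward] takes the measurability proof as an
   extra argument, which [pose] abstracts over. *)
pose WV : T -> (measurableTypeR R * measurableTypeR R)%type := fun w => (W w, V w).
pose m'_ := mscale (NngNum pi0) (pushforward (mrestr P mD) WV).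
pose m' : {measure set (measurableTypeR R * measurableTypeR R) -> \bar R} :=
  m'_ mWV.
have m'E A : m' A = (p^-1%:E * P (D `&` (fun w => (W w, V w)) @^-1` A))%E.
  by rewrite /m' /m'_ /mscale /= /pushforward /mrestr setIC.
have := @product_measure_unique _ _ _ _ R al be m'.
move=> /(_ _ X mX) ->; last first.
  move=> A B mA mB; rewrite m'E.
  rewrite (_ : _ @^-1` _ = W @^-1` A `&` V @^-1` B)//.
  by rewrite rect// pE muleA -EFinM mulVf ?gt_eqF// mul1e.
by rewrite m'E pE muleA -EFinM mulfV ?gt_eqF// mul1e.
Qed.

(* [D] is independent of the family [(X i)_(i in A)], whose members are
   mutually independent with law [nu]. *)
Definition indep_on (R : realType) d (T : measurableType d)
    (P : probability T R) (I : finType) (X : I -> {RV P >-> R})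
    (nu : probability (measurableTypeR R) R) (D : set T) (A : {set I}) : Prop :=
  forall B : I -> set R, (forall i, measurable (B i)) ->
    P (D `&` \bigcap_(i in [set` A]) (X i @^-1` B i)) =
    (P D * \prod_(i in A) nu (B i))%E.

Lemma RV_preimage_measurable (R : realType) d (T : measurableType d)
    (P : probability T R) (X : {RV P >-> R}) (B : set R) :
  measurable B -> measurable (X @^-1` B).
Proof. by move=> mB; rewrite -[X in measurable X]setTI; exact: measurable_funP. Qed.

Lemma bigcap_RV_measurable (R : realType) d (T : measurableType d)
    (P : probability T R) (I : finType) (X : I -> {RV P >-> R}) (A : {set I})
    (B : I -> set R) :
  (forall i, measurable (B i)) ->
  measurable (\bigcap_(i in [set` A]) (X i @^-1` B i)).
Proof.
move=> mB; apply: fin_bigcap_measurable => [|i _]; last exact: RV_preimage_measurable.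
exact: finite_finset.
Qed.

(** Moves some variables of the family into the event; the remaining ones are independent of the
    enlarged event. *)
Lemma indep_on_split (R : realType) d (T : measurableType d)
    (P : probability T R) (I : finType) (X : I -> {RV P >-> R})
    (nu : probability (measurableTypeR R) R) (D : set T) (A A' : {set I})
    (B : I -> set R) :
  A' \subset A -> indep_on X nu D A -> (forall i, measurable (B i)) ->
  P (D `&` \bigcap_(i in [set` A']) (X i @^-1` B i)) =
    (P D * \prod_(i in A') nu (B i))%E /\
  indep_on X nu (D `&` \bigcap_(i in [set` A']) (X i @^-1` B i)) (A :\: A')%SET.
Proof.
move=> /fintype.subsetP A'A indep mB.
have PA' : P (D `&` \bigcap_(i in [set` A']) (X i @^-1` B i)) =
    (P D * \prod_(i in A') nu (B i))%E.
  pose B1 i := if i \in A' then B i else setT.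
  have mB1 i : measurable (B1 i) by rewrite /B1; case: ifP.
  have := indep B1 mB1.
  rewrite (_ : \bigcap_(i in [set` A]) _ = \bigcap_(i in [set` A']) (X i @^-1` B i)).
    move=> ->; congr (_ * _)%E; rewrite (big_setID A') /=.
    rewrite [X in (_ * X)%E]big1 ?mule1; last first.
      by move=> i; rewrite inE /B1 => /andP[/negbTE -> _]; rewrite probability_setT.
    have -> : (A :&: A' = A')%SET by apply/finset.setIidPr/fintype.subsetP.
    by apply: eq_bigr => i iA'; rewrite /B1 iA'.
  apply/seteqP; split=> w h i /= iA.
    by have := h i (A'A _ iA); rewrite /B1 iA.
  rewrite /B1; case: ifPn => // iA'; exact: h.
split=> // B' mB'; rewrite PA'.
pose B1 i := if i \in A' then B i else B' i.
have mB1 i : measurable (B1 i) by rewrite /B1; case: ifP.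
have := indep B1 mB1.
rewrite (_ : \bigcap_(i in [set` A]) _ = \bigcap_(i in [set` A']) (X i @^-1` B i)
    `&` \bigcap_(i in [set` (A :\: A')%SET]) (X i @^-1` B' i)).
  rewrite setIA => ->; rewrite -muleA; congr (_ * _)%E; rewrite (big_setID A') /=.
  have -> : (A :&: A' = A')%SET by apply/finset.setIidPr/fintype.subsetP.
  congr (_ * _)%E.
    by apply: eq_bigr => i iA'; rewrite /B1 iA'.
  by apply: eq_bigr => i; rewrite inE /B1 => /andP[/negbTE ->].
apply/seteqP; split=> [w h|w [h1 h2] i /= iA].
  split=> i /= iA.
    by have := h i (A'A _ iA); rewrite /B1 iA.
  move: iA; rewrite inE => /andP[iA' iA].
  by have := h i iA; rewrite /B1 (negbTE iA').
rewrite /B1; case: ifPn => iA'; first exact: h1.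
by apply: h2; rewrite /= inE iA' iA.
Qed.

Lemma fubini_EFin (R : realType) (al be : probability (measurableTypeR R) R)
    (f : R * R -> R) : measurable_fun setT f -> (forall x, 0 <= f x) ->
  (\int[al \x be]_x (f x)%:E = \int[be]_y \int[al]_x (f (x, y))%:E)%E.
Proof.
move=> mf f0; rewrite (@fubini_tonelli2 _ _ _ _ R al be (EFin \o f))//.
exact/measurable_EFinP.
Qed.

(** The form is not shown to be normal: its law [ga] is built as an image of a product measure, and
    only the exponential moments of its shifted square are recorded, which is what the norm
    requires. One [ga] serves every event [D], so that other rows may later sit in [D]. *)
Lemma linear_form_law (R : realType) d (T : measurableType d)
    (P : probability T R) (I : finType) (X : I -> {RV P >-> R}) (sigma : R)
    (a : I -> R) (l : seq I) : 0 < sigma -> uniq l ->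
  exists ga : probability (measurableTypeR R) R,
    (forall D, measurable D -> indep_on X (normal_prob 0 sigma) D [set i in l]%SET ->
       forall A : set R, measurable A ->
         P (D `&` (fun w => \sum_(i <- l) a i * X i w) @^-1` A) = (P D * ga A)%E) /\
    (forall s c, let q := 1 - 2 * s * (\sum_(i <- l) a i ^+ 2 * sigma ^+ 2) in
       0 < q ->
       (\int[ga]_w (expR (s * (c + w) ^+ 2))%:E)%E =
       ((Num.sqrt q)^-1 * expR (s / q * c ^+ 2))%:E).
Proof.
move=> s0; elim: l => [_|i l ih /andP[il lu]].
  exists (\d_ (0 : measurableTypeR R)); split.
    move=> D mD _ A mA.
    under eq_fun do rewrite big_nil.
    rewrite preimage_cst /= /dirac indicE; case: (0 \in A).
      by rewrite setIT mule1.
    by rewrite setI0 measure0 mule0.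
  move=> s c q _; rewrite integral_dirac//; last first.
    apply/measurable_EFinP; apply: measurableT_comp => //.
    apply: measurable_funM => //; apply: measurable_funX.
    exact: measurable_funD.
  rewrite /= /dirac indicE in_setT mul1e addr0.
  by rewrite /q big_nil mulr0 subr0 sqrtr1 invr1 mul1r mulr1.
have [ga [gaL gaI]] := ih lu.
pose f (x : R * R) : R := a i * x.2 + x.1.
have mf : measurable_fun setT f.
  by apply: measurable_funD => //; apply: measurable_funM.
pose fm : {mfun (measurableTypeR R * measurableTypeR R)%type >-> measurableTypeR R} :=
  HB.pack (f : measurableTypeR R * measurableTypeR R -> measurableTypeR R)
    (isMeasurableFun.Build _ _ (measurableTypeR R * measurableTypeR R)%type
      (measurableTypeR R) _ mf).
exists (distribution (ga \x normal_prob 0 sigma)%E fm); split.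
  move=> D mD indep A mA.
  have mW : measurable_fun setT (fun w => \sum_(j <- l) a j * X j w).
    by apply: measurable_sum => j; apply: measurable_funM.
  have sub : [set i]%SET \subset [set j in i :: l]%SET.
    by rewrite finset.sub1set !inE eqxx.
  have rect (A1 B1 : set R) : measurable A1 -> measurable B1 ->
      P (D `&` ((fun w => \sum_(j <- l) a j * X j w) @^-1` A1 `&` X i @^-1` B1)) =
      (P D * (ga A1 * normal_prob 0 sigma B1))%E.
    move=> mA1 mB1.
    have [P1 ind1] := indep_on_split sub indep (fun _ => mB1).
    have E : \bigcap_(j in [set` [set i]%SET]) X j @^-1` B1 = X i @^-1` B1.
      apply/seteqP; split => [w /(_ i) h|w h j]; first by apply: h; rewrite /= inE.
      by rewrite /= inE => /eqP ->.
    move: P1 ind1; rewrite E big_set1 => P1 ind1.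
    rewrite (setIC _ (X i @^-1` _)) setIA gaL//.
    + by rewrite P1 -muleA (muleC (ga A1)).
    + by apply: measurableI => //; exact: RV_preimage_measurable.
    + suff -> : [set j in l]%SET = ([set j in i :: l] :\: [set i])%SET by [].
      apply/setP => j; rewrite !inE; case: eqVneq => [->|//].
      by rewrite (negbTE il).
  have := pair_law mD mW (measurable_funP (X i)) rect.
  move=> /(_ (f @^-1` A)) <-; last first.
    by rewrite -[X in measurable X]setTI; exact: (mf measurableT A mA).
  congr (P (_ `&` _)); apply/seteqP; split => w /=; rewrite /f /= big_cons//.
move=> s c q q0.
have mexp (s' c' : R) : measurable_fun setT (fun w : R => expR (s' * (c' + w) ^+ 2)).
  apply: measurableT_comp => //; apply: measurable_funM => //.
  by apply: measurable_funX; apply: measurable_funD.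
rewrite ge0_integral_distribution; last 2 first.
- by apply/measurable_EFinP; exact: mexp.
- by move=> y; rewrite lee_fin expR_ge0.
rewrite (_ : _ \o _ = fun x => (expR (s * (c + f x) ^+ 2))%:E)//.
rewrite fubini_EFin; last 2 first.
- exact: (measurableT_comp (mexp s c) mf).
- by move=> x; exact: expR_ge0.
set q1 := 1 - 2 * s * (\sum_(j <- l) a j ^+ 2 * sigma ^+ 2).
have S0 : 0 <= \sum_(j <- l) a j ^+ 2 * sigma ^+ 2.
  by apply: sumr_ge0 => j _; rewrite -exprMn sqr_ge0.
have qE : q = q1 - 2 * s * (a i ^+ 2 * sigma ^+ 2).
  by rewrite /q /q1 big_cons mulrDr; ring.
(* Dropping a summand preserves positivity: for [s > 0] the quantity only grows, and for [s <= 0] it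
   is at least 1. *)
have q10 : 0 < q1.
  have [sneg|spos] := leP s 0.
    by rewrite /q1; have := mulr_le0_ge0 sneg S0; lra.
  rewrite (lt_le_trans q0)// qE lerBlDr lerDl -exprMn mulr_ge0 ?sqr_ge0//.
  by rewrite mulr_ge0// ltW.
have q2E : 1 - 2 * (s / q1) * (a i ^+ 2 * sigma ^+ 2) = q / q1.
  by rewrite qE; field; rewrite gt_eqF.
have q20 : 0 < 1 - 2 * (s / q1) * (a i ^+ 2 * sigma ^+ 2).
  by rewrite q2E divr_gt0.
transitivity (\int[normal_prob 0 sigma]_y
    (((Num.sqrt q1)^-1)%:E * (expR (s / q1 * (c + a i * y) ^+ 2))%:E))%E.
  apply: eq_integral => y _; rewrite /f /=.
  under eq_integral do rewrite addrA.
  by rewrite gaI// EFinM.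
rewrite ge0_integralZl//; last first.
  apply/measurable_EFinP; apply: measurableT_comp => //; apply: measurable_funM => //.
  by apply: measurable_funX; apply: measurable_funD => //; exact: measurable_funM.
rewrite normal_expR_sqr// q2E -EFinM; congr EFin.
rewrite mulrA -invfM -sqrtrM ?(ltW q10)//; congr (_ * expR (_ * _)).
  by rewrite mulrC divfK// gt_eqF.
by field; rewrite !gt_eqF.
Qed.

(** The rows are independent copies of one linear form, so each contributes a factor [q ^ (-1/2)].
    The induction absorbs one row into [D] and applies the hypothesis to the others. *)
Lemma sum_sqr_rows_law (R : realType) dd (T : measurableType dd)
    (P : probability T R) (t d : nat) (X : 'I_t * 'I_d -> {RV P >-> R})
    (sigma : R) (u : 'cV[R]_d) (l : seq 'I_t) : 0 < sigma -> uniq l ->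
  exists ze : probability (measurableTypeR R) R,
    (forall D, measurable D ->
       indep_on X (normal_prob 0 sigma) D [set i | i.1 \in l]%SET ->
       forall A : set R, measurable A ->
         P (D `&` (fun w => \sum_(r <- l) (\sum_j u j 0 * X (r, j) w) ^+ 2) @^-1` A) =
         (P D * ze A)%E) /\
    (forall s, let q := 1 - 2 * s * (dot u u * sigma ^+ 2) in
       0 < q ->
       (\int[ze]_w (expR (s * w))%:E)%E = ((Num.sqrt q)^-1 ^+ size l)%:E).
Proof.
move=> s0; elim: l => [_|r l ih /andP[rl lu]].
  exists (\d_ (0 : measurableTypeR R)); split.
    move=> D mD _ A mA.
    under eq_fun do rewrite big_nil.
    rewrite preimage_cst /= /dirac indicE; case: (0 \in A).
      by rewrite setIT mule1.
    by rewrite setI0 measure0 mule0.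
  move=> s q _; rewrite integral_dirac//; last first.
    apply/measurable_EFinP; apply: measurableT_comp => //.
  by rewrite /= /dirac indicE in_setT mul1e mulr0 expR0 expr0.
have [ze [zeL zeI]] := ih lu.
pose lr := [seq (r, j) | j <- enum 'I_d].
have lru : uniq lr by rewrite map_inj_uniq ?enum_uniq// => a b [].
pose a (i : 'I_t * 'I_d) := u i.2 0.
have [ga [gaL gaI]] := linear_form_law X a s0 lru.
pose Y w := \sum_j u j 0 * X (r, j) w.
have YE w : \sum_(i <- lr) a i * X i w = Y w by rewrite big_map big_enum.
pose Z w := \sum_(r' <- l) (\sum_j u j 0 * X (r', j) w) ^+ 2.
have mRow r' : measurable_fun setT (fun w => \sum_j u j 0 * X (r', j) w).
  by apply: measurable_sum => j; apply: measurable_funM.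
have mZ : measurable_fun setT Z.
  by apply: measurable_sum => r'; apply: measurable_funX.
pose f (x : R * R) : R := x.2 ^+ 2 + x.1.
have mf : measurable_fun setT f.
  by apply: measurable_funD => //; apply: measurable_funX.
pose fm : {mfun (measurableTypeR R * measurableTypeR R)%type >-> measurableTypeR R} :=
  HB.pack (f : measurableTypeR R * measurableTypeR R -> measurableTypeR R)
    (isMeasurableFun.Build _ _ (measurableTypeR R * measurableTypeR R)%type
      (measurableTypeR R) _ mf).
exists (distribution (ze \x ga)%E fm); split.
  move=> D mD indep A mA.
  pose El := [set i : 'I_t * 'I_d | i.1 \in l]%SET.
  pose Er := [set i : 'I_t * 'I_d | i \in lr]%SET.
  have lrE i : (i \in lr) = (i.1 == r).
    apply/mapP/eqP => [[j _ ->]//|ir]; exists i.2; first by rewrite mem_enum.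
    by rewrite -ir -surjective_pairing.
  have subl : El \subset [set i | i.1 \in r :: l]%SET.
    by apply/fintype.subsetP => i; rewrite !inE => ->; rewrite orbT.
  have subr : Er \subset [set i | i.1 \in r :: l]%SET.
    by apply/fintype.subsetP => i; rewrite !inE lrE => ->.
  have Dr : ([set i | i.1 \in r :: l] :\: El)%SET = Er.
    apply/setP => i; rewrite !inE lrE; case: eqVneq => [->|_] /=.
      by rewrite rl.
    by case: (_ \in l).
  have Dl : ([set i | i.1 \in r :: l] :\: Er)%SET = El.
    apply/setP => i; rewrite !inE lrE; case: eqVneq => [->|_] //=.
    by rewrite (negbTE rl).
  have indr : indep_on X (normal_prob 0 sigma) D Er.
    move=> B mB; exact: (indep_on_split subr indep mB).1.
  have mY B1 : measurable B1 -> measurable (Y @^-1` B1).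
    by move=> mB1; rewrite -[X in measurable X]setTI; exact: (mRow r).
  have PY B1 D' : measurable B1 -> measurable D' ->
      indep_on X (normal_prob 0 sigma) D' Er ->
      P (D' `&` Y @^-1` B1) = (P D' * ga B1)%E.
    move=> mB1 mD' ind'; rewrite -gaL//; congr (P (_ `&` _)).
    by apply/seteqP; split=> w /=; rewrite YE.
  have rect (A1 B1 : set R) : measurable A1 -> measurable B1 ->
      P (D `&` (Z @^-1` A1 `&` Y @^-1` B1)) = (P D * (ze A1 * ga B1))%E.
    move=> mA1 mB1.
    rewrite (setIC (Z @^-1` _)) setIA zeL//.
    - by rewrite PY// -muleA (muleC (ze A1)).
    - by apply: measurableI => //; exact: mY.
    - move=> B mB; rewrite PY//.
      have [PDB indB] := indep_on_split subl indep mB.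
      rewrite Dr in indB.
      rewrite -setIA (setIC (Y @^-1` _)) setIA PY//.
        by rewrite PDB -muleA (muleC (\prod_(i in _) _)%E) muleA.
      by apply: measurableI => //; exact: bigcap_RV_measurable.
  have := pair_law mD mZ (mRow r) rect.
  move=> /(_ (f @^-1` A)) <-; last first.
    by rewrite -[X in measurable X]setTI; exact: (mf measurableT A mA).
  congr (P (_ `&` _)); apply/seteqP; split => w /=; rewrite /f /= big_cons//.
move=> s q q0.
have mexp : measurable_fun setT (fun w : R => expR (s * w)).
  by apply: measurableT_comp => //; apply: measurable_funM.
rewrite ge0_integral_distribution; last 2 first.
- by apply/measurable_EFinP; exact: mexp.
- by move=> y; rewrite lee_fin expR_ge0.
rewrite (_ : _ \o _ = fun x => (expR (s * f x))%:E)//.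
rewrite fubini_EFin; last 2 first.
- exact: (measurableT_comp mexp mf).
- by move=> x; exact: expR_ge0.
have qE : q = 1 - 2 * s * (\sum_(i <- lr) a i ^+ 2 * sigma ^+ 2).
  have -> : \sum_(i <- lr) a i ^+ 2 * sigma ^+ 2 = dot u u * sigma ^+ 2.
    by rewrite /lr big_map big_enum /= -mulr_suml.
  by [].
transitivity (\int[ga]_y (((Num.sqrt q)^-1 ^+ size l)%:E *
    (expR (s * (0 + y) ^+ 2))%:E))%E.
  apply: eq_integral => y _; rewrite /f /= add0r.
  transitivity (\int[ze]_x ((expR (s * y ^+ 2))%:E * (expR (s * x))%:E))%E.
    by apply: eq_integral => x _; rewrite mulrDr expRD EFinM.
  rewrite ge0_integralZl//; last by apply/measurable_EFinP; exact: mexp.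
  by rewrite zeI// muleC.
have sq0 : 0 <= (Num.sqrt q)^-1 by rewrite invr_ge0 sqrtr_ge0.
rewrite ge0_integralZl//; last first.
  apply/measurable_EFinP; apply: measurableT_comp => //; apply: measurable_funM => //.
  by apply: measurable_funX; apply: measurable_funD.
by rewrite gaI -?qE// expr0n mulr0 expR0 mulr1 -EFinM exprSr.
Qed.

Lemma measurable_sqr_image (R : realType) dd (T : measurableType dd)
    (P : probability T R) (t d : nat) (G : 'I_t * 'I_d -> {RV P >-> R})
    (u : 'cV[R]_d) :
  measurable_fun setT
    (fun w => dot (random_matrix G w *m u) (random_matrix G w *m u)).
Proof.
apply: measurable_sum => r.
have m1 : measurable_fun setT (fun w => (random_matrix G w *m u) r 0).
  under eq_fun do rewrite mxE.
  apply: measurable_sum => j; apply: measurable_funM => //.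
  rewrite (_ : (fun _ => _) = G (r, j)); first exact: measurable_funP.
  by apply/funext => w; rewrite mxE.
exact: measurable_funM.
Qed.

Lemma gaussian_mgf (R : realType) dd (T : measurableType dd)
    (P : probability T R) (t d : nat) (G : 'I_t * 'I_d -> {RV P >-> R})
    (u : 'cV[R]_d) (s : R) : (0 < t)%N -> iid_gaussian_entries G ->
  let q := 1 - 2 * s * (dot u u / t%:R) in 0 < q ->
  (\int[P]_w (expR (s * dot (random_matrix G w *m u) (random_matrix G w *m u)))%:E)%E =
  ((Num.sqrt q)^-1 ^+ t)%:E.
Proof.
move=> t0 [indG lawG] q q0.
pose sigma : R := Num.sqrt t%:R^-1.
have s0 : 0 < sigma by rewrite sqrtr_gt0 invr_gt0 ltr0n.
have sigma2 : sigma ^+ 2 = t%:R^-1 by rewrite sqr_sqrtr// invr_ge0.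
have [ze [zeL zeI]] := sum_sqr_rows_law G u s0 (enum_uniq 'I_t).
have ind : indep_on G (normal_prob 0 sigma) setT [set i | i.1 \in enum 'I_t]%SET.
  move=> B mB; rewrite setTI probability_setT mul1e indG//.
  by apply: eq_bigr => i _; exact: (lawG i (B i) (mB i)).
have mS : measurable_fun setT (fun w => \sum_(r <- enum 'I_t) (\sum_j u j 0 * G (r, j) w) ^+ 2).
  by apply: measurable_sum => r; apply: measurable_funX; apply: measurable_sum => j;
    apply: measurable_funM.
pose Zm : {mfun T >-> measurableTypeR R} :=
  HB.pack ((fun w => \sum_(r <- enum 'I_t) (\sum_j u j 0 * G (r, j) w) ^+ 2) :
     T -> measurableTypeR R) (isMeasurableFun.Build _ _ T (measurableTypeR R) _ mS).
have mexp : measurable_fun setT (fun w : R => expR (s * w)).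
  by apply: measurableT_comp => //; apply: measurable_funM.
transitivity (\int[distribution P Zm]_y (expR (s * y))%:E)%E.
  rewrite ge0_integral_distribution; last 2 first.
  - by apply/measurable_EFinP; exact: mexp.
  - by move=> y; rewrite lee_fin expR_ge0.
  apply: eq_integral => w _ /=; congr (expR (s * _))%:E.
  rewrite big_enum /=; apply: eq_bigr => r _; rewrite -expr2; congr (_ ^+ 2).
  by rewrite mxE; apply: eq_bigr => j _; rewrite mxE mulrC.
transitivity (\int[ze]_y (expR (s * y))%:E)%E.
  apply: eq_measure_integral => A mA _.
  have := zeL setT measurableT ind A mA.
  by rewrite setTI probability_setT mul1e.
by rewrite zeI sigma2 ?size_enum_ord.
Qed.

(** * Markov bounds for the random map *)

Lemma sqr_image_mgf_le (R : realType) dd (T : measurableType dd)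
    (P : probability T R) (t d : nat) (G : 'I_t * 'I_d -> {RV P >-> R})
    (u : 'cV[R]_d) (a c : R) : (0 < t)%N -> iid_gaussian_entries G ->
  u != 0 -> a <= 4^-1 ->
  (\int[P]_w (expR (a * t%:R * (dot (random_matrix G w *m u)
      (random_matrix G w *m u) / dot u u - c)))%:E
   <= (expR (a * t%:R * (1 - c) + 4 * a ^+ 2 * t%:R))%:E)%E.
Proof.
move=> t0 iid u0 a4.
have N0 : 0 < dot u u by rewrite lt_def dot_eq0 u0 dot_ge0.
have tR : 0 < t%:R :> R by rewrite ltr0n.
pose q := 1 - 2 * (a * t%:R / dot u u) * (dot u u / t%:R).
have qE : q = 1 - 2 * a by rewrite /q; field; rewrite !gt_eqF.
have q0 : 0 < q by rewrite qE; lra.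
have mgf := gaussian_mgf t0 iid q0.
rewrite (_ : (fun w => _) = (fun w => (expR (- (a * t%:R * c)))%:E *
   (expR (a * t%:R / dot u u * dot (random_matrix G w *m u)
      (random_matrix G w *m u)))%:E)%E); last first.
  apply/funext => w; rewrite -EFinM -expRD; congr (expR _)%:E.
  by field; rewrite gt_eqF.
rewrite ge0_integralZl//; last first.
  apply/measurable_EFinP; apply: measurableT_comp => //; apply: measurable_funM => //.
  exact: measurable_sqr_image.
rewrite mgf -EFinM lee_fin -/q.
have sq0 : 0 < Num.sqrt q by rewrite sqrtr_gt0.
(* Squared, this follows from [(1 - 2 a) (1 + 2 a + 8 a^2) = 1 + 4 a^2 (1 - 4 a) >= 1], which is
   where [a <= 1/4] enters. Negative [a] is allowed, so both tails are covered. *)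
have h : (Num.sqrt q)^-1 <= expR (a + 4 * a ^+ 2).
  rewrite -ler_sqr ?nnegrE ?invr_ge0 ?sqrtr_ge0 ?expR_ge0//.
  rewrite exprVn sqr_sqrtr ?(ltW q0)// -expRM_natl.
  rewrite (le_trans _ (expR_ge1Dx _))// qE -[leLHS]mul1r ler_pdivrMr ?qE// -?qE//.
  rewrite qE; have := mulr_ge0 (sqr_ge0 a) (_ : 0 <= 1 - 4 * a); nra.
rewrite (_ : a * t%:R * (1 - c) + 4 * a ^+ 2 * t%:R =
  - (a * t%:R * c) + t%:R * (a + 4 * a ^+ 2)); last by ring.
rewrite expRD ler_wpM2l ?expR_ge0// expRM_natl.
by rewrite lerXn2r ?nnegrE ?invr_ge0 ?sqrtr_ge0 ?expR_ge0.
Qed.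

(** An unlikely event is represented by a nonnegative random variable that is at least 1 on it and
    has small mean. Means add under arbitrary weights, and the event itself never has to be shown
    measurable. *)
Definition mean_le (R : realType) dd (T : measurableType dd)
    (P : probability T R) (f : T -> R) (b : R) : Prop :=
  [/\ measurable_fun setT f, forall w, 0 <= f w &
      (\int[P]_w (f w)%:E <= b%:E)%E].

Lemma mean_le_const0 (R : realType) dd (T : measurableType dd)
    (P : probability T R) b : 0 <= b -> mean_le P (fun=> 0) b.
Proof.
by move=> b0; split => //; rewrite integral0 lee_fin.
Qed.

Lemma mean_leD (R : realType) dd (T : measurableType dd) (P : probability T R)
    f g a b :
  mean_le P f a -> mean_le P g b -> mean_le P (fun w => f w + g w) (a + b).
Proof.
move=> [mf f0 fa] [mg g0 gb]; split.
- exact: measurable_funD.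
- by move=> w; rewrite addr_ge0.
under eq_integral do rewrite EFinD.
rewrite ge0_integralD//.
- by rewrite EFinD leeD.
- by move=> w _; rewrite lee_fin.
- exact/measurable_EFinP.
- by move=> w _; rewrite lee_fin.
- exact/measurable_EFinP.
Qed.

Lemma mean_leZ (R : realType) dd (T : measurableType dd) (P : probability T R)
    f a c :
  0 <= c -> mean_le P f a -> mean_le P (fun w => c * f w) (c * a).
Proof.
move=> c0 [mf f0 fa]; split.
- exact: measurable_funM.
- by move=> w; rewrite mulr_ge0.
under eq_integral do rewrite EFinM.
rewrite ge0_integralZl//.
- by rewrite EFinM lee_wpmul2l.
- exact/measurable_EFinP.
- by move=> w _; rewrite lee_fin.
Qed.

Lemma mean_le_sum (R : realType) dd (T : measurableType dd) (P : probability T R)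
    (I : Type) (r : seq I) (f : I -> T -> R) (b : I -> R) :
  (forall i, mean_le P (f i) (b i)) ->
  mean_le P (fun w => \sum_(i <- r) f i w) (\sum_(i <- r) b i).
Proof.
move=> h; elim: r => [|i r ih].
  under eq_fun do rewrite big_nil.
  by rewrite big_nil; exact: mean_le_const0.
under eq_fun do rewrite big_cons.
by rewrite big_cons; exact: mean_leD.
Qed.

Lemma mean_le_mono (R : realType) dd (T : measurableType dd)
    (P : probability T R) f a b :
  a <= b -> mean_le P f a -> mean_le P f b.
Proof. by move=> ab [mf f0 fa]; split => //; rewrite (le_trans fa)// lee_fin. Qed.

Lemma mean_le_markov (R : realType) dd (T : measurableType dd)
    (P : probability T R) f b (E : set T) :
  mean_le P f b -> (forall w, f w < 1 -> E w) -> with_prob_ge P (1 - b) E.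
Proof.
move=> [mf f0 fb] fE.
have mA : measurable [set w | 1 <= f w].
  have -> : [set w | 1 <= f w] = setT `&` f @^-1` `[1, +oo[%classic.
    by rewrite setTI; apply/seteqP; split=> w /=; rewrite in_itv/= andbT.
  exact: (mf measurableT _ (measurable_itv _)).
exists (~` [set w | 1 <= f w]); split.
- exact: measurableC.
- by move=> w /= /negP; rewrite -ltNge; exact: fE.
rewrite probability_setC// EFinB leeB// (le_trans _ fb)//.
rewrite -[X in (P X <= _)%E]setIT -integral_indic//.
apply: ge0_le_integral => //.
- by apply/measurable_EFinP; exact: measurable_indic.
- exact/measurable_EFinP.
move=> w _; rewrite lee_fin indicE.
by case: (boolP (w \in _)) => //; rewrite inE.
Qed.

(** Chernoff's method for both tails, with exponents [a = eps / 8] and [a = - eps / 8]: the linear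
    gain [eps^2 t / 8] exceeds the quadratic loss [4 a^2 t] by [eps^2 t / 16]. *)
Lemma distortion_mean (R : realType) dd (T : measurableType dd)
    (P : probability T R) (t d : nat) (G : 'I_t * 'I_d -> {RV P >-> R})
    (u : 'cV[R]_d) (eps : R) : (0 < t)%N -> iid_gaussian_entries G ->
  0 < eps -> eps <= 1 ->
  exists F, mean_le P F (2 * expR (- (eps ^+ 2 * t%:R / 16))) /\
    forall w, F w < 1 ->
      `|dot (random_matrix G w *m u) (random_matrix G w *m u) - dot u u|
      <= eps * dot u u.
Proof.
move=> t0 iid e0 e1.
have [->|u0] := eqVneq u 0.
  exists (fun=> 0); split; first by apply: mean_le_const0; rewrite mulr_ge0 ?expR_ge0.
  by move=> w _; rewrite mulmx0 !dot0l subr0 normr0 mulr0.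
have N0 : 0 < dot u u by rewrite lt_def dot_eq0 u0 dot_ge0.
pose y w := dot (random_matrix G w *m u) (random_matrix G w *m u).
pose E (a c : R) w := expR (a * t%:R * (y w / dot u u - c)).
have mE a c : measurable_fun setT (E a c).
  apply: measurableT_comp => //; apply: measurable_funM => //.
  apply: measurable_funB => //; apply: measurable_funM => //.
  exact: measurable_sqr_image.
exists (fun w => E (eps / 8) (1 + eps) w + E (- (eps / 8)) (1 - eps) w); split.
  rewrite mulr_natl mulr2n; apply: mean_leD; split => //.
  - by move=> w; exact: expR_ge0.
  - rewrite (le_trans (sqr_image_mgf_le _ t0 iid u0 _))//; first by lra.
    by rewrite lee_fin ler_expR; lra.
  - by move=> w; exact: expR_ge0.
  - rewrite (le_trans (sqr_image_mgf_le _ t0 iid u0 _))//; first by lra.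
    by rewrite lee_fin ler_expR; lra.
move=> w Fw.
have tR : 0 < t%:R :> R by rewrite ltr0n.
have et0 : 0 < eps / 8 * t%:R by rewrite mulr_gt0// divr_gt0.
have h1 : y w / dot u u < 1 + eps.
  rewrite ltNge; apply/negP => h.
  have E1 : 1 <= E (eps / 8) (1 + eps) w.
    by rewrite /E -[leLHS]expR0 ler_expR; apply: mulr_ge0 (ltW et0) _; rewrite subr_ge0.
  by move: Fw; rewrite ltNge => /negP; apply; apply: ler_wpDr => //; exact: expR_ge0.
have h2 : 1 - eps < y w / dot u u.
  rewrite ltNge; apply/negP => h.
  have E1 : 1 <= E (- (eps / 8)) (1 - eps) w.
    rewrite /E -[leLHS]expR0 ler_expR !mulNr -mulrN opprB.
    by apply: mulr_ge0 (ltW et0) _; rewrite subr_ge0.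
  by move: Fw; rewrite ltNge => /negP; apply; apply: ler_wpDl => //; exact: expR_ge0.
move: h1 h2; rewrite ltr_pdivrMr// ltr_pdivlMr// -/(y w) ler_norml => h1 h2.
by apply/andP; split; lra.
Qed.

Lemma gram_schmidt2 (R : realType) m (a b : 'cV[R]_m) :
  exists e1 e2 : 'cV[R]_m, [/\ dot e1 e2 = 0,
    e1 = 0 \/ dot e1 e1 = 1, e2 = 0 \/ dot e2 e2 = 1 &
    exists al be ga, a = al *: e1 /\ b = be *: e1 + ga *: e2].
Proof.
have normalize (v : 'cV[R]_m) : exists e r, (e = 0 \/ dot e e = 1) /\
    v = r *: e /\ (forall x, dot v x = 0 -> dot e x = 0).
  have [->|v0] := eqVneq v 0.
    exists 0, 0; split; [by left|split; first by rewrite scaler0].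
    by move=> x _; rewrite dot0l.
  have n0 : norm2 v != 0 by rewrite norm2_eq0.
  exists ((norm2 v)^-1 *: v), (norm2 v); split.
    by right; rewrite !dotE -norm2_sqr; field.
  split; first by rewrite scalerA divff// scale1r.
  by move=> x; rewrite dotZl => ->; rewrite mulr0.
have [e1 [al [e1P [aE _]]]] := normalize a.
have [e2 [ga [e2P [bE orth]]]] := normalize (b - dot b e1 *: e1).
exists e1, e2; split => //.
  rewrite dotC; apply: orth; rewrite !dotE.
  by case: e1P => ->; rewrite ?dot0r ?mulr0 ?mulr1 ?subr0 ?subrr.
by exists al, (dot b e1), ga; split => //; rewrite -bE addrC subrK.
Qed.

(* By polarization, the distortion of the cross term is controlled by the
   distortion of [e1 + e2] and [e1 - e2]. *)
Lemma frame_noncontracting (R : realType) t d (M : 'M[R]_(t, d))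
    (e1 e2 : 'cV[R]_d) (eps : R) (al be : R) :
  0 <= eps -> dot e1 e2 = 0 ->
  e1 = 0 \/ dot e1 e1 = 1 -> e2 = 0 \/ dot e2 e2 = 1 ->
  (forall u, u \in [:: e1; e2; e1 + e2; e1 - e2] ->
     `|dot (M *m u) (M *m u) - dot u u| <= eps * dot u u) ->
  let y := al *: e1 + be *: e2 in
  (1 - 2 * eps) * dot y y <= dot (M *m y) (M *m y).
Proof.
move=> eps0 orth e1P e2P dist /=.
have := dist e1; have := dist e2; have := dist (e1 + e2); have := dist (e1 - e2).
rewrite !inE !eqxx !orbT => /(_ isT) + /(_ isT) + /(_ isT) + /(_ isT).
rewrite !mulmxDr !mulmxN -!scalemxAr !dotE (dotC e2 e1) orth.
rewrite (dotC (M *m e2) (M *m e1)).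
case: e1P => [->|->]; case: e2P => [->|->];
  rewrite ?mulmx0 ?dot0l ?dot0r !ler_norml.
- by move=> *; lra.
- by move=> _ _ /andP[h _] _; have := mulr_ge0 (sqr_ge0 be) eps0;
    have := ler_wpM2l (sqr_ge0 be) h; lra.
- by move=> _ _ _ /andP[h _]; have := mulr_ge0 (sqr_ge0 al) eps0;
    have := ler_wpM2l (sqr_ge0 al) h; lra.
move=> /andP[h1 h2] /andP[h3 h4] /andP[h5 _] /andP[h7 _].
set c := dot (M *m e1) (M *m e2) in h1 h2 h3 h4 *.
have cN : - eps <= c <= eps by apply/andP; split; lra.
have /andP[c1 c2] := cN.
have := ler_wpM2l (sqr_ge0 al) h7; have := ler_wpM2l (sqr_ge0 be) h5.
have [ab|ab] := leP 0 (al * be).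
  have := ler_wpM2l ab c1; have := mulr_ge0 eps0 (sqr_ge0 (al - be)); lra.
have := ler_wnM2l (ltW ab) c2; have := mulr_ge0 eps0 (sqr_ge0 (al + be)); lra.
Qed.

(** An orthonormal frame reduces a whole plane to the four vectors [f1], [f2], [f1 + f2], [f1 - f2],
    with two tails each, hence the 8. Zero frame vectors cover degenerate planes. *)
Lemma plane_noncontracting_mean (R : realType) dd (T : measurableType dd)
    (P : probability T R) (t d : nat) (G : 'I_t * 'I_d -> {RV P >-> R})
    (a b : 'cV[R]_d) (eps : R) : (0 < t)%N -> iid_gaussian_entries G ->
  0 < eps -> eps <= 1 ->
  exists F, mean_le P F (8 * expR (- (eps ^+ 2 * t%:R / 16))) /\
    forall w, F w < 1 -> forall al be, let y := al *: a + be *: b in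
      (1 - 2 * eps) * dot y y <=
      dot (random_matrix G w *m y) (random_matrix G w *m y).
Proof.
move=> t0 iid e0 e1.
have [f1 [f2 [orth f1P f2P [al0 [be0 [ga0 [aE bE]]]]]]] := gram_schmidt2 a b.
have /choice[F HF] := fun u : 'cV[R]_d => distortion_mean u t0 iid e0 e1.
pose fr := [:: f1; f2; f1 + f2; f1 - f2].
exists (fun w => \sum_(u <- fr) F u w); split.
  have -> : 8 * expR (- (eps ^+ 2 * t%:R / 16)) =
      \sum_(u <- fr) 2 * expR (- (eps ^+ 2 * t%:R / 16)).
    by rewrite /fr !big_cons big_nil; ring.
  by apply: mean_le_sum => u; case: (HF u).
move=> w Fw al be /=.
have -> : al *: a + be *: b = (al * al0 + be * be0) *: f1 + (be * ga0) *: f2.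
  by rewrite aE bE scalerDr !scalerA addrA -scalerDl.
apply: frame_noncontracting => //; first exact: ltW.
move=> u uf; have [[_ F0 _] h] := HF u; apply: h.
apply: le_lt_trans Fw; rewrite (big_rem u)//= lerDl.
by apply: sumr_ge0 => v _; case: (HF v) => [[]].
Qed.

(** A negative exponential moment: the variable equals 1 when [u] is sent to 0, and [s] is tuned so
    that its mean is [B ^ (- t)], at most [1 / B]. Since [B] is arbitrary, the kernel is avoided
    with any prescribed probability below 1. *)
Lemma kernel_mean (R : realType) dd (T : measurableType dd)
    (P : probability T R) (t d : nat) (G : 'I_t * 'I_d -> {RV P >-> R})
    (u : 'cV[R]_d) (B : R) : (0 < t)%N -> iid_gaussian_entries G ->
  u != 0 -> 1 <= B ->
  exists F, mean_le P F B^-1 /\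
    forall w, F w < 1 -> random_matrix G w *m u != 0.
Proof.
move=> t0 iid u0 B1.
have N0 : 0 < dot u u by rewrite lt_def dot_eq0 u0 dot_ge0.
have tR : 0 < t%:R :> R by rewrite ltr0n.
have B0 : 0 < B by rewrite (lt_le_trans ltr01).
pose s := (1 - B ^+ 2) / 2 * (t%:R / dot u u).
have qE : 1 - 2 * s * (dot u u / t%:R) = B ^+ 2.
  by rewrite /s; field; rewrite !gt_eqF.
exists (fun w => expR (s * dot (random_matrix G w *m u) (random_matrix G w *m u))).
split; last first.
  move=> w; apply: contraTneq => ->; rewrite dot0l mulr0 expR0 ltxx //.
split.
- apply: measurableT_comp => //; apply: measurable_funM => //.
  exact: measurable_sqr_image.
- by move=> w; exact: expR_ge0.
rewrite gaussian_mgf// qE ?exprn_gt0// sqrtr_sqr gtr0_norm// lee_fin.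
by rewrite exprVn lef_pV2 ?posrE ?exprn_gt0// ler_eXnr.
Qed.

Lemma injective_mean (R : realType) dd (T : measurableType dd)
    (P : probability T R) (t d : nat) (G : 'I_t * 'I_d -> {RV P >-> R})
    (I : finType) (x : I -> 'cV[R]_d) (p : R) :
  (0 < t)%N -> iid_gaussian_entries G -> injective x -> 0 < p ->
  exists F, mean_le P F p /\
    forall w, F w < 1 -> injective (fun i => random_matrix G w *m x i).
Proof.
move=> t0 iid xinj p0.
pose n := #|[set: I * I]%SET|.
pose B : R := 1 + n%:R / p.
have B1 : 1 <= B by rewrite /B lerDl divr_ge0// ltW.
have B0 : 0 < B by rewrite (lt_le_trans ltr01).
have /choice[F HF] : forall ij : I * I, exists F, mean_le P F B^-1 /\
    forall w, F w < 1 -> ij.1 != ij.2 ->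
      random_matrix G w *m x ij.1 != random_matrix G w *m x ij.2.
  move=> [i j]; have [->|ij] /= := eqVneq i j.
    exists (fun=> 0); split; last by move=> w; rewrite eqxx.
    by apply: mean_le_const0; rewrite invr_ge0 ltW.
  have xij : x i - x j != 0.
    by rewrite subr_eq0; apply: contra ij => /eqP /xinj ->.
  have [F [HF1 HF2]] := kernel_mean t0 iid xij B1.
  exists F; split => // w /HF2 h _.
  by rewrite -subr_eq0 -mulmxBr.
exists (fun w => \sum_(ij <- enum [set: I * I]%SET) F ij w); split.
  apply: (@mean_le_mono _ _ _ _ _ (\sum_(ij <- enum [set: I * I]%SET) B^-1)).
    rewrite big_const_seq count_predT -cardE iter_addr_0 -mulr_natl.
    rewrite ler_pdivrMr// /B mulrDr mulr1 mulrC divfK ?gt_eqF//.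
    by rewrite lerDr ltW.
  by apply: mean_le_sum => ij; case: (HF ij).
move=> w Fw i j Mij; apply/eqP/negPn/negP => ij.
have [[_ F0 _] h] := HF (i, j); have := h w _ ij; rewrite /= Mij eqxx.
suff lt1 : F (i, j) w < 1 by move=> /(_ lt1).
apply: le_lt_trans Fw; rewrite (big_rem (i, j)) ?mem_enum ?inE//= lerDl.
by apply: sumr_ge0 => kl _; case: (HF kl) => [[]].
Qed.

(** Let [rho] be the stretch of [u] and [h = 1 + eps / 2]. Where [rho > h], the bound
    [ln r <= (r^2 - 1) / 2] for [r = rho / h], together with [z / 2 <= eps t / 8], dominates [r ^ z]
    by the exponential used for the upper tail. So the [z]-th power has a controlled mean, and sums
    of residuals follow by linearity. *)
Lemma expansion_mean (R : realType) dd (T : measurableType dd)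
    (P : probability T R) (t d : nat) (G : 'I_t * 'I_d -> {RV P >-> R})
    (u : 'cV[R]_d) (eps z : R) : (0 < t)%N -> iid_gaussian_entries G ->
  0 < eps -> eps <= 1 -> 1 <= z -> z / 2 <= eps / 8 * t%:R ->
  exists F, mean_le P F (expR (- (eps ^+ 2 * t%:R / 16))) /\
    forall w, norm2 (random_matrix G w *m u) `^ z <=
      (1 + eps / 2) `^ z * (1 + F w) * norm2 u `^ z.
Proof.
move=> t0 iid e0 e1 z1 zt; have z0 : 0 <= z by rewrite (le_trans ler01).
have [->|u0] := eqVneq u 0.
  exists (fun=> 0); split; first by apply: mean_le_const0; rewrite expR_ge0.
  by move=> w; rewrite mulmx0 !norm20 powR0 ?mulr0// gt_eqF// (lt_le_trans ltr01).
have N0 : 0 < dot u u by rewrite lt_def dot_eq0 u0 dot_ge0.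
have n0 : 0 < norm2 u by rewrite lt_def norm2_eq0 u0 norm2_ge0.
pose y w := dot (random_matrix G w *m u) (random_matrix G w *m u).
exists (fun w => expR (eps / 8 * t%:R * (y w / dot u u - (1 + eps)))); split.
  split.
  - apply: measurableT_comp => //; apply: measurable_funM => //.
    apply: measurable_funB => //; apply: measurable_funM => //.
    exact: measurable_sqr_image.
  - by move=> w; exact: expR_ge0.
  - rewrite (le_trans (sqr_image_mgf_le _ t0 iid u0 _))//; first by lra.
    by rewrite lee_fin ler_expR; lra.
move=> w; set xi := expR _.
have xi0 : 0 <= xi by exact: expR_ge0.
pose rho := norm2 (random_matrix G w *m u) / norm2 u.
have rho0 : 0 <= rho by rewrite divr_ge0 ?norm2_ge0.
have rho2 : rho ^+ 2 = y w / dot u u by rewrite expr_div_n !norm2_sqr.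
have -> : norm2 (random_matrix G w *m u) = rho * norm2 u.
  by rewrite /rho divfK// gt_eqF.
rewrite powRM ?norm2_ge0// ler_wpM2r ?powR_ge0//.
pose h := 1 + eps / 2.
have h1 : 1 <= h by rewrite lerDl divr_ge0// ltW.
have h0 : 0 < h by rewrite (lt_le_trans ltr01).
rewrite -/h.
have [rh|rh] := leP rho h.
  apply: (@le_trans _ _ (h `^ z)).
    by apply: ge0_ler_powR; rewrite ?nnegrE// ltW.
  by rewrite ler_peMr ?powR_ge0// lerDl.
pose r' := rho / h.
have r'1 : 1 < r' by rewrite ltr_pdivlMr// mul1r.
have r'0 : 0 < r' by rewrite (lt_trans ltr01).
have -> : rho = h * r' by rewrite /r' mulrC divfK// gt_eqF.
rewrite powRM ?(ltW h0) ?(ltW r'0)// ler_wpM2l ?powR_ge0//.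
apply: ler_wpDl => //.
rewrite /powR gt_eqF// /xi ler_expR -rho2.
have lnr : ln r' <= (r' ^+ 2 - 1) / 2.
  have : 2 * ln r' <= r' ^+ 2 - 1.
    have -> : 2 * ln r' = ln (1 + (r' ^+ 2 - 1)).
      by rewrite addrC subrK lnXn// mulr_natl.
    by apply: le_ln1Dx; have := exprn_gt0 2 r'0; lra.
  lra.
have r2 : r' ^+ 2 - 1 <= rho ^+ 2 - (1 + eps).
  have hh : 1 + eps <= h ^+ 2 by rewrite /h; have := sqr_ge0 eps; nra.
  have rE : rho ^+ 2 = h ^+ 2 * r' ^+ 2.
    by rewrite -exprMn /r' [h * _]mulrC divfK// gt_eqF.
  have : 0 <= (h ^+ 2 - 1) * (r' ^+ 2 - 1).
    by rewrite mulr_ge0// subr_ge0 exprn_ege1// ltW.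
  lra.
have r20 : 0 <= r' ^+ 2 - 1 by rewrite subr_ge0 exprn_ege1// ltW.
apply: (@le_trans _ _ (z * ((r' ^+ 2 - 1) / 2))); first by rewrite ler_wpM2l.
have -> : z * ((r' ^+ 2 - 1) / 2) = z / 2 * (r' ^+ 2 - 1) by ring.
by apply: ler_pM => //; rewrite divr_ge0.
Qed.

(** Each of the three properties is controlled by a variable of mean at most [1 / 100]; thus 800 is
    [8 * 100] and 400 is [4 * 100]. The 4 reserves a factor [1 + eps / 4] for the total excess,
    which fits with [(1 + eps / 2) ^ z] under [(1 + eps) ^ z]. *)
Lemma good_event (R : realType) dd (T : measurableType dd)
    (P : probability T R) (t d : nat) (G : 'I_t * 'I_d -> {RV P >-> R})
    (I : finType) (x b : I -> 'cV[R]_d) (mu : I -> R) (eps eps1 z delta : R) :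
  (0 < t)%N -> iid_gaussian_entries G -> injective x ->
  (forall i, 0 <= mu i) -> 0 < eps -> eps <= 1 -> 0 < eps1 -> eps1 < 2^-1 ->
  1 <= z -> z / 2 <= eps / 8 * t%:R -> 0 < delta ->
  0 < \sum_i norm2 (b i) `^ z ->
  400 * expR (- (eps ^+ 2 * t%:R / 16)) <= eps ->
  800 * expR (- (eps1 ^+ 2 * t%:R / 16)) * (\sum_i mu i) ^+ 3 <= delta ^+ 3 ->
  with_prob_ge P (9 / 10) [set w | let M := random_matrix G w in
    [/\ injective (fun i => M *m x i),
        \sum_i norm2 (M *m b i) `^ z <= (1 + eps) `^ z * \sum_i norm2 (b i) `^ z &
        \sum_i \sum_j \sum_l mu i * mu j * mu l *
          (~~ `[< noncontracting (1 - 2 * eps1)^-1 M x i j l >])%:R <= delta ^+ 3]].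
Proof.
move=> t0 iid xinj mu0 e0 e1 e10 e11 z1 zt d0 O0 he he1.
have z0 : 0 <= z by rewrite (le_trans ler01).
set O := \sum_i norm2 (b i) `^ z in O0 *.
set eta := expR (- (eps ^+ 2 * t%:R / 16)) in he.
set eta1 := expR (- (eps1 ^+ 2 * t%:R / 16)) in he1.
have [F3 [F3m F3i]] := @injective_mean R dd T P t d G I x 100^-1 t0 iid xinj (ltac:(by [])).
have /choice[F2 HF2] := fun i => @expansion_mean R dd T P t d G (b i) eps z t0 iid e0 e1 z1 zt.
have e11' : eps1 <= 1 by lra.
have /choice[F1 HF1] : forall ijl : I * I * I, exists F,
    mean_le P F (8 * eta1) /\
    forall w, F w < 1 ->
      noncontracting (1 - 2 * eps1)^-1 (random_matrix G w) x ijl.1.1 ijl.1.2 ijl.2.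
  move=> [[i j] l] /=.
  have [F [Fm FF]] := plane_noncontracting_mean (x i - x l) (x j - x l) t0 iid e10 e11'.
  exists F; split => // w /FF h a1 a2 a3 a0 /=.
  have -> : a1 *: x i + a2 *: x j + a3 *: x l =
      a1 *: (x i - x l) + a2 *: (x j - x l).
    have -> : a3 = - a1 - a2 by lra.
    by apply/matrixP => u v; rewrite !mxE; ring.
  rewrite ler_pdivlMl; last by lra.
  exact: h.
pose S1 w := (delta ^+ 3)^-1 * \sum_i \sum_j \sum_l mu i * mu j * mu l * F1 (i, j, l) w.
pose S2 w := 4 / (eps * O) * \sum_i norm2 (b i) `^ z * F2 i w.
have d3 : 0 < delta ^+ 3 by rewrite exprn_gt0.
have eO : 0 < eps * O by rewrite mulr_gt0.
have S1m : mean_le P S1 (100^-1).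
  apply: (@mean_le_mono _ _ _ _ _ ((delta ^+ 3)^-1 *
     \sum_i \sum_j \sum_l mu i * mu j * mu l * (8 * eta1))).
    rewrite ler_pdivrMl//.
    have -> : \sum_i \sum_j \sum_l mu i * mu j * mu l * (8 * eta1) =
        8 * eta1 * (\sum_i mu i) ^+ 3.
      rewrite !exprS expr0 mulr1 mulr_suml mulr_sumr; apply: eq_bigr => i _.
      rewrite mulr_suml !mulr_sumr; apply: eq_bigr => j _.
      rewrite !mulr_sumr; apply: eq_bigr => l _; ring.
    by move: he1; lra.
  apply: mean_leZ; first by rewrite invr_ge0 ltW.
  apply: mean_le_sum => i; apply: mean_le_sum => j; apply: mean_le_sum => l.
  by apply: mean_leZ; [rewrite !mulr_ge0|case: (HF1 (i, j, l))].
have S2m : mean_le P S2 (100^-1).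
  apply: (@mean_le_mono _ _ _ _ _ (4 / (eps * O) * \sum_i norm2 (b i) `^ z * eta)).
    rewrite -mulr_suml -/O mulrAC ler_pdivrMr//.
    by have := ler_wpM2r (ltW O0) he; lra.
  apply: mean_leZ; first by rewrite divr_ge0// ltW.
  apply: mean_le_sum => i.
  by apply: mean_leZ; [exact: powR_ge0|case: (HF2 i)].
have S1p w : 0 <= S1 w by case: S1m.
have S2p w : 0 <= S2 w by case: S2m.
have F3p w : 0 <= F3 w by case: F3m.
have Sm := mean_leD (mean_leD S1m S2m) F3m.
have pE : 9 / 10 = 1 - 10^-1 :> R by field.
rewrite pE; apply: (mean_le_markov (mean_le_mono _ Sm)); first by lra.
move=> w Sw /=.
have s1 : S1 w < 1 by move: Sw (S2p w) (F3p w); lra.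
have s2 : S2 w < 1 by move: Sw (S1p w) (F3p w); lra.
have s3 : F3 w < 1 by move: Sw (S1p w) (S2p w); lra.
split; first exact: F3i.
- apply: (@le_trans _ _ (\sum_i (1 + eps / 2) `^ z * (1 + F2 i w) * norm2 (b i) `^ z)).
    by apply: ler_sum => i _; case: (HF2 i).
  have -> : \sum_i (1 + eps / 2) `^ z * (1 + F2 i w) * norm2 (b i) `^ z =
      (1 + eps / 2) `^ z * (O + \sum_i norm2 (b i) `^ z * F2 i w).
    by rewrite /O -big_split /= mulr_sumr; apply: eq_bigr => i _; ring.
  have s2' : \sum_i norm2 (b i) `^ z * F2 i w <= eps / 4 * O.
    by move: s2; rewrite /S2 mulrAC ltr_pdivrMr//; lra.
  apply: (@le_trans _ _ ((1 + eps / 2) `^ z * ((1 + eps / 4) * O))).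
    by rewrite ler_wpM2l ?powR_ge0//; lra.
  rewrite mulrA ler_wpM2r ?(ltW O0)//.
  apply: (@le_trans _ _ ((1 + eps / 2) `^ z * (1 + eps / 4) `^ z)).
    rewrite ler_wpM2l ?powR_ge0//; apply: le1r_powR => //.
    by rewrite lerDl divr_ge0// ltW.
  rewrite -powRM; [|by rewrite addr_ge0// divr_ge0// ltW..].
  apply: ge0_ler_powR; rewrite ?nnegrE//.
  + by rewrite mulr_ge0// addr_ge0// divr_ge0// ltW.
  + by rewrite addr_ge0// ltW.
  + by nra.
- apply: (@le_trans _ _ (\sum_i \sum_j \sum_l mu i * mu j * mu l * F1 (i, j, l) w)).
    apply: ler_sum => i _; apply: ler_sum => j _; apply: ler_sum => l _.
    rewrite ler_wpM2l ?mulr_ge0//.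
    have [[_ F10 _] h] := HF1 (i, j, l).
    have [f1|f1] := ltP (F1 (i, j, l) w) 1.
      by have /asboolP -> := h w f1; exact: F10.
    by apply: le_trans f1; case: (~~ _).
  by move: s1; rewrite /S1 ltr_pdivrMl// mulr1 => /ltW.
Qed.

(** * Choice of the parameters *)

(** Ensures [ln 3 > 1], so that [ln (ln n)] is bounded below by a positive constant for [n >= 3]. *)
Lemma expR1_lt3 (R : realType) : expR 1 < 3 :> R.
Proof.
have h : expR (6^-1) <= 6 / 5 :> R.
  have h1 : 5 / 6 <= expR (- 6^-1) :> R.
    by rewrite (le_trans _ (expR_ge1Dx _))//; lra.
  rewrite -[leLHS]invrK -expRN -[leRHS]invrK lef_pV2 ?posrE ?expR_gt0//.
  by rewrite (le_trans _ h1)//; lra.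
have -> : (1 : R) = 6%:R * 6^-1 by field.
rewrite expRM_natl (@le_lt_trans _ _ ((6 / 5) ^+ 6))//.
  by rewrite lerXn2r ?nnegrE ?expR_ge0.
lra.
Qed.

Lemma expR1_ge2 (R : realType) : 2 <= expR 1 :> R.
Proof. by have := expR_ge1Dx (1 : R); lra. Qed.

(* Every quantity to be compared is bounded by a fixed power of
   [E = (ln n) ^ k * e ^ z / eps]. *)
Lemma parameter_choice (R : realType) : exists C : R, 0 < C /\
  forall (n k t : nat) (z eps : R), (3 <= n)%N -> (0 < k)%N -> 1 <= z ->
    0 < eps -> eps < 1 -> (0 < t)%N ->
    C * ((k%:R * ln (ln n%:R) + z + ln (1 / eps)) / eps ^+ 3) <= t%:R ->
  exists (delta : R) (N : nat),
    [/\ 0 < delta, z / 2 <= eps / 8 * t%:R,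
        400 * expR (- (eps ^+ 2 * t%:R / 16)) <= eps &
    [/\ 800 * expR (- ((eps / 10) ^+ 2 * t%:R / 16)) *
          (1 + k%:R * ((3 * 2 ^ k)%:R * (1 + ln n%:R))) ^+ 3 <= delta ^+ 3,
        2 * (1 + 2 * (eps / 10)) ^+ 2 < N%:R * ((eps / 10) ^+ 2 / 8) &
        2 * 20 `^ z * (k%:R * ((N.+2%:R + N.+2%:R ^+ 2) * delta) + delta)
          <= eps / 20]].
Proof.
have e3 := expR1_lt3 R.
have l3 : 1 < ln (3 : R).
  by rewrite -[ltLHS](expRK 1) ltr_ln ?posrE ?expR_gt0.
(* From [2 < (ln 3) ^ p] one gets [2 ^ k <= (ln n) ^ (p k) <= E ^ p]: this is how [k * ln (ln n)]
   pays for the factor [2 ^ k]. *)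
have [p Hp] := exprn_unbounded 2 l3.
(* The exponent [m] is [(10 + 3 (2 p + 5)) + 3 (p + 42)]: the first part covers 800 times the cubed
   mass, the second is [delta ^+ 3]. *)
have [m mE] : exists m, m = (9 * p + 151)%N by exists (9 * p + 151)%N.
have m1 : 1 <= m%:R :> R by rewrite ler1n mE addnC.
(* Here 1600 is [16 * 10 ^ 2], since the triples are tested with accuracy [eps / 10]. *)
exists (1600 * m%:R); split; first by lra.
move=> n k t z eps n3 k0 z1 eps0 eps1 t0 ht.
have tR : 0 < t%:R :> R by rewrite ltr0n.
have l3n : ln (3 : R) <= ln n%:R by rewrite ler_ln ?posrE ?ltr0n ?ler_nat// (leq_trans _ n3).
have ln1 : 1 < ln (n%:R : R) by exact: lt_le_trans l3 l3n.
have lln0 : 0 < ln (ln (n%:R : R)) by rewrite ln_gt0.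
have le0 : 0 <= ln (1 / eps) by rewrite ln_ge0// ler_pdivlMr// mul1r ltW.
have kl0 : 0 <= k%:R * ln (ln n%:R) :> R by rewrite mulr_ge0// ltW.
set W := k%:R * ln (ln n%:R) + z + ln (1 / eps) in ht.
have [E EE] : exists E, E = expR W by exists (expR W).
have zW : z <= W by rewrite /W; lra.
have W1 : 1 <= W by exact: le_trans zW.
have E2 : 2 <= E by rewrite EE (le_trans (expR1_ge2 R))// ler_expR.
have E1 : 1 <= E by lra.
have E0 : 0 < E by lra.
have EX i : 0 <= E ^+ i by apply: exprn_ge0; exact: ltW.
have Emono i j : (i <= j)%N -> E ^+ i <= E ^+ j by move=> ij; rewrite ler_weXn2l.
have two i : 2 ^+ i <= E ^+ i by rewrite lerXn2r ?nnegrE// ltW.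
have Ez : expR z <= E by rewrite EE ler_expR.
have Eeps : 1 / eps <= E.
  rewrite -[leLHS](@lnK R) ?posrE ?divr_gt0// EE ler_expR /W; lra.
have Ek : ln n%:R ^+ k <= E :> R.
  rewrite -[ln n%:R](@lnK R) ?posrE; last by lra.
  by rewrite EE -expRM_natl ler_expR /W; lra.
have Eln : ln n%:R <= E :> R.
  by rewrite (le_trans _ Ek)// ler_eXnr// ltW.
have E2k : 2 ^+ k <= E ^+ p :> R.
  rewrite (@le_trans _ _ ((ln n%:R ^+ p) ^+ k))//.
    rewrite lerXn2r ?nnegrE ?exprn_ge0//; first by lra.
    rewrite (le_trans (ltW Hp))// lerXn2r ?nnegrE//; lra.
  by rewrite exprAC lerXn2r ?nnegrE ?exprn_ge0//; lra.
have Ekk : k%:R <= E ^+ p :> R.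
  rewrite (le_trans _ E2k)// -natrX ler_nat; exact: ltnW (ltn_expl k _).
have E20 : 20 `^ z <= E ^+ 5.
  have e20 : 20 <= expR 5 :> R.
    have -> : expR 5 = expR 1 ^+ 5 :> R by rewrite -expRM_natl mulr1.
    rewrite (@le_trans _ _ (2 ^+ 5))//; first by lra.
    by rewrite lerXn2r ?nnegrE ?expR_ge0// expR1_ge2.
  rewrite (@le_trans _ _ ((expR 5) `^ z))//.
    by apply: ge0_ler_powR; rewrite ?nnegrE ?expR_ge0//; lra.
  by rewrite -expRM expRM_natl lerXn2r ?nnegrE ?expR_ge0// ltW.
have ht3 : 1600 * (m%:R * W) <= t%:R * eps ^+ 3.
  by move: ht; rewrite mulrA ler_pdivrMr ?exprn_gt0// -mulrA.
have e32 : t%:R * eps ^+ 3 <= t%:R * eps ^+ 2.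
  by rewrite ler_pM2l// exprS ler_piMl ?sqr_ge0// ltW.
have e21 : t%:R * eps ^+ 2 <= t%:R * eps.
  by rewrite ler_pM2l// expr2 ler_piMl// ltW.
have mW : W <= m%:R * W by rewrite ler_peMl// (le_trans _ W1).
have et : m%:R * W <= eps ^+ 2 * t%:R / 1600.
  lra.
have eta : expR (- (eps ^+ 2 * t%:R / 1600)) <= (E ^+ m)^-1.
  by rewrite EE -expRM_natl -expRN ler_expR lerN2.
have EV i j : (i <= j)%N -> E ^+ i * (E ^+ j)^-1 <= (E ^+ (j - i))^-1.
  move=> ij; rewrite -{1}(subnK ij) exprD invfM mulrCA mulfV ?mulr1//.
  by rewrite expf_neq0// gt_eqF.
have epsE : E^-1 <= eps.
  by rewrite -[leRHS]invrK lef_pV2 ?posrE ?invr_gt0//; move: Eeps; rewrite mul1r.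
(* The exponent 42 + [p] is [6 + (p + 30) + 6]: the factor [2 * 20 ^ z], then [k] times the
   polynomial in [N], and a reserve [E ^ -6] that is below [eps / 20]. *)
pose a := (p + 42)%N.
pose delta := (E ^+ a)^-1.
(* With [N > 3200 / eps^2] the right-hand side [N * eps^2 / 800] exceeds 4, while the left-hand side
   is at most [2 * 1.2 ^ 2]. *)
have [Q QE] : exists Q : R, Q = 3200 by exists 3200.
have Q0 : 0 <= Q by lra.
pose N := (Num.truncn (Q / eps ^+ 2)).+1.
have N0 : 0 <= Q / eps ^+ 2 := divr_ge0 Q0 (sqr_ge0 _).
have /andP[Nl Nu] := truncn_itv N0.
exists delta, N; split.
- by rewrite invr_gt0 exprn_gt0.
- lra.
- rewrite (@le_trans _ _ (E ^+ 9 * (E ^+ m)^-1))//.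
    rewrite ler_pM ?expR_ge0//.
      by apply: le_trans (two 9%N); clear; lra.
    rewrite (le_trans _ eta)// ler_expR lerN2.
    have h : 0 <= eps ^+ 2 * t%:R by rewrite mulr_ge0 ?sqr_ge0.
    clear -h; lra.
  apply: (le_trans (EV 9%N m _)); first by rewrite mE; clear; lia.
  rewrite (le_trans _ epsE)// lef_pV2 ?posrE ?exprn_gt0//.
  by rewrite -[leLHS]expr1 Emono// mE; clear; lia.
split.
- have h1 : (3 * 2 ^ k)%:R <= E ^+ (p + 2) :> R.
    rewrite natrM natrX mulrC exprD; apply: ler_pM => //.
    by apply: le_trans (two 2%N); clear; lra.
  have ln0 : 0 <= 1 + ln n%:R :> R by clear -ln1; lra.
  have h2 : 1 + ln n%:R <= E ^+ 2 by clear -Eln E2; nra.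
  have h30 : 0 <= k%:R * ((3 * 2 ^ k)%:R * (1 + ln n%:R)) :> R.
    by apply: mulr_ge0 => //; apply: mulr_ge0.
  have h3 : k%:R * ((3 * 2 ^ k)%:R * (1 + ln n%:R)) <= E ^+ (2 * p + 4).
    have -> : (2 * p + 4 = p + ((p + 2) + 2))%N by clear; lia.
    rewrite exprD; apply: ler_pM => //; first exact: mulr_ge0.
    by rewrite exprD; apply: ler_pM.
  have T1 : 1 + k%:R * ((3 * 2 ^ k)%:R * (1 + ln n%:R)) <= E ^+ (2 * p + 5).
    have -> : (2 * p + 5 = (2 * p + 4).+1)%N by clear; lia.
    have h4 : 1 <= E ^+ (2 * p + 4) by exact: exprn_ege1.
    rewrite exprS; have := ler_wpM2r (EX (2 * p + 4)%N) E2.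
    by clear -h3 h4; lra.
  have T0 : 0 <= 1 + k%:R * ((3 * 2 ^ k)%:R * (1 + ln n%:R)) :> R by clear -h30; lra.
  have -> : expR (- ((eps / 10) ^+ 2 * t%:R / 16)) = expR (- (eps ^+ 2 * t%:R / 1600)).
    by congr (expR (- _)); field.
  apply: (@le_trans _ _ (E ^+ 10 * (E ^+ m)^-1 * (E ^+ (2 * p + 5)) ^+ 3)).
    apply: ler_pM; [|exact: exprn_ge0| |].
    - by apply: mulr_ge0; [clear; lra|exact: expR_ge0].
    - apply: ler_pM; [by clear; lra|exact: expR_ge0| |exact: eta].
      by apply: le_trans (two 10%N); clear; lra.
    - by rewrite lerXn2r ?nnegrE.
  rewrite mulrAC -exprM -exprD.
  apply: (le_trans (EV (10 + (2 * p + 5) * 3)%N m _)); first by rewrite mE; clear; lia.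
  rewrite /delta exprVn -exprM lef_pV2 ?posrE ?exprn_gt0//.
  by apply: Emono; rewrite mE /a; clear; lia.
- have : Q < N%:R * eps ^+ 2 by move: Nu; rewrite ltr_pdivrMr ?exprn_gt0.
  have : (1 + 2 * (eps / 10)) ^+ 2 <= (12 / 10) ^+ 2.
    by rewrite lerXn2r ?nnegrE//; clear -eps0 eps1; lra.
  by rewrite expr_div_n QE; clear; lra.
- have N2 : N.+2%:R <= E ^+ 14 :> R.
    have h : N.+2%:R <= (Q + 3) / eps ^+ 2 :> R.
      have -> : N.+2%:R = (Num.truncn (Q / eps ^+ 2))%:R + 3 :> R.
        by rewrite /N -!natr1; clear; lra.
      have : 1 <= (eps ^+ 2)^-1.
        by rewrite invf_ge1 ?exprn_gt0// exprn_ile1// ltW.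
      by move: Nl; rewrite mulrDl; clear; lra.
    apply: (le_trans h); rewrite (_ : 14 = 12 + 2)%N; last by clear; lia.
    rewrite exprD -exprVn; apply: ler_pM.
    - by clear -Q0; lra.
    - by rewrite exprn_ge0// invr_ge0 ltW.
    - by apply: le_trans (two 12%N); rewrite QE; clear; lra.
    rewrite lerXn2r ?nnegrE ?invr_ge0 ?(ltW eps0) ?(ltW E0)//.
    by move: Eeps; rewrite mul1r.
  have d0 : 0 <= delta by rewrite invr_ge0.
  have N0r : 0 <= N.+2%:R :> R by exact: ler0n.
  have [NN NNE] : exists NN : R, NN = N.+2%:R by exists N.+2%:R.
  rewrite -NNE in N2 N0r *.
  have NNS : NN + NN ^+ 2 <= E ^+ 29 :> R.
    have h1 : NN ^+ 2 <= E ^+ 28 :> R.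
      rewrite (_ : 28 = 14 * 2)%N; last by clear; lia.
      by rewrite exprM lerXn2r ?nnegrE.
    have h2 := Emono 14%N 28%N isT.
    have := ler_wpM2r (EX 28%N) E2.
    by rewrite (exprS E 28%N); clear -N2 h1 h2; lra.
  have NN0 : 0 <= NN + NN ^+ 2 by apply: addr_ge0 => //; exact: sqr_ge0.
  have h0 : 0 <= k%:R * ((NN + NN ^+ 2) * delta).
    by apply: mulr_ge0; [exact: ler0n|exact: mulr_ge0].
  have h1 : k%:R * ((NN + NN ^+ 2) * delta) + delta <= E ^+ (p + 30) * delta.
    have h2 : k%:R * ((NN + NN ^+ 2) * delta) <= E ^+ (p + 29) * delta.
      rewrite exprD -mulrA; apply: ler_pM => //; first exact: mulr_ge0.
      exact: ler_wpM2r.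
    have h3 : delta <= E ^+ (p + 29) * delta by rewrite ler_peMl// exprn_ege1.
    have -> : (p + 30 = (p + 29).+1)%N by clear; lia.
    have := ler_wpM2r d0 (ler_wpM2r (EX (p + 29)%N) E2).
    by rewrite (exprS E); clear -h2 h3; lra.
  apply: (@le_trans _ _ (E ^+ 6 * (E ^+ (p + 30) * delta))).
    apply: ler_pM => //.
    - exact: addr_ge0.
    - by rewrite (exprS E 5%N); apply: ler_pM => //; exact: powR_ge0.
  rewrite mulrA -exprD.
  apply: (le_trans (EV (6 + (p + 30))%N a _)); first by rewrite /a; clear; lia.
  have -> : (a - (6 + (p + 30)) = 6)%N by rewrite /a; clear; lia.
  rewrite ler_pdivlMr; last by clear; lra.
  apply: (@le_trans _ _ ((E ^+ 6)^-1 * E ^+ 5)).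
    apply: ler_wpM2l; first by rewrite invr_ge0.
    by apply: le_trans (two 5%N); clear; lra.
  apply: le_trans epsE; rewrite mulrC; apply: (le_trans (EV 5%N 6%N isT)).
  exact: lexx.
Qed.

(** * Proof of the theorem *)

(** The map may collapse a line to a point, and then any line through that point is taken; an
    inequality between distances is enough for the upper bound. *)
Lemma image_lines (R : realType) d t k (M : 'M[R]_(t, d)) (V U : 'I_k -> 'cV[R]_d) :
  (0 < t)%N -> exists v u : 'I_k -> 'cV[R]_t, (forall l, norm2 (u l) = 1) /\
    forall l y s, ldist (v l) (u l) (M *m y) <= norm2 (M *m (y - (V l + s *: U l))).
Proof.
move=> t0.
have /choice[ua Hua] : forall l, exists ua : 'cV[R]_t * R,
    norm2 ua.1 = 1 /\ M *m U l = ua.2 *: ua.1.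
  by move=> l; have [u u1 [a E]] := unit_direction (M *m U l) t0; exists (u, a).
exists (fun l => M *m V l), (fun l => (ua l).1); split=> [l|l y s].
  by case: (Hua l).
have [u1 E] := Hua l.
have -> : M *m (y - (V l + s *: U l)) =
    M *m y - (M *m V l + (s * (ua l).2) *: (ua l).1).
  by rewrite mulmxBr mulmxDr -scalemxAr E scalerA.
exact: ldist_le.
Qed.

Lemma sum_linear_image (R : realType) d t (M : 'M[R]_(t, d)) (X : {fset 'cV[R]_d})
    (F : 'cV[R]_t -> R) : injective (fun i : X => M *m val i) ->
  \sum_(y <- linear_image M X) F y = \sum_(i : X) F (M *m val i).
Proof.
move=> inj; rewrite big_imfset/=; first by rewrite big_seq_fsetE.
move=> a b aX bX E; have := inj [` aX]%fset [` bX]%fset E.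
by move/(congr1 val).
Qed.

Lemma le_root (R : realType) (a b z : R) : 0 < z -> 0 <= a -> 0 <= b ->
  a `^ z^-1 <= b `^ z^-1 -> a <= b.
Proof.
move=> z0 a0 b0 h.
have E c : 0 <= c -> c = (c `^ z^-1) `^ z.
  by move=> c0; rewrite -powRrM mulVf ?gt_eqF// powRr1.
rewrite (E _ a0) (E _ b0).
by apply: ge0_ler_powR => //; rewrite ?nnegrE ?powR_ge0// ltW.
Qed.

Lemma powRKV (R : realType) (a z : R) : 0 <= a -> z != 0 -> (a `^ z) `^ z^-1 = a.
Proof. by move=> a0 z0; rewrite -powRrM mulfV// powRr1. Qed.

Lemma root_le_scale (R : realType) (a b c z : R) : 0 < z -> 0 <= a -> 0 <= b ->
  0 <= c -> a <= c `^ z * b -> a `^ z^-1 <= c * b `^ z^-1.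
Proof.
move=> z0 a0 b0 c0 h.
rewrite -[c in leRHS](@powRKV R c z)// ?gt_eqF// -powRM ?powR_ge0//.
apply: ge0_ler_powR => //; first by rewrite invr_ge0 ltW.
by rewrite nnegrE; exact: mulr_ge0 (powR_ge0 _ _) b0.
Qed.

Lemma sum_powR_ge0 (R : realType) (I : Type) (r : seq I) (F : I -> R) z :
  0 <= \sum_(i <- r) F i `^ z.
Proof. by apply: sumr_ge0 => i _; exact: powR_ge0. Qed.

Lemma optimal_powered (R : realType) d k (z : R) (X : {fset 'cV[R]_d})
    (V U : 'I_k -> 'cV[R]_d) D : (0 < k)%N -> 1 <= z ->
  (forall l, norm2 (U l) = 1) -> is_min_dist V U D ->
  optimal_lines z X (fun l => line (V l) (U l)) ->
  forall (v u : 'I_k -> 'cV[R]_d) D', (forall l, norm2 (u l) = 1) ->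
    is_min_dist v u D' ->
    \sum_(i : X) D (val i) `^ z <= \sum_(i : X) D' (val i) `^ z.
Proof.
move=> k0 z1 U1 HD [_ opt] v u D' u1 HD'.
have z0 : 0 < z by rewrite (lt_le_trans ltr01).
have := opt _ (fun l => @line_is_line R d (v l) (u l) (u1 l)).
rewrite (cost_min_dist _ k0 (ltW z0) U1 HD) (cost_min_dist _ k0 (ltW z0) u1 HD').
rewrite !big_seq_fsetE /=.
by apply: le_root => //; exact: sum_powR_ge0.
Qed.

(** The deterministic end of the argument: from inequalities between [z]-th powers to inequalities
    between costs. Injectivity keeps the projected sum indexed by [X], and the minimum over lines is
    witnessed by an actual optimal family. *)
Lemma optimal_cost_distortion (R : realType) d t k (z eps : R) (X : {fset 'cV[R]_d})
    (M : 'M[R]_(t, d)) (V U : 'I_k -> 'cV[R]_d) D (g : X -> 'I_k) (tau : X -> R) :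
  let b (i : X) := val i - (V (g i) + tau i *: U (g i)) in
  (0 < k)%N -> (0 < t)%N -> 1 <= z -> 0 < eps ->
  (forall l, norm2 (U l) = 1) -> is_min_dist V U D ->
  (forall i, norm2 (b i) = D (val i)) ->
  injective (fun i : X => M *m val i) ->
  \sum_i norm2 (M *m b i) `^ z <= (1 + eps) `^ z * \sum_i norm2 (b i) `^ z ->
  (forall (v u : 'I_k -> 'cV[R]_t) D', (forall l, norm2 (u l) = 1) ->
     is_min_dist v u D' ->
     \sum_i norm2 (b i) `^ z <= (1 + eps) `^ z * \sum_(i : X) D' (M *m val i) `^ z) ->
  exists L' : 'I_k -> set 'cV[R]_t,
    [/\ optimal_lines z (linear_image M X) L',
        1 / (1 + eps) * cost z X (fun l => line (V l) (U l)) <=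
          cost z (linear_image M X) L' &
        cost z (linear_image M X) L' <=
          (1 + eps) * cost z X (fun l => line (V l) (U l))].
Proof.
move=> b k0 t0 z1 eps0 U1 HD bD inj upper lower.
have z0 : 0 < z by rewrite (lt_le_trans ltr01).
have e1 : 0 < 1 + eps by rewrite addr_gt0.
have [L' HL'] := optimal_lines_exist (linear_image M X) k0 t0 z1.
exists L'; have [isL' optL'] := HL'.
have [v [u [u1 LE]]] := lines_param isL'.
have [D' HD'] := min_dist_exists v u k0.
have costX : cost z X (fun l => line (V l) (U l)) =
    (\sum_i norm2 (b i) `^ z) `^ z^-1.
  rewrite (cost_min_dist _ k0 (ltW z0) U1 HD) big_seq_fsetE /=.
  by congr (_ `^ _); apply: eq_bigr => i _; rewrite bD.
have costM (w1 w2 : 'I_k -> 'cV[R]_t) D1 :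
    (forall l, norm2 (w2 l) = 1) -> is_min_dist w1 w2 D1 ->
    cost z (linear_image M X) (fun l => line (w1 l) (w2 l)) =
    (\sum_(i : X) D1 (M *m val i) `^ z) `^ z^-1.
  move=> w1E HD1.
  by rewrite (cost_min_dist _ k0 (ltW z0) w1E HD1) sum_linear_image.
split=> //.
  rewrite LE costX (costM _ _ _ u1 HD') mul1r ler_pdivrMl//.
  apply: (root_le_scale z0 (sum_powR_ge0 _ _ _) (sum_powR_ge0 _ _ _) (ltW e1)).
  exact: (lower _ _ _ u1 HD').
have [v2 [u2 [u21 h2]]] := image_lines M V U t0.
have [D2 HD2] := min_dist_exists v2 u2 k0.
apply: (le_trans (optL' _ (fun l => @line_is_line R t (v2 l) (u2 l) (u21 l)))).
rewrite costX (costM _ _ _ u21 HD2).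
apply: (root_le_scale z0 (sum_powR_ge0 _ _ _) (sum_powR_ge0 _ _ _) (ltW e1)).
apply: le_trans upper; apply: ler_sum => i _.
apply: (ge0_ler_powR (ltW z0)).
- by rewrite nnegrE; exact: min_dist_ge0 HD2.
- by rewrite nnegrE norm2_ge0.
by apply: le_trans (h2 (g i) (val i) (tau i)); case: HD2 => _; apply.
Qed.

(** Shows that a positive optimal cost needs at least three points, the range in which the iterated
    logarithm is positive. *)
Lemma line_through_two (R : realType) d (I : finType) (x : I -> 'cV[R]_d) :
  (0 < d)%N -> (#|I| <= 2)%N ->
  exists v u, norm2 u = 1 /\ forall i, ldist v u (x i) = 0.
Proof.
move=> d0; rewrite cardE => sz.
have [a [b ab]] : exists a b : 'cV[R]_d, forall i, x i = a \/ x i = b.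
  have mI i : i \in enum I by rewrite mem_enum.
  case: (enum I) sz mI => [|i0 [|i1 [|//]]] _ mI.
  - by exists 0, 0 => i; have := mI i.
  - by exists (x i0), (x i0) => i; have := mI i; rewrite inE => /eqP ->; left.
  - exists (x i0), (x i1) => i; have := mI i.
    by rewrite !inE => /orP[/eqP ->|/eqP ->]; [left|right].
have [u u1 [s E]] := unit_direction (b - a) d0.
exists a, u; split=> // i; apply/eqP; rewrite eq_le ldist_ge0 andbT.
case: (ab i) => ->.
  by apply: (le_trans (ldist_le a a 0 u1)); rewrite scale0r addr0 subrr norm20.
apply: (le_trans (ldist_le a b s u1)).
by rewrite -E (addrC a) subrK subrr norm20.
Qed.

(** The factor [1 - theta] is compensated by [1 + e <= (1 + e) ^ z], and
    [(1 + e)^2 (1 + 3 e) <= 1 + 10 e] for [e < 1/10]; this is why the accuracy is divided by 10. *)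
Lemma distortion_constants (R : realType) (O S z eps theta : R) :
  let e := eps / 10 in
  0 < eps -> eps < 1 -> 1 <= z -> 0 <= O -> 0 <= S -> theta <= eps / 20 ->
  (1 - theta) * O <= ((1 + 2 * e + e) * (1 + e)) `^ z * S ->
  O <= (1 + eps) `^ z * S.
Proof.
move=> e eps0 eps1 z1 O0 S0 th h.
have ee : eps = 10 * e by rewrite /e; field.
move: e ee h => e ee h.
have e0 : 0 < e by lra.
have e1 : e < 1 / 10 by lra.
have c0 : 0 <= (1 + 2 * e + e) * (1 + e) by nra.
apply: (@le_trans _ _ ((1 + e) * ((1 - theta) * O))).
  by rewrite mulrA ler_peMl//; nra.
apply: (@le_trans _ _ ((1 + e) * (((1 + 2 * e + e) * (1 + e)) `^ z * S))).
  by rewrite ler_pM2l//; lra.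
rewrite mulrA; apply: ler_wpM2r => //.
apply: (@le_trans _ _ ((1 + e) `^ z * ((1 + 2 * e + e) * (1 + e)) `^ z)).
  apply: ler_wpM2r; first exact: powR_ge0.
  by apply: le1r_powR => //; lra.
rewrite -powRM//; last by lra.
apply: ge0_ler_powR; rewrite ?nnegrE; [lra|apply: mulr_ge0 => //; lra|lra|].
rewrite ee; nra.
Qed.

Theorem theorem7p1 (R : realType) :
  exists C : R, 0 < C /\
  forall (d k : nat) (z : R) (X : {fset 'cV[R]_d})
         (L : 'I_k -> set 'cV[R]_d) (eps : R) (t : nat),
    (0 < k)%N -> 1 <= z -> optimal_lines z X L ->
    0 < eps -> eps < 1 -> (0 < t)%N ->
    C * ((k%:R * ln (ln (#|` X|%:R)) + z + ln (1 / eps)) / eps ^+ 3) <= t%:R ->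
  forall (disp : measure_display) (T : measurableType disp)
         (P : probability T R) (G : 'I_t * 'I_d -> {RV P >-> R}),
    iid_gaussian_entries G ->
    with_prob_ge P (9 / 10)
      [set w | exists L' : 'I_k -> set 'cV[R]_t,
         let PiX := linear_image (random_matrix G w) X in
         [/\ optimal_lines z PiX L',
             1 / (1 + eps) * cost z X L <= cost z PiX L' &
             cost z PiX L' <= (1 + eps) * cost z X L] ].
Proof.
have [C [C0 HC]] := parameter_choice R.
exists C; split; first exact: C0.
move=> d k z X L eps t k0 z1 optL eps0 eps1 t0 ht disp T P G iidG.
have z0 : 0 < z by rewrite (lt_le_trans ltr01).
have [V [U [U1 LE]]] := lines_param optL.1.
rewrite LE in optL *.
have [D HD] := min_dist_exists V U k0.
have d0 : (0 < d)%N.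
  have := U1 (Ordinal k0); rewrite lt0n; apply: contraPN => /eqP d0.
  have -> : norm2 (U (Ordinal k0)) = 0.
    by rewrite /norm2 big1 ?sqrtr0// => -[j jd]; exfalso; rewrite d0 in jd.
  by move/eqP; rewrite eq_sym oner_eq0.
have /choice[g gE] : forall i : X, exists l, D (val i) = ldist (V l) (U l) (val i).
  by move=> i; case: HD.
pose tau (i : X) := dot (val i - V (g i)) (U (g i)).
pose b (i : X) := val i - (V (g i) + tau i *: U (g i)).
have bD i : norm2 (b i) = D (val i) by rewrite gE ldistE.
have sumE : \sum_i norm2 (b i) `^ z = \sum_(i : X) D (val i) `^ z.
  by apply: eq_bigr => i _; rewrite bD.
have optz (v u : 'I_k -> 'cV[R]_d) D' (u1 : forall l, norm2 (u l) = 1)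
    (HD' : is_min_dist v u D') :
    \sum_i norm2 (b i) `^ z <= \sum_(i : X) D' (val i) `^ z.
  by rewrite sumE; exact: (optimal_powered k0 z1 U1 HD optL u1 HD').
have injX : injective (fun i : X => val i) by exact: val_inj.
have O0 : 0 <= \sum_i norm2 (b i) `^ z by exact: sum_powR_ge0.
(* At optimal cost 0 there is nothing to normalise the sensitivities by. All residuals vanish and so
   do their images, so injectivity of the map on [X] is the only random property to secure. *)
have [Oz|On] := eqVneq (\sum_i norm2 (b i) `^ z) 0.
  have b0 i : b i = 0.
    apply/eqP; rewrite -norm2_eq0; have /eqP := Oz.
    rewrite psumr_eq0 => [/allP/(_ i)|j _]; last exact: powR_ge0.
    by rewrite mem_index_enum => /(_ isT)/=; rewrite powR_eq0 => /andP[].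
  have p0 : 0 < 1 / 10 :> R by rewrite divr_gt0.
  have [F [FP Finj]] := injective_mean t0 iidG injX p0.
  have -> : 9 / 10 = 1 - 1 / 10 :> R by field.
  apply: (mean_le_markov FP) => w /Finj inj /=.
  apply: (optimal_cost_distortion k0 t0 z1 eps0 U1 HD bD inj).
    rewrite [X in _ * X]Oz mulr0 big1// => i _.
    by rewrite -/(b i) b0 mulmx0 norm20 powR0// gt_eqF.
  move=> v u D' u1 HD'; rewrite [leLHS]Oz.
  by apply: mulr_ge0; [exact: powR_ge0|exact: sum_powR_ge0].
have Opos : 0 < \sum_i norm2 (b i) `^ z by rewrite lt_neqAle eq_sym On.
have n3 : (3 <= #|{: X}|)%N.
  rewrite leqNgt ltnS; apply: contraNN On => n2.
  have [v [u [u1 vu0]]] := line_through_two (fun i : X => val i) d0 n2.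
  have [D' HD'] := min_dist_exists (fun _ : 'I_k => v) (fun _ : 'I_k => u) k0.
  rewrite eq_le O0 andbT.
  apply: (le_trans (optz _ _ _ (fun _ => u1) HD')).
  rewrite big1 // => i _; have [l ->] := HD'.1 (val i).
  by rewrite vu0 powR0// gt_eqF.
have htX := ht; rewrite cardfE in htX.
have [delta [N [delta0 zt small [bad Nbig thsmall]]]] :=
  HC _ _ _ _ _ n3 k0 z1 eps0 eps1 t0 htX.
have [mu [mu0 muS sens]] := @line_sensitivity R d k X z V U tau g
  (fun i : X => val i) z1 (ltnW (ltnW n3)) Opos.
set e := eps / 10 in bad Nbig.
have e0 : 0 < e by rewrite divr_gt0.
have e1 : e < 1 / 10 by rewrite ltr_pM2r// invr_gt0.
have bad' : 800 * expR (- (e ^+ 2 * t%:R / 16)) * (\sum_i mu i) ^+ 3 <= delta ^+ 3.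
  apply: le_trans bad; apply: ler_wpM2l.
    by apply: mulr_ge0; [clear; lra|exact: expR_ge0].
  have mS0 : 0 <= \sum_i mu i by apply: sumr_ge0 => i _; exact: mu0.
  by rewrite lerXn2r// nnegrE// (le_trans mS0).
have e2 : e < 2^-1 by clear -e1; lra.
have [A [mA AE PA]] := good_event t0 iidG injX mu0 eps0 (ltW eps1) e0 e2 z1 zt
  delta0 Opos small bad'.
exists A; split=> // w /AE /= [inj upper badw].
apply: (optimal_cost_distortion k0 t0 z1 eps0 U1 HD bD inj upper).
move=> v' u' D' u'1 HD'.
pose c : R := (1 - 2 * e)^-1.
have c0 : 0 < c by rewrite invr_gt0; clear -e1; lra.
(* Holds because [(1 - 2 e) (1 + 2 e)^2 = (1 + 2 e) (1 - 4 e^2) > 1]; the strict gap is what the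
   power-sum argument consumes. *)
have cb : c < (1 + 2 * e) ^+ 2.
  rewrite -[c]mul1r ltr_pdivrMr; first by clear -e0 e1; nra.
  by clear -e1; lra.
have K0 : 0 <= 20 `^ z by exact: powR_ge0.
have b1 : 0 <= 1 + 2 * e by clear -e0; lra.
have := @projected_cost_lower_bound R d t k X (fun i : X => val i)
  (random_matrix G w) mu z (\sum_i norm2 (b i) `^ z) (20 `^ z) c (1 + 2 * e) e
  delta N v' u' D' k0 d0 z1 c0 b1 cb e0 delta0 K0 Nbig.
have th1 : 2 * 20 `^ z * (k%:R * ((N.+2%:R + N.+2%:R ^+ 2) * delta) + delta) <= 1.
  by apply: (le_trans thsmall); clear -eps1; lra.
move=> /(_ th1 mu0 optz sens badw u'1 HD').
apply: distortion_constants => //; exact: sum_powR_ge0.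
Qed.
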